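(* Let the downlink (DL) satellite network share spectrum with the downlink (DL) terrestrial network. For $R_{\min}^{\mathrm{s|u_s}}\le r\le R_{\max}^{\mathrm{s|u_s}}$ and $\|\mathbf x_1-\mathbf u_1^{\mathrm s}\|=r$, define the aggregated interference plus noise power $$I_{\mathrm{dn}}^{\mathrm{dn}}(r)=\sum_{\mathbf x_n\in\Phi_{\mathrm s}\cap(\mathcal A_{\mathrm{s|u_s}}\setminus\mathcal A_{\mathrm{s|u_s}}(r))}G_n^{\mathrm{s|u_s}}P_{\mathrm s}H_n^{\mathrm s}\|\mathbf x_n-\mathbf u_1^{\mathrm s}\|^{-\alpha_{\mathrm s}}+\sum_{\mathbf b_m\in\Phi_{\mathrm b}\cap\mathcal A_{\mathrm{b|u_s}}}G^{\mathrm{b|u_s}}P_{\mathrm b}H_m^{\mathrm t}\|\mathbf b_m-\mathbf u_1^{\mathrm s}\|^{-\alpha_{\mathrm t}}+\sigma^2 .$$ Then, for $s\ge0$, its conditional Laplace transform $\mathbb E\bigl[e^{-sI_{\mathrm{dn}}^{\mathrm{dn}}(r)}\,\big|\,\|\mathbf x_1-\mathbf u_1^{\mathrm s}\|=r,\ \Phi_{\mathrm s}(\mathcal A_{\mathrm{s|u_s}})\ge1\bigr]$ equals $$\exp\Biggl(-s\sigma^2-2\pi\tilde\lambda_{\mathrm{s|u_s}}\int_r^{R_{\max}^{\mathrm{s|u_s}}}\Bigl[1-\sum_{z=0}^{m_{\mathrm s}-1}\frac{\zeta(z)\Gamma(z+1)}{(\beta-c+sG_n^{\mathrm{s|u_s}}P_{\mathrm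 s}v^{-\alpha_{\mathrm s}})^{z+1}}\Bigr]v\,\mathrm dv-2\pi\tilde\lambda_{\mathrm{b|u_s}}\int_{R_{\min}^{\mathrm{b|u_s}}}^{R_{\max}^{\mathrm{b|u_s}}}\Bigl[1-\Bigl(1+\frac{sG^{\mathrm{b_H|u_s}}P_{\mathrm b}w^{-\alpha_{\mathrm t}}}{m_{\mathrm t}}\Bigr)^{-m_{\mathrm t}}\Bigr]w\,\mathrm dw\Biggr),$$ where $G_n^{\mathrm{s|u_s}}$ denotes the common (side-lobe) gain of all interfering satellites ($n\ne1$).
   Context: Geometry. The typical satellite user is fixed at $\mathbf u_1^{\mathrm s}=(0,0,R_{\mathrm{u_s}})\in\mathbb R^3$. Satellites and terrestrial base stations (BSs) lie on origin-centered spheres of radii $R_{\mathrm s}$ and $R_{\mathrm b}$, both larger than $R_{\mathrm{u_s}}$, and form independent homogeneous Poisson point processes $\Phi_{\mathrm s}=\{\mathbf x_n\}$, $\Phi_{\mathrm b}=\{\mathbf b_m\}$ with densities $\lambda_{\mathrm s},\lambda_{\mathrm b}>0$ per unit area. The elevation angle is $\theta_{\mathrm{u_s}}\in[0,\pi/2)$. For $o\in\{\mathrm s,\mathrm b\}$ put $$R_{\min}^{o|\mathrm{u_s}}=R_o-R_{\mathrm{u_s}},\quad R_{\max}^{o|\mathrm{u_s}}=\sqrt{R_o^2-R_{\mathrm{u_s}}^2+R_{\mathrm{u_s}}^2\sin^2\theta_{\mathrm{u_s}}}-R_{\mathrm{u_s}}\sin\theta_{\mathrm{u_s}},\quad\tilde\lambda_{o|\mathrm{u_s}}=\lambda_o\frac{R_o}{R_{\mathrm{u_s}}}.$$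 The visible cap $\mathcal A_{o|\mathrm{u_s}}$ is the set of points of the sphere of radius $R_o$ at distance at most $R_{\max}^{o|\mathrm{u_s}}$ from $\mathbf u_1^{\mathrm s}$, and $\mathcal A_{o|\mathrm{u_s}}(r)$ is the set of those at distance at most $r$. $\mathbf x_1$ is the visible satellite nearest to $\mathbf u_1^{\mathrm s}$. Gains. With carrier frequency $f_c$, speed of light $c_0$ and positive lobe gains: $G_n^{\mathrm{s|u_s}}=G_{\mathrm{u_s}}^{\mathrm{side}}G_{\mathrm s}^{\mathrm{side}}(c_0/4\pi f_c)^2$ for $n\neq1$; $G^{\mathrm{b|u_s}}=G^{\mathrm{b_H|u_s}}=G_{\mathrm{u_s}}^{\mathrm{side}}G_{\mathrm{b_H}}^{\mathrm{side}}(c_0/4\pi f_c)^2$. Fading. All fading powers are mutually independent and independent of the point processes. The $H_n^{\mathrm s}$ are i.i.d., $\sqrt{H^{\mathrm s}}$ being Shadowed-Rician with density $$\Bigl(\tfrac{2bm_{\mathrm s}}{2bm_{\mathrm s}+\Omega}\Bigr)^{m_{\mathrm s}}\tfrac{x}{b}\,e^{-x^2/(2b)}\,{}_1F_1\Bigl(m_{\mathrm s};1;\tfrac{\Omega x^2}{2b(2bm_{\mathrm s}+\Omega)}\Bigr),\quad x>0,$$ with $b,\Omega>0$, $m_{\mathrm s}$ a positive integer, ${}_1F_1$ the confluent hypergeometric function. The $H_m^{\mathrm t}$ are i.i.d., $\sqrt{H^{\mathrm t}}$ being Nakagami with density $\frac{2m_{\mathrm t}^{m_{\mathrm t}}}{\Gamma(m_{\mathrm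 t})}x^{2m_{\mathrm t}-1}e^{-m_{\mathrm t}x^2}$, $x>0$, $m_{\mathrm t}>0$. Constants: $\beta=\frac1{2b}$, $c=\frac{\Omega}{2b(2bm_{\mathrm s}+\Omega)}$, $\zeta(z)=\bigl(\frac{2bm_{\mathrm s}}{2bm_{\mathrm s}+\Omega}\bigr)^{m_{\mathrm s}}\frac{\beta(-1)^z(1-m_{\mathrm s})_z c^z}{(z!)^2}$, with $(x)_z=x(x+1)\cdots(x+z-1)$ and $(x)_0=1$. $P_{\mathrm s},P_{\mathrm b}>0$ are transmit powers, $\sigma^2>0$ the noise power, $\alpha_{\mathrm s},\alpha_{\mathrm t}>0$ the path-loss exponents of satellite and terrestrial links. *)

(* Defs.v *)
From HB Require Import structures.
From mathcomp Require Import all_boot all_order all_algebra.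
From mathcomp Require Import finmap.
From mathcomp Require Import all_classical all_reals all_analysis.

Set Implicit Arguments.
Unset Strict Implicit.
Unset Printing Implicit Defensive.

Import Order.TTheory GRing.Theory Num.Theory.
Import numFieldNormedType.Exports.

Local Open Scope classical_set_scope.
Local Open Scope ring_scope.

Section special_functions.
Context {R : realType}.

Definition poch (x : R) (n : nat) : R := \prod_(i < n) (x + i%:R).

Definition hyp1F1 (a b x : R) : R :=
  limn (series (fun n => poch a n / poch b n * x ^+ n / n`!%:R)).

Definition Gamma (a : R) : R :=
  \int[lebesgue_measure]_(t in `]0, +oo[) (t `^ (a - 1) * expR (- t)).

End special_functions.

Section geometry.
Context {R : realType}.

(* The norm that the library puts on a product is the sup norm. *)
Definition euclid_norm (p : R * R * R) : R :=
  Num.sqrt (p.1.1 ^+ 2 + p.1.2 ^+ 2 + p.2 ^+ 2).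

Definition euclid_dist (p q : R * R * R) : R :=
  euclid_norm (p.1.1 - q.1.1, p.1.2 - q.1.2, p.2 - q.2).

Definition user (Ru : R) : R * R * R := (0, 0, Ru).

Definition sphere (rho : R) : set (R * R * R) := [set p | euclid_norm p = rho].

Definition cap (rho Ru d : R) : set (R * R * R) :=
  [set p | sphere rho p /\ euclid_dist p (user Ru) <= d].

Definition Rmin (Ro Ru : R) : R := Ro - Ru.

Definition Rmax (Ro Ru theta : R) : R :=
  Num.sqrt (Ro ^+ 2 - Ru ^+ 2 + Ru ^+ 2 * sin theta ^+ 2) - Ru * sin theta.

Definition visible (Ro Ru theta : R) : set (R * R * R) :=
  cap Ro Ru (Rmax Ro Ru theta).

Definition spherical (rho phi t : R) : R * R * R :=
  (rho * sin t * cos phi, rho * sin t * sin phi, rho * cos t).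

(* Surface measure of the sphere of radius rho, as a function on the subsets
   of the whole space: the surface integral, in spherical coordinates with
   azimuth phi and polar angle t, of the indicator of A. *)
Definition sphere_area (rho : R) (A : set (R * R * R)) : \bar R :=
  (\int[lebesgue_measure]_(phi in `[0%R, (2 * pi)%R])
     \int[lebesgue_measure]_(t in `[0%R, pi])
       (\1_A (spherical rho phi t) * (rho ^+ 2 * sin t))%:E)%E.

End geometry.

Section probability_notions.
Context d (T : measurableType d) (R : realType) (P : probability T R).

Definition sigma_of d' (T' : measurableType d') (X : T -> T') : set (set T) :=
  preimage_set_system setT X measurable.

Definition mutually_independent (I : choiceType) (F : I -> set (set T)) :=
  forall (J : {fset I}) (A : I -> set T), (forall i, i \in J -> F i (A i)) ->
    P (\bigcap_(i in [set` J]) A i) = (\prod_(i <- J) P (A i))%E.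

Definition has_density (X : T -> R) (f : R -> R) :=
  forall B : set R, measurable B ->
    P (X @^-1` B) = (\int[lebesgue_measure]_(x in B) (f x)%:E)%E.

(* f is a version, for r in dom, of r |-> E[X r | D = r, E]. The integrand may
   itself depend on r; it is evaluated along r = D. Both sides of the defining
   identity are integrals against P rather than against P(. | E), since the
   factor 1 / P E cancels. *)
Definition is_cond_expectation (D : T -> R) (E : set T) (dom : set R)
    (X : R -> T -> R) (f : R -> R) :=
  [/\ (0 < P E)%E,
      P.-integrable E (fun w => (X (D w) w)%:E),
      measurable_fun dom f &
      forall B : set R, measurable B -> B `<=` dom ->
        (\int[P]_(w in E `&` D @^-1` B) (X (D w) w)%:E =
         \int[P]_(w in E `&` D @^-1` B) (f (D w))%:E)%E].

(* A finite point process, with an enumeration of its points: in state w the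
   points are pt n w for n < npts w, and the other values of pt are junk. *)
Record point_process := PointProcess {
  npts : {RV P >-> nat} ;
  pt : nat -> {RV P >-> (R * R * R)%type} }.

Definition npoints_in (Phi : point_process) (A : set (R * R * R)) (w : T)
    : nat :=
  \sum_(n < npts Phi w) (pt Phi n w \in A : nat).

(* The sigma-algebra generated by the enumeration; taking B = setT shows that
   it contains the events n < npts. *)
Definition process_sigma (Phi : point_process) : set (set T) :=
  <<s [set C | exists n (B : set (R * R * R)), measurable B /\
               C = [set w | (n < npts Phi w)%N /\ B (pt Phi n w)]] >>.

(* The intensity measure vanishes outside the sphere, so the process has
   almost surely no point there. The second argument of poisson_prob is
   unused by the library. *)
Definition homogeneous_PPP_on_sphere (rho lambda : R) (Phi : point_process) :=
  (forall (A : set (R * R * R)) (B : set nat), measurable A ->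
     P (npoints_in Phi A @^-1` B) =
     poisson_prob (lambda * fine (sphere_area rho A)) 0 B) /\
  (forall A : nat -> set (R * R * R),
     (forall i, measurable (A i)) -> trivIset setT A ->
     mutually_independent (fun i => sigma_of (npoints_in Phi (A i)))).

(* The point of index 0 is the one written x_1. *)
Definition first_is_nearest (Phi : point_process) (A : set (R * R * R))
    (u : R * R * R) :=
  forall w, (1 <= npoints_in Phi A w)%N ->
    A (pt Phi 0 w) /\
    forall n, (n < npts Phi w)%N -> A (pt Phi n w) ->
      euclid_dist (pt Phi 0 w) u <= euclid_dist (pt Phi n w) u.

(* Mutual independence of the two processes and of all the fading powers. *)
Definition independent_network (Phis Phib : point_process)
    (Hs Ht : nat -> {RV P >-> R}) :=
  mutually_independent (fun i : (bool + (nat + nat))%type =>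
    match i with
    | inl true => process_sigma Phis
    | inl false => process_sigma Phib
    | inr (inl n) => sigma_of (Hs n)
    | inr (inr m) => sigma_of (Ht m)
    end).

(* Power received at u from the points of Phi in A, when the product of gain
   and transmit power is g. *)
Definition received_power (Phi : point_process) (A : set (R * R * R))
    (u : R * R * R) (g alpha : R) (H : nat -> {RV P >-> R}) (w : T) : R :=
  \sum_(n < npts Phi w | pt Phi n w \in A)
     g * H n w * euclid_dist (pt Phi n w) u `^ (- alpha).

End probability_notions.

Section link_model.
Context {R : realType}.

Definition link_gain (Grx Gtx c0 fc : R) : R :=
  Grx * Gtx * (c0 / (4 * pi * fc)) ^+ 2.

Definition shadowed_rician_pdf (b Omega : R) (ms : nat) (x : R) : R :=
  if 0 < x then
    (2 * b * ms%:R / (2 * b * ms%:R + Omega)) ^+ ms * (x / b) *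
    expR (- (x ^+ 2 / (2 * b))) *
    hyp1F1 ms%:R 1 (Omega * x ^+ 2 / (2 * b * (2 * b * ms%:R + Omega)))
  else 0.

Definition nakagami_pdf (mt x : R) : R :=
  if 0 < x then
    2 * mt `^ mt / Gamma mt * x `^ (2 * mt - 1) * expR (- (mt * x ^+ 2))
  else 0.

Definition SR_beta (b : R) : R := 1 / (2 * b).

Definition SR_c (b Omega : R) (ms : nat) : R :=
  Omega / (2 * b * (2 * b * ms%:R + Omega)).

Definition SR_zeta (b Omega : R) (ms z : nat) : R :=
  (2 * b * ms%:R / (2 * b * ms%:R + Omega)) ^+ ms *
  (SR_beta b * (-1) ^+ z * poch (1 - ms%:R) z * SR_c b Omega ms ^+ z /
   (z`!%:R) ^+ 2).

Definition scaled_density (lambda Ro Ru : R) : R := lambda * (Ro / Ru).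

End link_model.

(* Main.v *)
Require Import Defs.
From HB Require Import structures.
From mathcomp Require Import all_boot all_order all_algebra.
From mathcomp Require Import finmap.
From mathcomp Require Import all_classical all_reals all_analysis.
From mathcomp Require Import measurable_realfun.
From mathcomp Require Import ring lra.

Set Implicit Arguments.
Unset Strict Implicit.
Unset Printing Implicit Defensive.

Import Order.TTheory GRing.Theory Num.Theory.
Import numFieldNormedType.Exports.

Local Open Scope classical_set_scope.
Local Open Scope ring_scope.

Import HBNNSimple.

(** Distances to the user are discretised into cells of width 1/(n+1).  The
    numbers of points of a Poisson process in the cells are independent Poisson
    variables, and the fading powers are independent of everything else, so a
    product over the points of functions of (cell, fading) has as expectation
    the exponential of minus a sum over the cells.  The nearest satellite lies
    in cell j iff the cells below j are empty and cell j is not, an event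
    independent of the counts above j; conditioning on it therefore keeps only
    the factors above j.  Bounded convergence, as the mesh tends to 0, turns
    the sums into integrals against the distance law: an annulus cut from a
    sphere of radius Ro has area 2 pi (Ro/Ru) int v dv.  This gives the
    identity on the events D < v, and a pi-lambda argument extends it to all
    Borel sets.  The two fading transforms are computed by Kummer's
    transformation, which makes the Shadowed-Rician density a finite mixture of
    Gamma densities, and by rescaling. *)

(** The enumeration puts the nearest satellite at index 0, so its points are not independent given
    their number, and the Poisson hypothesis speaks of counts only. Functionals of the points must
    therefore be expressed through the counts of finitely many disjoint cells; a grid of distances
    suffices because the interference sees a point only through its distance. The fading powers are
    attached to indices, not to places, but they are independent of the whole sigma-algebra of the
    enumeration: they are integrated out first, with the labels frozen, and only then are the points
    counted. An exact distance of the nearest satellite is a null event, so the cell of that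
    satellite stands for it: all satellites of this cell are dropped from the product, an error that
    disappears in the limit because distinct distances end up in distinct cells. As [s] is
    nonnegative, all variables can be kept in [0, 1], so expectations pass to the limit by bounded
    convergence. Only the law of the root of a fading power is given; [Num.sqrt H ^+ 2] replaces
    [H], and the two agree almost surely. *)

(** * Image measures of weighted measures *)

Section weighted_laws.
Context {R : realType} d1 d2 d (T1 : measurableType d1) (T2 : measurableType d2)
  (Y : measurableType d) (m1 : {measure set T1 -> \bar R})
  (m2 : {measure set T2 -> \bar R}).
Variables (W1 : T1 -> R) (W2 : T2 -> R) (X1 : T1 -> Y) (X2 : T2 -> Y).
Hypotheses (mW1 : measurable_fun setT W1) (mW2 : measurable_fun setT W2)
  (mX1 : measurable_fun setT X1) (mX2 : measurable_fun setT X2)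
  (W1_ge0 : forall x, 0 <= W1 x) (W2_ge0 : forall x, 0 <= W2 x).

(** Reduces a simple integrand to the indicators of its level sets, the integrands about which the
    hypothesis [eq_laws] speaks. *)
Lemma integral_weight_nnsfun d' (T : measurableType d') (m : {measure set T -> \bar R})
    (W : T -> R) (X : T -> Y) (h : {nnsfun Y >-> R}) :
  measurable_fun setT W -> measurable_fun setT X -> (forall x, 0 <= W x) ->
  (\int[m]_x (W x * h (X x))%:E =
   \sum_(y \in range h) y%:E *
     \int[m]_x (W x * \1_(h @^-1` [set y]) (X x))%:E)%E.
Proof.
move=> mW mX W0.
have mI y : measurable_fun setT (fun x => W x * \1_(h @^-1` [set y]) (X x)).
  by apply: measurable_funM => //; apply: measurableT_comp.
transitivity (\int[m]_x (\sum_(y \in range h)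
    (y * (W x * \1_(h @^-1` [set y]) (X x)))%:E))%E.
  apply: eq_integral => t _; rewrite {1}fimfunE fsumEFin//; congr EFin.
  rewrite mulr_fsumr//; apply: eq_fsbigr => y _; ring.
have nn y x : 0 <= y * (W x * \1_(h @^-1` [set y]) (X x)).
  rewrite mulrCA mulr_ge0//.
  by have := nnfun_muleindic_ge0 h y (X x); rewrite lee_fin.
rewrite ge0_integral_fsum//; last 2 first.
- by move=> y; apply/measurable_EFinP; apply: measurable_funM.
- by move=> y x _; rewrite lee_fin.
apply: eq_fsbigr => y /set_mem[z _ <-].
under eq_integral do rewrite EFinM.
rewrite ge0_integralZl_EFin//.
- by move=> x _; rewrite lee_fin mulr_ge0// indicE.
- exact/measurable_EFinP.
Qed.

Hypothesis eq_laws : forall B, measurable B ->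
  (\int[m1]_x (W1 x * \1_B (X1 x))%:E = \int[m2]_x (W2 x * \1_B (X2 x))%:E)%E.

(** Simple approximation and monotone convergence pass from sets to functions. Read as an equality
    of image measures, this serves as a change of variables, as the transfer to a density or a
    probability mass function, and as the inductive step for independence. *)
Lemma eq_integral_weight (g : Y -> R) : measurable_fun setT g ->
  (forall y, 0 <= g y) ->
  (\int[m1]_x (W1 x * g (X1 x))%:E = \int[m2]_x (W2 x * g (X2 x))%:E)%E.
Proof.
move=> mg g0.
have mg' : measurable_fun setT (EFin \o g) by exact/measurable_EFinP.
pose h := nnsfun_approx measurableT mg'.
have hg y : (h n y)%:E @[n --> \oo] --> (g y)%:E.
  by apply: (cvg_nnsfun_approx measurableT mg') => // z _; rewrite lee_fin.
have lim d' (T : measurableType d') (m : {measure set T -> \bar R})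
    (W : T -> R) (X : T -> Y) : measurable_fun setT W ->
    measurable_fun setT X -> (forall x, 0 <= W x) ->
    (\int[m]_x (W x * h n (X x))%:E)%E @[n --> \oo] -->
    (\int[m]_x (W x * g (X x))%:E)%E.
  move=> mW mX W0.
  have -> : (\int[m]_x (W x * g (X x))%:E =
      \int[m]_x limn (fun n => (W x * h n (X x))%:E))%E.
    apply: eq_integral => x _; apply/esym/cvg_lim => //.
    under eq_fun do rewrite EFinM.
    by rewrite EFinM; apply: cvgeZl => //; exact: hg.
  apply: cvg_monotone_convergence => //.
  - move=> n; apply/measurable_EFinP; apply: measurable_funM => //.
    exact: measurableT_comp.
  - by move=> n x _; rewrite lee_fin mulr_ge0.
  - move=> x _ a c ac; rewrite lee_fin ler_wpM2l//.
    by move/(nd_nnsfun_approx measurableT mg'): ac => /lefP.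
have -> : (\int[m1]_x (W1 x * g (X1 x))%:E =
    limn (fun n => \int[m1]_x (W1 x * h n (X1 x))%:E))%E.
  by apply/esym/cvg_lim => //; exact: lim.
apply/cvg_lim => //.
under eq_fun do rewrite integral_weight_nnsfun//.
have := lim _ _ m2 _ _ mW2 mX2 W2_ge0.
under eq_fun do rewrite integral_weight_nnsfun//.
apply: cvg_trans; apply: near_eq_cvg; apply: nearW => n.
by apply: eq_fsbigr => y _; rewrite eq_laws.
Qed.

End weighted_laws.

Lemma integral_indic_comp {R : realType} d1 d (T : measurableType d1)
    (Y : measurableType d) (m : {measure set T -> \bar R}) (W : T -> R)
    (X : T -> Y) (B : set Y) :
  (\int[m]_x (W x * \1_B (X x))%:E = \int[m]_(x in X @^-1` B) (W x)%:E)%E.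
Proof.
rewrite [RHS]integral_mkcond; apply: eq_integral => x _.
rewrite patchE indicE; have -> : (x \in X @^-1` B) = (X x \in B) by [].
by case: ifPn; rewrite (mulr1, mulr0).
Qed.

(** The rays form a pi-system that generates the Borel sets, and finiteness of the total mass makes
    the class of good sets closed under complement. *)
Lemma eq_integral_weight_rays {R : realType} d1 d2 (T1 : measurableType d1)
    (T2 : measurableType d2) (m1 : {measure set T1 -> \bar R})
    (m2 : {measure set T2 -> \bar R}) (W1 : T1 -> R) (W2 : T2 -> R)
    (X1 : T1 -> R) (X2 : T2 -> R) :
  measurable_fun setT W1 -> measurable_fun setT W2 ->
  measurable_fun setT X1 -> measurable_fun setT X2 ->
  (forall x, 0 <= W1 x) -> (forall x, 0 <= W2 x) ->
  (\int[m1]_x (W1 x)%:E < +oo)%E ->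
  (forall y, \int[m1]_x (W1 x * \1_(`]-oo, y[) (X1 x))%:E =
     \int[m2]_x (W2 x * \1_(`]-oo, y[) (X2 x))%:E)%E ->
  forall g : R -> R, measurable_fun setT g -> (forall y, 0 <= g y) ->
  (\int[m1]_x (W1 x * g (X1 x))%:E = \int[m2]_x (W2 x * g (X2 x))%:E)%E.
Proof.
move=> mW1 mW2 mX1 mX2 W10 W20 fin1 rays g mg g0.
have total d (T : measurableType d) (m : {measure set T -> \bar R})
    (W : T -> R) (X : T -> R) : measurable_fun setT W ->
    measurable_fun setT X -> (forall x, 0 <= W x) ->
    (\int[m]_x (W x * \1_(`]-oo, n%:R[) (X x))%:E)%E @[n --> \oo] -->
    (\int[m]_x (W x)%:E)%E.
  move=> mW mX W0.
  have cvX x : (W x * \1_(`]-oo, n%:R[) (X x))%:E @[n --> \oo] --> (W x)%:E.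
    apply: cvg_near_cst; near=> n; rewrite indicE mem_set ?mulr1//=.
    by rewrite in_itv/=; near: n; exact: nbhs_infty_gtr.
  rewrite (_ : (\int[m]_x (W x)%:E = \int[m]_x limn (fun n =>
      (W x * \1_(`]-oo, n%:R[) (X x))%:E))%E); last first.
    by apply: eq_integral => x _; apply/esym/cvg_lim => //; exact: cvX.
  apply: cvg_monotone_convergence => //.
  - move=> n; apply/measurable_EFinP; apply: measurable_funM => //.
    by apply: measurableT_comp.
  - by move=> n x _; rewrite lee_fin mulr_ge0// indicE.
  - move=> x _ a c ac; rewrite lee_fin ler_wpM2l// !indicE ler_nat.
    apply: leq_trans (_ : (X x < c%:R)%R <= _)%N; last first.
      by case: ltP => // h; rewrite mem_set//= in_itv.
    case: (boolP (X x \in _)) => //; rewrite inE/= in_itv/= => /lt_le_trans ->//.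
    by rewrite ler_nat.
(* The whole line is not a ray; its masses are compared along the rays with end point [n]. The
   complement step below needs this. *)
have eqT : (\int[m1]_x (W1 x)%:E = \int[m2]_x (W2 x)%:E)%E.
  have := total _ _ m2 _ _ mW2 mX2 W20; under eq_fun do rewrite -rays.
  by move/cvg_lim => <-//; apply/esym/cvg_lim => //; exact: total.
apply: eq_integral_weight => // B mB; rewrite !integral_indic_comp.
have mW1' : measurable_fun setT (EFin \o W1) by exact/measurable_EFinP.
have mW2' : measurable_fun setT (EFin \o W2) by exact/measurable_EFinP.
have mXp d (T : measurableType d) (X : T -> R) (A : set R) :
    measurable_fun setT X -> measurable A -> measurable (X @^-1` A).
  by move=> mX mA; rewrite -[X in measurable X]setTI; exact: mX.
pose G := [set A : set R | exists x, A = `]-oo, x[%classic].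
have mE : @measurable _ (measurableTypeR R) = <<s G >>.
  exact: RGenInftyO.measurableE.
apply: (@dynkin_induction _ (measurableTypeR R) G (fun B =>
  (\int[m1]_(x in X1 @^-1` B) (W1 x)%:E =
   \int[m2]_(x in X2 @^-1` B) (W2 x)%:E)%E)) => //.
- move=> _ _ [x ->] [y ->]; exists (Order.min x y).
  apply/seteqP; split => z/=; rewrite !in_itv/= lt_min.
    by move=> [-> ->].
  by move=> /andP[].
- by move=> _ [x ->]; rewrite -!integral_indic_comp.
- move=> A mA PA.
  have split d (T : measurableType d) (m : {measure set T -> \bar R})
      (W : T -> R) (X : T -> R) : measurable_fun setT (EFin \o W) ->
      measurable_fun setT X -> (forall x, 0 <= W x) ->
      (\int[m]_x (W x)%:E = \int[m]_(x in X @^-1` A) (W x)%:E +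
         \int[m]_(x in X @^-1` (~` A)) (W x)%:E)%E.
    move=> mW mX W0; rewrite -ge0_integral_setU//=.
    - by rewrite -preimage_setU setUv.
    - exact: mXp.
    - by apply: mXp => //; exact: measurableC.
    - by rewrite -preimage_setU setUv.
    - by move=> x _; rewrite lee_fin.
    - by apply/disj_setPS => x [].
  move: eqT; rewrite (split _ _ m1 W1 X1)// (split _ _ m2 W2 X2)// PA.
  set a := (\int[m2]_(x in X2 @^-1` A) (W2 x)%:E)%E.
  (* The mass of [A] can be cancelled in the extended reals only if it is finite; this is where the
     hypothesis on the total mass enters. *)
  have fa : a \is a fin_num.
    rewrite /a -PA ge0_fin_numE ?integral_ge0//.
      apply: le_lt_trans fin1; apply: ge0_subset_integral => //.
        exact: mXp.
      by move=> x _; rewrite lee_fin.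
    by move=> x _; rewrite lee_fin.
  by rewrite addeC (addeC a) => /(congr1 (fun z => z - a)%E); rewrite !addeK.
- move=> F mF tF PF.
  have tp T (X : T -> R) : trivIset setT (fun n => X @^-1` F n).
    apply/trivIsetP => i j _ _ ij; rewrite -preimage_setI.
    by move/trivIsetP: tF => /(_ i j I I ij) ->; rewrite preimage_set0.
  have additive d (T : measurableType d) (m : {measure set T -> \bar R})
      (W : T -> R) (X : T -> R) : measurable_fun setT (EFin \o W) ->
      measurable_fun setT X -> (forall x, 0 <= W x) ->
      (\int[m]_(x in X @^-1` \bigcup_k F k) (W x)%:E =
       \sum_(k <oo) \int[m]_(x in X @^-1` F k) (W x)%:E)%E.
    move=> mW mX W0; rewrite preimage_bigcup; apply: ge0_integral_bigcup.
    - move=> k; apply: mXp; [exact: mX|exact: mF].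
    - exact: measurable_funTS.
    - by move=> x _; rewrite lee_fin.
    - exact: tp.
  rewrite (additive _ _ m1 W1 X1 mW1' mX1 W10).
  rewrite (additive _ _ m2 W2 X2 mW2' mX2 W20).
  by apply: eq_eseriesr => k _; exact: PF.
- by rewrite -mE.
Unshelve. all: by end_near. Qed.

(** * Random variables with values in [0, 1] *)

Section unit_valued.
Context {R : realType} d (T : measurableType d) (P : probability T R).
Implicit Types f g : T -> R.

(** Indicators and factors [expR (- a)] with [a] nonnegative are of this kind. The class is stable
    under products and pointwise limits, and integrability is automatic in it. *)
Definition unit_rv f := measurable_fun setT f /\ forall x, 0 <= f x <= 1.

Lemma unit_rv_ge0 f x : unit_rv f -> 0 <= f x.
Proof. by move=> [_ /(_ x)/andP[]]. Qed.

Lemma unit_rv_le1 f x : unit_rv f -> f x <= 1.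
Proof. by move=> [_ /(_ x)/andP[]]. Qed.

Lemma unit_rv_integrable f : unit_rv f -> P.-integrable setT (EFin \o f).
Proof.
move=> uf; apply: (@le_integrable _ _ _ _ _ measurableT _ (cst 1)%E).
- exact/measurable_EFinP/uf.1.
- move=> x _ /=; rewrite lee_fin normr1 ger0_norm ?unit_rv_le1//.
  exact: unit_rv_ge0.
- by apply: finite_measure_integrable_cst.
Qed.

Lemma EFin_Rintegral d' (T' : measurableType d') (m : {measure set T' -> \bar R})
    (D : set T') (f : T' -> R) : measurable D -> m.-integrable D (EFin \o f) ->
  (\int[m]_(x in D) f x)%:E = (\int[m]_(x in D) (f x)%:E)%E.
Proof. by move=> mD intf; rewrite /Rintegral fineK//; exact: integrable_fin_num. Qed.

Lemma EFin_unit_rv f : unit_rv f ->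
  (\int[P]_x f x)%:E = (\int[P]_x (f x)%:E)%E.
Proof. by move=> uf; apply: EFin_Rintegral => //; exact: unit_rv_integrable. Qed.

Lemma unit_rv_cst (c : R) : 0 <= c <= 1 -> unit_rv (fun=> c).
Proof. by []. Qed.

Lemma unit_rvM f g : unit_rv f -> unit_rv g -> unit_rv (fun x => f x * g x).
Proof.
move=> uf ug; split; first exact: measurable_funM uf.1 ug.1.
move=> x; rewrite mulr_ge0 ?mulr_ile1 ?unit_rv_ge0 ?unit_rv_le1//.
Qed.

Lemma unit_rv_prod (I : Type) (s : seq I) (Q : pred I) (f : I -> T -> R) :
  (forall i, unit_rv (f i)) -> unit_rv (fun x => \prod_(i <- s | Q i) f i x).
Proof.
move=> uf; elim: s => [|i s IH].
  by under eq_fun do rewrite big_nil; apply: unit_rv_cst; rewrite ler01 lexx.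
under eq_fun do rewrite big_cons.
by case: (Q i) => //; exact: unit_rvM.
Qed.

Lemma unit_rv_indic (A : set T) : measurable A -> unit_rv \1_A.
Proof.
move=> mA; split; first exact: measurable_indic.
by move=> x; rewrite indicE; case: (x \in A); rewrite ?lexx ?ler01.
Qed.

Lemma unit_rv_comp d' (Y : measurableType d') (X : T -> Y) (g : Y -> R) :
  measurable_fun setT X -> measurable_fun setT g -> (forall y, 0 <= g y <= 1) ->
  unit_rv (fun x => g (X x)).
Proof. by move=> mX mg g01; split => //; exact: measurableT_comp. Qed.

Lemma Rintegral_unit_rv f : unit_rv f -> 0 <= \int[P]_x f x <= 1.
Proof.
move=> uf; apply/andP; split.
  by apply: Rintegral_ge0 => x _; exact: unit_rv_ge0.
rewrite -lee_fin EFin_unit_rv//.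
have <- : (\int[P]_x (cst 1%E x) = 1)%E.
  by rewrite integral_cst// mul1e; exact: probability_setT.
apply: ge0_le_integral => //.
- by move=> x _; rewrite lee_fin; exact: unit_rv_ge0.
- exact/measurable_EFinP/uf.1.
- by move=> x _; rewrite lee_fin; exact: unit_rv_le1.
Qed.

Lemma Rintegral_indic1 (A : set T) : measurable A ->
  \int[P]_x \1_A x = fine (P A).
Proof. by move=> mA; rewrite /Rintegral integral_indic// setIT. Qed.

Lemma Rintegral_sum d' (T' : measurableType d') (m : {measure set T' -> \bar R})
    (D : set T') (I : Type) (s : seq I) (Q : pred I) (f : I -> T' -> R) :
  measurable D -> (forall i, m.-integrable D (EFin \o f i)) ->
  \int[m]_(x in D) (\sum_(i <- s | Q i) f i x) =
  \sum_(i <- s | Q i) \int[m]_(x in D) f i x.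
Proof.
move=> mD uf; elim: s => [|i s IH].
  rewrite big_nil; under eq_Rintegral do rewrite big_nil.
  by rewrite Rintegral_cst// mul0r.
rewrite big_cons; under eq_Rintegral do rewrite big_cons.
case: (Q i) => //; rewrite RintegralD ?IH//.
rewrite (_ : EFin \o _ = (fun x => \sum_(j <- s | Q j) (f j x)%:E)%E); last first.
  by apply/funext => x /=; rewrite sumEFin.
by apply: integrable_sum => // j _; exact: uf.
Qed.

End unit_valued.

(** * Expectations of products of independent variables *)

Section independence.
Context {R : realType} d (T : measurableType d) (P : probability T R)
  (I : choiceType) (F : I -> set (set T)) (f : I -> T -> R).
Hypotheses (indF : mutually_independent P F) (uf : forall i, unit_rv (f i))
  (fF : forall i B, measurable B -> F i (f i @^-1` B)).

(** Independence is known for events, so the variables of [s2] are turned one at a time into events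
    of [s1]. The other factors act as a weight in the meantime. *)
Let expectation_prod_indic_rv (s2 s1 : seq I) (A : I -> set T) :
  uniq (s1 ++ s2) -> (forall i, measurable (A i)) ->
  (forall i, i \in s1 -> F i (A i)) ->
  \int[P]_x ((\prod_(i <- s1) \1_(A i) x) * \prod_(i <- s2) f i x) =
  (\prod_(i <- s1) fine (P (A i))) * \prod_(i <- s2) \int[P]_x f i x.
Proof.
elim: s2 s1 A => [|i s2 IH] s1 A.
  rewrite cats0 => us1 mA FA; rewrite big_nil mulr1.
  have fsE i : (i \in [fset i in s1]%fset) = (i \in s1) by rewrite in_fset.
  have -> : \int[P]_x ((\prod_(i <- s1) \1_(A i) x) * \prod_(i <- [::]) f i x) =
      \int[P]_x \1_(\bigcap_(i in [set` [fset i in s1]%fset]) A i) x.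
    apply: eq_Rintegral => x _; rewrite big_nil mulr1 indicE.
    case: (asboolP ((\bigcap_(i in [set` [fset i in s1]%fset]) A i) x)) => [Ax|].
      rewrite mem_set// big_seq big1// => i is1; rewrite indicE mem_set//.
      by apply: Ax; rewrite /mkset fsE.
    move=> nAx; rewrite memNset//; move: nAx.
    move=> /existsNP[i /not_implyP[]]; rewrite /mkset fsE => is1 nA.
    by rewrite (big_rem i)//= indicE memNset// mul0r.
  rewrite Rintegral_indic1; last first.
    by apply: fin_bigcap_measurable => //; exact: finite_fset.
  rewrite indF; last by move=> i; rewrite fsE; exact: FA.
  rewrite (perm_big s1)/=; last first.
    by apply: uniq_perm => // i; rewrite fsE.
  elim: s1 {us1 FA fsE} => [|i s1 IH]; first by rewrite !big_nil.
  rewrite !big_cons fineM ?IH//; first exact: fin_num_measure.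
  by apply: prode_fin_num => j _; exact: fin_num_measure.
move=> us mA FA.
have us1 : uniq ((i :: s1) ++ s2).
  by move: us; rewrite -(cat1s i s2) uniq_catCA.
set c := (\prod_(i <- s1) fine (P (A i))) * \prod_(i <- s2) \int[P]_x f i x.
have c0 : 0 <= c.
  apply: mulr_ge0; apply: prodr_ge0 => j _; first exact: fine_ge0.
  by have /andP[] := Rintegral_unit_rv P (uf j).
pose W x := (\prod_(i <- s1) \1_(A i) x) * \prod_(i <- s2) f i x.
have uW : unit_rv W.
  apply: unit_rvM; apply: unit_rv_prod => // j.
  exact: unit_rv_indic.
have mfi B : measurable B -> measurable (f i @^-1` B).
  by move=> mB; rewrite -[X in measurable X]setTI; apply: (uf i).1.
have key : (\int[P]_x (W x * `|f i x|)%:E = \int[P]_x (c * `|f i x|)%:E)%E.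
  apply: (eq_integral_weight (X1 := f i) (X2 := f i)) => //.
  - exact: uW.1.
  - exact: (uf i).1.
  - exact: (uf i).1.
  - by move=> x; exact: unit_rv_ge0.
  move=> B mB.
  have uB : unit_rv (fun x => \1_B (f i x) : R).
    have mB1 : measurable_fun setT (\1_B : R -> R) by exact: measurable_indic.
    split; first exact: (measurableT_comp mB1 (uf i).1).
    by move=> x; rewrite indicE; case: (_ \in _); rewrite ?lexx ?ler01.
  rewrite -EFin_unit_rv; last exact: unit_rvM.
  have IH' := IH (i :: s1) (fun j => if j == i then f i @^-1` B else A j) us1.
  have is1 : i \notin s1 by move: us1 => /= /andP[]; rewrite mem_cat negb_or => /andP[].
  have sub (G : set T -> R) : \prod_(j <- i :: s1) G (if j == i then f i @^-1` B else A j) =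
      G (f i @^-1` B) * \prod_(j <- s1) G (A j).
    rewrite big_cons eqxx; congr (_ * _); apply: eq_big_seq => j js1.
    by case: eqP => // ji; rewrite -ji js1 in is1.
  have -> : (\int[P]_x (c * \1_B (f i x))%:E =
      (c * fine (P (f i @^-1` B)))%:E)%E.
    under eq_integral do rewrite EFinM.
    rewrite ge0_integralZl_EFin//.
    + rewrite -EFin_unit_rv// EFinM; congr (_ * _%:E)%E.
      by rewrite -Rintegral_indic1//; exact: mfi.
    + exact/measurable_EFinP/uB.1.
  congr EFin.
  transitivity (\int[P]_x ((\prod_(j <- i :: s1) \1_(if j == i then f i @^-1` B else A j) x) * \prod_(i <- s2) f i x)).
    apply: eq_Rintegral => x _; rewrite (sub (fun A => \1_A x)) /W.
    rewrite (_ : \1_(f i @^-1` B) x = \1_B (f i x) :> R) 1?indicE//; ring.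
  rewrite IH'; first by rewrite (sub (fun A => fine (P A))) /c; ring.
  - by move=> j; case: eqP => // _; exact: mfi.
  - move=> j; rewrite inE; case: eqP => [->|/= _ js1]; first by move=> _; exact: fF.
    exact: FA.
have u1 : unit_rv (fun x => W x * f i x) by exact: unit_rvM.
rewrite big_cons mulrCA mulrC -/c.
apply: EFin_inj.
transitivity (\int[P]_x (W x * `|f i x|)%:E)%E.
  rewrite -EFin_unit_rv; last first.
    rewrite (_ : (fun x => _) = (fun x => W x * f i x))//.
    by apply/funext => x; rewrite ger0_norm// unit_rv_ge0.
  congr EFin; apply: eq_Rintegral => x _; rewrite big_cons /W ger0_norm ?unit_rv_ge0//; ring.
rewrite key; under eq_integral do rewrite EFinM ger0_norm ?unit_rv_ge0//.
rewrite ge0_integralZl_EFin//; first by rewrite -EFin_unit_rv.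
- by move=> x _; rewrite lee_fin; exact: unit_rv_ge0.
- exact/measurable_EFinP/(uf i).1.
Qed.

Lemma mutually_independent_expectation (s : seq I) : uniq s ->
  \int[P]_x (\prod_(i <- s) f i x) = \prod_(i <- s) \int[P]_x f i x.
Proof.
move=> us.
have := @expectation_prod_indic_rv s [::] (fun=> set0) us.
rewrite big_nil mul1r => <-//; apply: eq_Rintegral => x _.
by rewrite big_nil mul1r.
Qed.

End independence.

(** * Bounded convergence and selection by a discrete variable *)

Lemma unit_rv_cvg {R : realType} d (T : measurableType d) (f : nat -> T -> R)
    (g : T -> R) :
  (forall n, unit_rv (f n)) -> (forall x, f n x @[n --> \oo] --> g x) -> unit_rv g.
Proof.
move=> uf fg; split.
  apply: (@measurable_fun_cvg _ _ _ setT f) => [n|x _]; [exact: (uf n).1|exact: fg].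
move=> x; apply/andP; split.
  rewrite -(cvg_lim (@Rhausdorff R) (fg x)).
  by apply: limr_ge; [apply: cvgP (fg x)|apply: nearW => n; exact: unit_rv_ge0].
rewrite -(cvg_lim (@Rhausdorff R) (fg x)).
by apply: limr_le; [apply: cvgP (fg x)|apply: nearW => n; exact: unit_rv_le1].
Qed.

Lemma bounded_convergence {R : realType} d (T : measurableType d)
    (P : probability T R) (f : nat -> T -> R) (g : T -> R) :
  (forall n, unit_rv (f n)) -> (forall x, f n x @[n --> \oo] --> g x) ->
  \int[P]_x f n x @[n --> \oo] --> \int[P]_x g x.
Proof.
move=> uf fg; have ug := unit_rv_cvg uf fg.
apply: fine_cvg; rewrite EFin_unit_rv//.
have := @dominated_convergence _ T R P setT measurableT
  (fun n x => (f n x)%:E) (EFin \o g) (cst 1%E).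
case.
- by move=> n; exact/measurable_EFinP/(uf n).1.
- exact/measurable_EFinP/ug.1.
- by apply: aeW => x _; apply: cvg_EFin; [exact: nearW|exact: fg].
- exact: finite_measure_integrable_cst.
- apply: aeW => x n _; rewrite lee_fin ger0_norm ?unit_rv_le1//.
  exact: unit_rv_ge0.
- by [].
Qed.

Lemma sigma_algebra_setI T (G : set (set T)) : sigma_algebra setT G -> setI_closed G.
Proof.
move=> [G0 GC GU] A B GA GB.
rewrite -(setCK (A `&` B)) setCI -bigcup2E -setTD; apply/GC/GU => i.
rewrite /bigcup2; case: ifP => _; first by rewrite -setTD; exact: GC.
by case: ifP => _ //; rewrite -setTD; exact: GC.
Qed.

(** Cutting along the levels of [L] handles both random indices of the proof: the number of points
    and the label of a point. *)
Lemma measurable_select {R : realType} d (T : measurableType d) (L : T -> nat)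
    (F : nat -> T -> R) :
  (forall k, measurable [set w | L w = k]) ->
  (forall k, measurable_fun setT (F k)) ->
  measurable_fun setT (fun w => F (L w) w).
Proof.
move=> mL mF _ B mB; rewrite setTI.
rewrite (_ : _ @^-1` B = \bigcup_k ([set w | L w = k] `&` F k @^-1` B)).
  apply: bigcupT_measurable => k; apply: measurableI => //.
  by rewrite -[X in measurable X]setTI; exact: mF.
apply/seteqP; split => [w Bw|w [k _ [/= Lk]]].
  by exists (L w).
by rewrite /preimage/= Lk.
Qed.

Lemma unit_rv_select {R : realType} d (T : measurableType d) (L : T -> nat)
    (F : nat -> T -> R) :
  (forall k, measurable [set w | L w = k]) -> (forall k, unit_rv (F k)) ->
  unit_rv (fun w => F (L w) w).
Proof.
move=> mL uF; split; last by move=> w; exact: (uF _).2.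
by apply: measurable_select => // k; exact: (uF k).1.
Qed.

(** * Integrating out independent marks with random labels *)

Section marks.
Context {R : realType} d (T : measurableType d) (P : probability T R)
  (E : choiceType) (own : E -> bool) (G : bool -> set (set T))
  (Y : E -> T -> R) (L : E -> T -> nat) (K : nat) (phi : E -> nat -> R -> R).
Hypotheses (sigmaG : forall b, sigma_algebra setT (G b))
  (measG : forall b A, G b A -> measurable A)
  (mY : forall e, measurable_fun setT (Y e))
  (ind : mutually_independent P (fun i : (bool + E)%type =>
    match i with inl b => G b | inr e => sigma_of (Y e) end))
  (GL : forall e k, G (own e) [set w | L e w = k])
  (L_le : forall e w, (L e w <= K)%N)
  (mphi : forall e k, measurable_fun setT (phi e k))
  (phi01 : forall e k y, 0 <= phi e k y <= 1).

Let mean e k : R := \int[P]_w phi e k (Y e w).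

Let u_phi e k : unit_rv (fun w => phi e k (Y e w)).
Proof. exact: unit_rv_comp (mY e) (mphi e k) (phi01 e k). Qed.

Let mean01 e k : 0 <= mean e k <= 1.
Proof. exact: Rintegral_unit_rv. Qed.

Let labelE e w (F : nat -> R) :
  F (L e w) = \sum_(j < K.+1) \1_[set w | L e w = j] w * F j.
Proof.
have := L_le e w; rewrite -ltnS => LK; rewrite (bigD1 (Ordinal LK))//=.
rewrite indicE mem_set// mul1r big1 ?addr0// => i /eqP iL.
rewrite indicE memNset ?mul0r//= => h; apply: iL; exact/val_inj/esym.
Qed.

Let u_label (F : nat -> T -> R) e : (forall k, unit_rv (F k)) ->
  unit_rv (fun w => F (L e w) w).
Proof.
move=> uF; apply: unit_rv_select => // k; exact: measG (GL e k).
Qed.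

Let mG b A : G b A -> unit_rv (\1_A : T -> R).
Proof. by move=> /measG; exact: unit_rv_indic. Qed.

Let G_indic b A (B : set R) : G b A -> G b ((\1_A : T -> R) @^-1` B).
Proof.
move=> GA; rewrite preimage_indic.
have [G0 GC GU] := sigmaG b.
have GT : G b setT by rewrite -(setD0 setT); exact: GC.
by case: ifP => _; case: ifP => _ //; rewrite -setTD; exact: GC.
Qed.

Let marks_base (fs : seq E) (k : E -> nat) (U : bool -> set T) :
  uniq fs -> (forall b, G b (U b)) ->
  \int[P]_w ((\prod_(b : bool) \1_(U b) w) *
     \prod_(e <- fs) phi e (k e) (Y e w)) =
  (\prod_(b : bool) \int[P]_w \1_(U b) w) * \prod_(e <- fs) mean e (k e).
Proof.
move=> ufs GU.
pose f (i : (bool + E)%type) : T -> R :=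
  match i with inl b => \1_(U b) | inr e => fun w => phi e (k e) (Y e w) end.
have := @mutually_independent_expectation _ _ _ _ _ _ f ind _ _
  ([:: inl true; inl false] ++ map inr fs).
rewrite big_cat/= !big_cons big_nil big_map !big_bool mulr1 => <-.
- by apply: eq_Rintegral => w _; rewrite !big_cons big_map !big_bool/=; ring.
- by case=> [b|e]; [exact: mG|exact: u_phi].
- case=> [b|e] B mB; first exact: G_indic.
  exists (phi e (k e) @^-1` B); last by rewrite setTI.
  by rewrite -[X in measurable X]setTI; exact: mphi.
- by rewrite /= !inE/= (map_inj_uniq (@inr_inj _ _)) ufs andbT; apply/andP; split;
    apply/negP => /mapP[].
Qed.

(** A label is random, but one of two sigma-algebras, [G (own e)], decides it, and the marks are
    independent of both. So each mark can be averaged as if its label were fixed, after which the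
    two sigma-algebras separate. [fs] holds the marks whose label is already frozen, and [U] the
    events that freezing has produced. *)
Lemma expectation_marks (es fs : seq E) (k : E -> nat) (U : bool -> set T) :
  uniq (es ++ fs) -> (forall b, G b (U b)) ->
  \int[P]_w ((\prod_(b : bool) \1_(U b) w) *
     (\prod_(e <- es) phi e (L e w) (Y e w)) *
     \prod_(e <- fs) phi e (k e) (Y e w)) =
  (\prod_(b : bool) \int[P]_w (\1_(U b) w *
     \prod_(e <- es | own e == b) mean e (L e w))) *
  \prod_(e <- fs) mean e (k e).
Proof.
elim: es fs k U => [|e es IH] fs k U.
  move=> /= ufs GU.
  transitivity (\int[P]_w ((\prod_(b : bool) \1_(U b) w) *
     \prod_(e <- fs) phi e (k e) (Y e w))).
    by apply: eq_Rintegral => w _; rewrite big_nil mulr1.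
  rewrite marks_base//; congr (_ * _); apply: eq_bigr => b _.
  by apply: eq_Rintegral => w _; rewrite big_nil mulr1.
move=> ues GU.
(* Splitting along the value [j] of the label of [e] moves [e] from [es] to [fs]. The event
   [L e = j] joins the factor of the sigma-algebra that owns [e], so the induction hypothesis still
   applies. *)
pose U' j b := if b == own e then U b `&` [set w | L e w = j] else U b.
pose k' j e' := if e' == e then j else k e'.
have efs : e \notin fs.
  by move: ues => /= /andP[]; rewrite mem_cat negb_or => /andP[].
have ues' : uniq (es ++ e :: fs) by rewrite -(cat1s e fs) uniq_catCA.
have GU' j b : G b (U' j b).
  rewrite /U'; case: eqP => // ->.
  exact: sigma_algebra_setI.
have fsE (F : E -> nat -> R) j : \prod_(e' <- fs) F e' (k' j e') = \prod_(e' <- fs) F e' (k e').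
  apply: eq_big_seq => e' e'fs; rewrite /k'; case: eqP => // ee'.
  by rewrite -ee' e'fs in efs.
have restU (H : bool -> set T -> R) j :
    \prod_(b | b != own e) H b (U' j b) = \prod_(b | b != own e) H b (U b).
  by apply: eq_bigr => b /negbTE bo; rewrite /U' bo.
transitivity (\sum_(j < K.+1) \int[P]_w ((\prod_(b : bool) \1_(U' j b) w) *
     (\prod_(e <- es) phi e (L e w) (Y e w)) *
     \prod_(e' <- e :: fs) phi e' (k' j e') (Y e' w))).
  rewrite -Rintegral_sum//; last first.
    move=> j; apply: unit_rv_integrable; apply: unit_rvM.
      apply: unit_rvM; first by apply: unit_rv_prod => b; exact: mG.
      by apply: unit_rv_prod => e'; apply: (u_label (F := fun j w => phi e' j (Y e' w))) => j'; exact: u_phi.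
    by apply: unit_rv_prod => e'; exact: u_phi.
  apply: eq_Rintegral => w _; rewrite big_cons (labelE e w (fun j => phi e j (Y e w))).
  rewrite mulrA mulr_sumr !mulr_suml; apply: eq_bigr => j _.
  rewrite big_cons (fsE (fun e' j => phi e' j (Y e' w))) {1}/k' eqxx.
  rewrite (bigD1 (own e))//= [in RHS](bigD1 (own e))//= {1}/U' eqxx indicI/=.
  rewrite (restU (fun _ A => \1_A w)); ring.
transitivity (\sum_(j < K.+1) (\prod_(b : bool) \int[P]_w (\1_(U' j b) w *
     \prod_(e <- es | own e == b) mean e (L e w))) *
  \prod_(e' <- e :: fs) mean e' (k' j e')).
  by apply: eq_bigr => j _; exact: IH.
pose Z b A := \int[P]_w (\1_A w * \prod_(e0 <- es | own e0 == b) mean e0 (L e0 w)).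
rewrite [in RHS](bigD1 (own e))//= -mulrA.
have -> : \prod_(b | b != own e) \int[P]_w (\1_(U b) w *
      \prod_(e0 <- e :: es | own e0 == b) mean e0 (L e0 w)) =
    \prod_(b | b != own e) Z b (U b).
  apply: eq_bigr => b /negbTE bo; apply: eq_Rintegral => w _.
  by rewrite big_cons eq_sym bo.
transitivity ((\sum_(j < K.+1) Z (own e) (U (own e) `&` [set w | L e w = j]) * mean e j) *
    (\prod_(b | b != own e) Z b (U b) * (\prod_(e0 <- fs) mean e0 (k e0)))).
  rewrite mulr_suml; apply: eq_bigr => j _.
  rewrite (bigD1 (own e))//= big_cons (fsE mean) {1}/k' eqxx (restU Z) {1}/U' eqxx.
  by rewrite /Z; ring.
congr (_ * _).
have uZ j : unit_rv (fun w => \1_(U (own e) `&` [set w | L e w = j]) w *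
    \prod_(e0 <- es | own e0 == own e) mean e0 (L e0 w)).
  apply: unit_rvM.
    apply: (mG (b := own e)); exact: sigma_algebra_setI.
  apply: unit_rv_prod => e'; apply: (u_label (F := fun j _ => mean e' j)) => j'.
  by apply: unit_rv_cst; exact: mean01.
under eq_bigr => j _ do rewrite /Z -RintegralZr ?unit_rv_integrable//.
rewrite -Rintegral_sum//; last first.
  move=> j; apply: unit_rv_integrable.
  by apply: (unit_rvM (uZ j)); apply: unit_rv_cst; exact: mean01.
apply: eq_Rintegral => w _; rewrite big_cons eqxx (labelE e w (fun j => mean e j)).
rewrite mulr_suml mulr_sumr; apply: eq_bigr => j _; rewrite indicI/=; ring.
Qed.

End marks.

Lemma measurable_nat_fun d (T : measurableType d) (f : T -> nat) :
  (forall k, measurable [set w | f w = k]) -> measurable_fun setT f.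
Proof.
move=> mf _ B mB; rewrite setTI.
rewrite (_ : f @^-1` B = \bigcup_(k in B) [set w | f w = k]).
  exact: bigcup_measurable.
by apply/seteqP; split => [w Bw|w [k Bk /= fw]]; [exists (f w)|rewrite /= fw].
Qed.

(** * Events determined by the enumeration of a process *)

Section process.
Context {R : realType} d (T : measurableType d) (P : probability T R)
  (Phi : point_process P).

Lemma sigma_algebra_process_sigma : sigma_algebra setT (process_sigma Phi).
Proof. exact: smallest_sigma_algebra. Qed.

Lemma process_sigma_point n (B : set (R * R * R)) : measurable B ->
  process_sigma Phi [set w | (n < npts Phi w)%N /\ B (pt Phi n w)].
Proof. by move=> mB; apply: sub_sigma_algebra; exists n, B. Qed.

Lemma measurable_npts (k : nat) : measurable [set w | npts Phi w = k].
Proof.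
by rewrite -[X in measurable X]setTI; exact: (measurable_funPT (npts Phi) measurableT [set k] I).
Qed.

Lemma measurable_npts_gt n : measurable [set w | (n < npts Phi w)%N].
Proof.
by rewrite -[X in measurable X]setTI;
  exact: (measurable_funPT (npts Phi) measurableT [set k | (n < k)%N] I).
Qed.

Lemma measurable_pt n (B : set (R * R * R)) : measurable B ->
  measurable [set w | B (pt Phi n w)].
Proof.
by move=> mB; rewrite -[X in measurable X]setTI; exact: (measurable_funPT (pt Phi n) measurableT B mB).
Qed.

Lemma process_sigma_measurable (A : set T) : process_sigma Phi A -> measurable A.
Proof.
move=> h; apply: h; split; first exact: sigma_algebra_measurable.
move=> _ [n [B [mB ->]]]; apply: measurableI.
  exact: measurable_npts_gt.
exact: measurable_pt.
Qed.

Lemma process_sigmaC (A : set T) : process_sigma Phi A -> process_sigma Phi (~` A).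
Proof. exact: sigma_algebraC. Qed.

Lemma process_sigma_bigcup (A : nat -> set T) :
  (forall n, process_sigma Phi (A n)) -> process_sigma Phi (\bigcup_n A n).
Proof. exact: sigma_algebra_bigcup. Qed.

Lemma process_sigmaI (A B : set T) :
  process_sigma Phi A -> process_sigma Phi B -> process_sigma Phi (A `&` B).
Proof. exact: sigma_algebra_setI sigma_algebra_process_sigma _ _. Qed.

Lemma process_sigma_setT : process_sigma Phi setT.
Proof. by rewrite -setC0; apply: process_sigmaC; exact: sigma_algebra0. Qed.

Lemma npoints_in_gt0 (A : set (R * R * R)) w :
  (0 < npoints_in Phi A w)%N <->
  exists2 n, (n < npts Phi w)%N & A (pt Phi n w).
Proof.
rewrite lt0n sum_nat_eq0 negb_forall; split.
  move=> /existsP[n]; rewrite implyTb eqb0 negbK => /set_mem An.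
  by exists n => //; exact: ltn_ord.
move=> [n nN An]; apply/existsP; exists (Ordinal nN).
by rewrite implyTb eqb0 negbK mem_set.
Qed.

Lemma process_sigma_visible (A : set (R * R * R)) : measurable A ->
  process_sigma Phi [set w | (1 <= npoints_in Phi A w)%N].
Proof.
move=> mA; rewrite (_ : [set w | _] = \bigcup_n
  [set w | (n < npts Phi w)%N /\ A (pt Phi n w)]).
  by apply: process_sigma_bigcup => n; exact: process_sigma_point.
apply/seteqP; split => [w /npoints_in_gt0[n nN An]|w [n _ [nN An]]].
  by exists n.
by apply/npoints_in_gt0; exists n.
Qed.

Lemma measurable_npoints_in (A : set (R * R * R)) : measurable A ->
  measurable_fun setT (npoints_in Phi A).
Proof.
move=> mA; apply: measurable_nat_fun => k.
pose S m w := (\sum_(n < m) (pt Phi n w \in A : nat))%N.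
rewrite (_ : [set w | _] = \bigcup_m
    ([set w | npts Phi w = m] `&` [set w | S m w = k])); last first.
  apply/seteqP; split => [w h|w [m _ [/= <-]]//].
  by exists (npts Phi w).
apply: bigcupT_measurable => m; apply: measurableI; first exact: measurable_npts.
suff mS : measurable_fun setT (S m).
  rewrite -[X in measurable X]setTI.
  by apply: (mS measurableT [set k]).
elim: m => [|m IH].
  rewrite (_ : S 0%N = cst 0%N)//; apply/funext => w.
  by rewrite /S big_ord0.
rewrite (_ : S m.+1 = fun w => (S m w + (pt Phi m w \in A : nat))%N); last first.
  by apply/funext => w; rewrite /S big_ord_recr.
apply: measurable_fun_addn => //.
apply: measurable_nat_fun => j.
have mAm := measurable_pt m mA.
case: j => [|[|j]].
- rewrite (_ : [set w | _] = ~` [set w | A (pt Phi m w)]); first exact: measurableC.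
  by apply/seteqP; split => w /=; [case: (boolP (_ \in A)) => // /negP + _ => /[dup] h _ /mem_set|move=> nA; rewrite memNset].
- rewrite (_ : [set w | _] = [set w | A (pt Phi m w)])//.
  by apply/seteqP; split => w /=; [case: (boolP (_ \in A)) => // /set_mem|move=> An; rewrite mem_set].
- rewrite (_ : [set w | _] = set0)//.
  by apply/seteqP; split => w //=; case: (_ \in A).
Qed.

End process.

(** * Labels of points and products over points *)

Section labels.
Context {R : realType} d (T : measurableType d) (P : probability T R)
  (Phi : point_process P) (c : R * R * R -> nat) (K : nat).
Hypotheses (mc : forall k, measurable [set p | c p = k])
  (c_le : forall p, (c p <= K)%N).

(** Indices beyond the last point receive the neutral label [K], whose factor will be 1. A product
    over a random number of points is then the limit of products over [n < N], which are eventually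
    constant. *)
Definition point_label n w := if (n < npts Phi w)%N then c (pt Phi n w) else K.

Lemma point_label_le n w : (point_label n w <= K)%N.
Proof. by rewrite /point_label; case: ifP. Qed.

Lemma process_sigma_label n k :
  process_sigma Phi [set w | point_label n w = k].
Proof.
have inside j : process_sigma Phi [set w | (n < npts Phi w)%N /\ c (pt Phi n w) = j].
  exact: (@process_sigma_point _ _ _ _ Phi n [set p | c p = j]).
have [<-|/eqP kK] := eqVneq K k; last first.
  rewrite (_ : [set w | _] = [set w | (n < npts Phi w)%N /\ c (pt Phi n w) = k])//.
  apply/seteqP; split => w; rewrite /= /point_label; case: ifP => //; last by move=> _ [].
  by move=> _ [_ ->].
(* The label [K] is also taken beyond the last point, so its level set includes the complement of
   [n < npts], expressed in the sigma-algebra with [setT] as the set of positions. *)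
rewrite (_ : [set w | _] = [set w | (n < npts Phi w)%N /\ c (pt Phi n w) = K] `|`
   ~` [set w | (n < npts Phi w)%N /\ setT (pt Phi n w)]); last first.
  apply/seteqP; split => w; rewrite /= /point_label; case: ifP => //.
  - by move=> h cK; left.
  - by move=> h _; right => -[].
  - by move=> h [[]//|]; case.
rewrite -(setCK (_ `|` _)) setCU; apply: process_sigmaC; apply: process_sigmaI.
  exact: process_sigmaC.
by rewrite setCK; apply: process_sigma_point.
Qed.

Lemma prod_labels_cvg (F : nat -> nat -> T -> R) w : (forall n, F n K w = 1) ->
  \prod_(0 <= n < N) F n (point_label n w) w @[N --> \oo] -->
  \prod_(n < npts Phi w) F n (c (pt Phi n w)) w.
Proof.
move=> F1; apply: cvg_near_cst; near=> N.
have hN : (npts Phi w <= N)%N by near: N; exact: nbhs_infty_ge.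
rewrite (big_cat_nat (leq0n _) hN)//= [X in _ * X]big_nat_cond [X in _ * X]big1 ?mulr1.
  rewrite big_mkord; apply: eq_bigr => n _.
  by rewrite /point_label ltn_ord.
move=> n /andP[/andP[nN _] _].
by rewrite /point_label ltnNge nN F1.
Unshelve. all: by end_near. Qed.

(** Grouping the points by label makes the product a function of the counts alone, whatever the
    order of the enumeration. Points labelled [K] may be left out because their factor is 1. *)
Lemma prod_points_counts (f : nat -> R) w : f K = 1 ->
  \prod_(n < npts Phi w) f (c (pt Phi n w)) =
  \prod_(0 <= k < K) f k ^+ npoints_in Phi [set p | c p = k] w.
Proof.
move=> f1; under [RHS]eq_bigr do rewrite /npoints_in -prodrXr.
rewrite exchange_big/=; apply: eq_bigr => n _.
have [cK|cK] := ltnP (c (pt Phi n w)) K.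
  rewrite (bigD1_seq (c (pt Phi n w))) ?mem_index_iota ?iota_uniq//=.
  rewrite mem_set// expr1 big1 ?mulr1// => k kc.
  by rewrite memNset ?expr0//= => ck; rewrite ck eqxx in kc.
rewrite big_nat big1 => [|k /andP[_ kK]].
  by rewrite -f1; congr f; apply/eqP; rewrite eqn_leq cK c_le.
by rewrite memNset ?expr0//= => ck; move: kK; rewrite -ck ltnNge cK.
Qed.

End labels.

(** * Generating function of a Poisson variable *)

Lemma poisson_pgf {R : realType} d (T : measurableType d) (P : probability T R)
    (N : T -> nat) (rate x : R) :
  measurable_fun setT N -> 0 <= rate -> 0 <= x <= 1 ->
  (forall B, P (N @^-1` B) = poisson_prob rate 0 B) ->
  \int[P]_w x ^+ N w = expR (- ((1 - x) * rate)).
Proof.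
move=> mN rate0 /andP[x0 x1] law.
have x01 n : 0 <= x ^+ n <= 1 by rewrite exprn_ge0 ?exprn_ile1.
have mx (D : set nat) : measurable_fun D (fun n => x ^+ n) by [].
have uxN : unit_rv (fun w => x ^+ N w) by exact: (unit_rv_comp mN (mx setT)).
have PN B : (\int[P]_w ((cst 1 w : R) * \1_B (N w))%:E = P (N @^-1` B))%E.
  rewrite integral_indic_comp; under eq_integral do rewrite /=.
  rewrite integral_cst ?mul1e//.
  by rewrite -[X in measurable X]setTI; exact: mN.
apply: EFin_inj; rewrite EFin_unit_rv//.
transitivity (\int[P]_w ((cst 1 w : R) * x ^+ N w)%:E)%E.
  by under [RHS]eq_integral do rewrite /= mul1r.
(* At rate 0 [poisson_prob] is the Dirac mass at 0. The case does occur: cells below the minimal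
   distance have zero area. *)
move: rate0; rewrite le_eqVlt => /predU1P[r0|rate0].
  transitivity (\int[@dirac _ nat 0%N R]_n ((cst 1 n : R) * x ^+ n)%:E)%E; last first.
    by rewrite integral_dirac// diracT mul1e/= mulr1 -r0 mulr0 oppr0 expR0.
  apply: (eq_integral_weight (X1 := N) (X2 := id)) => //.
    move=> B mB; rewrite PN law /poisson_prob -r0 ltxx.
    by rewrite integral_dirac// diracT mul1e/= mul1r indicE diracE.
  by move=> n; exact: exprn_ge0.
transitivity (\int[@counting nat R]_n (poisson_pmf rate n * x ^+ n)%:E)%E; last first.
  rewrite ge0_integral_count; last first.
    by move=> k; rewrite lee_fin mulr_ge0 ?poisson_pmf_ge0 ?exprn_ge0.
  have -> : expR (- ((1 - x) * rate)) = expR (- rate) * expR (rate * x).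
    by rewrite -expRD; congr expR; ring.
  under eq_eseriesr.
    move=> n _; rewrite /poisson_pmf rate0.
    rewrite (_ : _ * _ = expR (- rate) * ((rate * x) ^+ n / n`!%:R)); last first.
      by rewrite exprMn; ring.
    rewrite EFinM; over.
  rewrite /= nneseriesZl/=; last first.
    by move=> n _; rewrite lee_fin divr_ge0// exprn_ge0// mulr_ge0// ltW.
  rewrite EFinM; congr *%E; rewrite -EFin_lim; last exact: is_cvg_series_exp_coeff.
  by apply/congr_lim/funext => n/=; rewrite /series/= -sumEFin.
apply: (eq_integral_weight (X1 := N) (X2 := id)) => //.
- exact: poisson_pmf_ge0.
- move=> B mB; rewrite PN law /poisson_prob rate0.
  rewrite ge0_integral_count; last first.
    by move=> k; rewrite lee_fin mulr_ge0 ?poisson_pmf_ge0// indicE.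
  rewrite nneseries_esumT; last first.
    by move=> k; rewrite lee_fin mulr_ge0 ?poisson_pmf_ge0// indicE.
  rewrite esum_mkcond; apply: eq_esum => k _.
  by rewrite indicE; case: ifPn => _; rewrite ?mulr1 ?mulr0.
- by move=> n; exact: exprn_ge0.
Qed.

(** * Averaging the fading powers of both networks *)

Section network.
Context {R : realType} d (T : measurableType d) (P : probability T R)
  (Phis Phib : point_process P) (Hs Ht : nat -> {RV P >-> R})
  (cs cb : R * R * R -> nat) (K : nat) (phis phib : nat -> R -> R)
  (means meanb : nat -> R).
Hypotheses (ind : independent_network Phis Phib Hs Ht)
  (mcs : forall k, measurable [set p | cs p = k])
  (mcb : forall k, measurable [set p | cb p = k])
  (cs_le : forall p, (cs p <= K)%N) (cb_le : forall p, (cb p <= K)%N)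
  (mphis : forall k, measurable_fun setT (phis k))
  (mphib : forall k, measurable_fun setT (phib k))
  (phis01 : forall k y, 0 <= phis k y <= 1)
  (phib01 : forall k y, 0 <= phib k y <= 1)
  (phisK : forall y, phis K y = 1) (phibK : forall y, phib K y = 1)
  (meansE : forall n k, \int[P]_w phis k (Hs n w) = means k)
  (meanbE : forall n k, \int[P]_w phib k (Ht n w) = meanb k).

Let u_phis n k : unit_rv (fun w => phis k (Hs n w)).
Proof. exact: unit_rv_comp (measurable_funPT (Hs n)) (mphis k) (phis01 k). Qed.

Let u_phib n k : unit_rv (fun w => phib k (Ht n w)).
Proof. exact: unit_rv_comp (measurable_funPT (Ht n)) (mphib k) (phib01 k). Qed.

Let means01 k : 0 <= means k <= 1.
Proof. by rewrite -(meansE 0); exact: Rintegral_unit_rv. Qed.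

Let meanb01 k : 0 <= meanb k <= 1.
Proof. by rewrite -(meanbE 0); exact: Rintegral_unit_rv. Qed.

Let mean_K (phi : nat -> R -> R) (H : T -> R) : (forall y, phi K y = 1) ->
  \int[P]_w phi K (H w) = 1.
Proof.
move=> phiK; under eq_Rintegral do rewrite phiK.
by rewrite Rintegral_cst// mul1r [X in fine X]probability_setT.
Qed.

Let Ls := point_label Phis cs K.
Let Lb := point_label Phib cb K.

Let mLs n k : measurable [set w | Ls n w = k].
Proof. apply: (@process_sigma_measurable _ _ _ _ Phis); exact: process_sigma_label. Qed.

Let mLb n k : measurable [set w | Lb n w = k].
Proof. apply: (@process_sigma_measurable _ _ _ _ Phib); exact: process_sigma_label. Qed.

(** [expectation_marks] deals with finite lists of marks, hence the truncation to indices below [N].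
    The marks of both networks are treated at once, and [own] tells which process labels them. *)
Let expectation_truncated N (U : set T) : process_sigma Phis U ->
  \int[P]_w (\1_U w * (\prod_(0 <= n < N) phis (Ls n w) (Hs n w)) *
             \prod_(0 <= n < N) phib (Lb n w) (Ht n w)) =
  (\int[P]_w (\1_U w * \prod_(0 <= n < N) means (Ls n w))) *
  \int[P]_w \prod_(0 <= n < N) meanb (Lb n w).
Proof.
move=> GU.
pose own (e : (nat + nat)%type) := if e is inl _ then true else false.
pose G b := if b then process_sigma Phis else process_sigma Phib.
pose Y (e : (nat + nat)%type) : T -> R :=
  match e with inl n => Hs n | inr n => Ht n end.
pose L (e : (nat + nat)%type) := match e with inl n => Ls n | inr n => Lb n end.
pose phi (e : (nat + nat)%type) := match e with inl n => phis | inr n => phib end.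
pose Ub (b : bool) := if b then U else setT.
pose es : seq (nat + nat) := map inl (iota 0 N) ++ map inr (iota 0 N).
have ind' : mutually_independent P (fun i : (bool + (nat + nat))%type =>
    match i with inl b => G b | inr e => sigma_of (Y e) end).
  rewrite (_ : (fun i : (bool + (nat + nat))%type => _) =
    (fun i : (bool + (nat + nat))%type => match i with
    | inl true => process_sigma Phis
    | inl false => process_sigma Phib
    | inr (inl n) => sigma_of (Hs n)
    | inr (inr m) => sigma_of (Ht m)
    end)); first exact: ind.
  by apply/funext => -[[]|[]].
have := @expectation_marks _ _ _ P _ own G Y L K phi _ _ _ ind' _ _ _ _
  es [::] (fun=> 0%N) Ub.
rewrite cats0 !big_bool/= => /(_ _ _ _ _ _ _ _ _ _) E.
transitivity (\int[P]_w ((\prod_(b : bool) \1_(Ub b) w) * (\prod_(e <- es) phi e (L e w) (Y e w)) * \prod_(e <- [::]) phi e 0%N (Y e w))).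
  apply: eq_Rintegral => w _.
  rewrite /es big_cat/= !big_map big_bool /Ub indicT big_nil /index_iota subn0.
  by rewrite /= !mulr1 mulrA.
rewrite E ?big_nil ?mulr1.
- congr (_ * _); apply: eq_Rintegral => w _.
    rewrite /es big_cat/= !big_map /= big_pred0_eq mulr1 /index_iota subn0.
    congr (_ * _); apply: eq_bigr => n _; exact: meansE.
  rewrite /es big_cat/= !big_map /= indicT mul1r big_pred0_eq mul1r.
  by rewrite /index_iota subn0; apply: eq_bigr => n _; exact: meanbE.
- by case; exact: sigma_algebra_process_sigma.
- by case => A; exact: process_sigma_measurable.
- by case=> n; exact: measurable_funPT.
- by case=> n k; exact: process_sigma_label.
- by case=> n w; exact: point_label_le.
- by case.
- by case.
- rewrite /es cat_uniq !map_inj_uniq ?iota_uniq; try by move=> ? ? [].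
  by rewrite andbT/= -all_predC; apply/allP => _ /mapP[n _ ->]; apply/negP => /mapP[].
- by case=> //; exact: process_sigma_setT.
Qed.

Let cvg_labels (Phi : point_process P) c (F : nat -> nat -> T -> R) w :
  (forall n, F n K w = 1) ->
  \prod_(0 <= n < N) F n (point_label Phi c K n w) w @[N --> \oo] -->
  \prod_(n < npts Phi w) F n (c (pt Phi n w)) w.
Proof. exact: prod_labels_cvg. Qed.

(** Letting [N] grow in the truncated identity changes nothing once [N] exceeds the number of
    points, so bounded convergence applies to each side. [U] is an event of the satellite process
    and therefore stays in the first factor. *)
Lemma expectation_network_marks (U : set T) : process_sigma Phis U ->
  \int[P]_w (\1_U w *
     (\prod_(n < npts Phis w) phis (cs (pt Phis n w)) (Hs n w)) *
     \prod_(n < npts Phib w) phib (cb (pt Phib n w)) (Ht n w)) =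
  (\int[P]_w (\1_U w * \prod_(n < npts Phis w) means (cs (pt Phis n w)))) *
  \int[P]_w \prod_(n < npts Phib w) meanb (cb (pt Phib n w)).
Proof.
move=> GU.
have uU : unit_rv (\1_U : T -> R).
  by apply: unit_rv_indic; exact: process_sigma_measurable GU.
have meansK : means K = 1 by rewrite -(meansE 0) mean_K.
have meanbK : meanb K = 1 by rewrite -(meanbE 0) mean_K.
have cvL : \int[P]_w (\1_U w * (\prod_(0 <= n < N) phis (Ls n w) (Hs n w)) *
      \prod_(0 <= n < N) phib (Lb n w) (Ht n w)) @[N --> \oo] -->
    \int[P]_w (\1_U w *
     (\prod_(n < npts Phis w) phis (cs (pt Phis n w)) (Hs n w)) *
     \prod_(n < npts Phib w) phib (cb (pt Phib n w)) (Ht n w)).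
  apply: bounded_convergence => [N|w].
    apply: unit_rvM; first apply: unit_rvM => //.
      apply: unit_rv_prod => n.
      by apply: (unit_rv_select (F := fun k w => phis k (Hs n w))) => // k; exact: mLs.
    apply: unit_rv_prod => n.
    by apply: (unit_rv_select (F := fun k w => phib k (Ht n w))) => // k; exact: mLb.
  apply: cvgM; first apply: cvgM; first exact: cvg_cst.
    by apply: (cvg_labels (F := fun n k w => phis k (Hs n w))) => n.
  by apply: (cvg_labels (F := fun n k w => phib k (Ht n w))) => n.
rewrite -(cvg_lim (@Rhausdorff R) cvL); apply/cvg_lim => //.
rewrite (funext (fun N => expectation_truncated N GU)).
apply: cvgM; apply: bounded_convergence.
- move=> N; apply: unit_rvM => //; apply: unit_rv_prod => n.
  apply: (unit_rv_select (F := fun k w => means k)) => k; first exact: mLs.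
  exact: unit_rv_cst.
- move=> w; apply: cvgM; first exact: cvg_cst.
  by apply: (cvg_labels (F := fun n k w => means k)) => n.
- move=> N; apply: unit_rv_prod => n.
  apply: (unit_rv_select (F := fun k w => meanb k)) => k; first exact: mLb.
  exact: unit_rv_cst.
- by move=> w; apply: (cvg_labels (F := fun n k w => meanb k)) => n.
Qed.

End network.

(** * Counts of a Poisson process in labelled cells *)

Section counts.
Context {R : realType} d (T : measurableType d) (P : probability T R)
  (Phi : point_process P) (rho lambda : R) (c : R * R * R -> nat) (K : nat).
Hypotheses (PPP : homogeneous_PPP_on_sphere rho lambda Phi) (lambda_ge0 : 0 <= lambda)
  (mc : forall k, measurable [set p | c p = k]) (c_le : forall p, (c p <= K)%N).

Definition label_mean k : R := lambda * fine (sphere_area rho [set p | c p = k]).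

Let N k := npoints_in Phi [set p | c p = k].

Let mN k : measurable_fun setT (N k).
Proof. exact: measurable_npoints_in. Qed.

Lemma sphere_area_ge0 (r : R) A : (0 <= sphere_area r A)%E.
Proof.
apply: integral_ge0 => phi _; apply: integral_ge0 => t.
rewrite /= in_itv/= => /andP[t0 tpi]; rewrite lee_fin mulr_ge0//.
by rewrite mulr_ge0 ?sqr_ge0 ?sin_ge0_pi ?t0.
Qed.

Lemma label_mean_ge0 k : 0 <= label_mean k.
Proof. by rewrite mulr_ge0// fine_ge0// sphere_area_ge0. Qed.

Lemma expectation_counts (g : nat -> nat -> R) :
  (forall k n, 0 <= g k n <= 1) ->
  \int[P]_w \prod_(0 <= k < K) g k (N k w) =
  \prod_(0 <= k < K) \int[P]_w g k (N k w).
Proof.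
move=> g01.
apply: (mutually_independent_expectation (f := fun k w => g k (N k w))
  (PPP.2 (fun k => [set p | c p = k]) mc _)) => //.
- apply/trivIsetP => i j _ _ ij; apply/seteqP; split => // p [/= -> ij'].
  by rewrite ij' eqxx in ij.
- by move=> k; apply: (unit_rv_comp (mN k)) => //.
- move=> k B mB; exists (g k @^-1` B) => //; by rewrite setTI.
- exact: iota_uniq.
Qed.

Lemma expectation_exprn_counts x k : 0 <= x <= 1 ->
  \int[P]_w x ^+ N k w = expR (- ((1 - x) * label_mean k)).
Proof.
move=> x01; apply: poisson_pgf => //; first exact: label_mean_ge0.
by move=> B; exact: PPP.1.
Qed.

(** The probability generating functional of the process, on step functions: the counts are
    independent, and each contributes its generating function. *)
Lemma expectation_prod_points (f : nat -> R) :
  (forall k, 0 <= f k <= 1) -> f K = 1 ->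
  \int[P]_w \prod_(n < npts Phi w) f (c (pt Phi n w)) =
  expR (- \sum_(0 <= k < K) (1 - f k) * label_mean k).
Proof.
move=> f01 fK.
under eq_Rintegral => w _ do rewrite (prod_points_counts Phi c_le _ fK).
rewrite (expectation_counts (g := fun k n => f k ^+ n)); last first.
  by move=> k n; have /andP[f0 f1] := f01 k; rewrite exprn_ge0 ?exprn_ile1.
under eq_bigr => k _ do rewrite expectation_exprn_counts//.
by rewrite -expR_sum -sumrN.
Qed.

(* Given that the smallest occupied label is [j], the numbers of points with
   the labels above [j] keep their law. *)
Lemma expectation_first_label (j : nat) (f : nat -> R) (U : set T) : (j < K)%N ->
  measurable U ->
  (forall w, U w <-> (forall k, (k < j)%N -> N k w = 0%N) /\ (0 < N j w)%N) ->
  (forall k, 0 <= f k <= 1) -> f K = 1 -> (forall k, (k <= j)%N -> f k = 1) ->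
  \int[P]_w (\1_U w * \prod_(n < npts Phi w) f (c (pt Phi n w))) =
  (\int[P]_w \1_U w) * expR (- \sum_(0 <= k < K) (1 - f k) * label_mean k).
Proof.
move=> jK mU UE f01 fK fj.
(* [U] is a product of conditions on single counts: empty below [j], occupied at [j], free above.
   Since [f k = 1] for [k <= j], each count carries at most one of the factors [h k] and [f k], so
   the expectation splits. *)
pose h k n : R := if (k < j)%N then (n == 0%N)%:R else
  if k == j then (0 < n)%N%:R else 1.
have h01 k n : 0 <= h k n <= 1.
  rewrite /h; case: ifP => _; first by case: (n == _); rewrite ?lexx ?ler01.
  by case: ifP => _; [case: (0 < n)%N|]; rewrite ?lexx ?ler01.
have U1 w : \1_U w = \prod_(0 <= k < K) h k (N k w).
  rewrite indicE; case: (boolP (w \in U)) => [/set_mem/UE[N0 Nj]|].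
    rewrite big_nat big1// => k _; rewrite /h; case: ifP => [kj|_].
      by rewrite N0.
    by case: eqP => // ->; rewrite Nj.
  rewrite notin_setE => nU; apply/esym/eqP.
  have [/forallP N0|] := boolP [forall k : 'I_j, N k w == 0%N]; last first.
    rewrite negb_forall => /existsP[k Nk].
    rewrite prodf_seq_eq0; apply/hasP; exists (k : nat).
      by rewrite mem_index_iota/= (ltn_trans _ jK).
    by change (h k (N k w) == 0); rewrite /h ltn_ord (negbTE Nk).
  rewrite prodf_seq_eq0; apply/hasP; exists j; first by rewrite mem_index_iota.
  change (h j (N j w) == 0); rewrite /h ltnn eqxx.
  have [Nj|Nj] := posnP (N j w); first by rewrite eqxx.
  by case: nU; apply/UE; split => // k kj; apply/eqP; exact: (N0 (Ordinal kj)).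
transitivity (\int[P]_w \prod_(0 <= k < K) (h k (N k w) * f k ^+ N k w)).
  by apply: eq_Rintegral => w _; rewrite U1 (prod_points_counts Phi c_le _ fK) -big_split.
have fn01 k n : 0 <= f k ^+ n <= 1.
  by have /andP[f0 f1] := f01 k; rewrite exprn_ge0 ?exprn_ile1.
rewrite (expectation_counts (g := fun k n => h k n * f k ^+ n)); last first.
  move=> k n; have /andP[h0 h1] := h01 k n; have /andP[f0 f1] := fn01 k n.
  by rewrite mulr_ge0 ?mulr_ile1.
under [X in _ = X * _]eq_Rintegral do rewrite U1.
rewrite expectation_counts// -sumrN expR_sum -big_split/=.
apply: eq_bigr => k _; rewrite -expectation_exprn_counts//.
have one : fine (P [set: T]) = 1 by rewrite [X in fine X]probability_setT.
have [kj|jk] := leqP k j.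
  under eq_Rintegral do rewrite fj// expr1n mulr1.
  by under [X in _ = _ * X]eq_Rintegral do rewrite fj// expr1n; rewrite Rintegral_cst// one !mulr1.
under [X in _ = X * _]eq_Rintegral do rewrite /h ltnNge (ltnW jk)/= gtn_eqF//.
rewrite Rintegral_cst// one !mul1r; apply: eq_Rintegral => w _.
by rewrite /h ltnNge (ltnW jk)/= gtn_eqF// mul1r.
Qed.

End counts.

Lemma unit_rv_prod_points {R : realType} d (T : measurableType d)
    (P : probability T R) (Phi : point_process P) (c : R * R * R -> nat)
    (F : nat -> nat -> T -> R) :
  (forall k, measurable [set p | c p = k]) -> (forall n k, unit_rv (F n k)) ->
  unit_rv (fun w => \prod_(n < npts Phi w) F n (c (pt Phi n w)) w).
Proof.
move=> mc uF.
apply: (unit_rv_select (F := fun N w => \prod_(n < N) F n (c (pt Phi n w)) w)) => k.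
  exact: measurable_npts.
apply: unit_rv_prod => n.
apply: (unit_rv_select (L := fun w => c (pt Phi n w))) => // j.
exact: (measurable_pt Phi n (mc j)).
Qed.

(** * The identity on a fixed grid *)

Section grid.
Context {R : realType} d (T : measurableType d) (P : probability T R)
  (Phis Phib : point_process P) (Hs Ht : nat -> {RV P >-> R})
  (cs cb : R * R * R -> nat) (K : nat) (phis phib : nat -> R -> R)
  (means meanb : nat -> R) (rhos rhob lambdas lambdab : R).
Hypotheses (ind : independent_network Phis Phib Hs Ht)
  (PPPs : homogeneous_PPP_on_sphere rhos lambdas Phis)
  (PPPb : homogeneous_PPP_on_sphere rhob lambdab Phib)
  (lambdas_ge0 : 0 <= lambdas) (lambdab_ge0 : 0 <= lambdab)
  (mcs : forall k, measurable [set p | cs p = k])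
  (mcb : forall k, measurable [set p | cb p = k])
  (cs_le : forall p, (cs p <= K)%N) (cb_le : forall p, (cb p <= K)%N)
  (mphis : forall k, measurable_fun setT (phis k))
  (mphib : forall k, measurable_fun setT (phib k))
  (phis01 : forall k y, 0 <= phis k y <= 1)
  (phib01 : forall k y, 0 <= phib k y <= 1)
  (phisK : forall y, phis K y = 1) (phibK : forall y, phib K y = 1)
  (meansE : forall n k, \int[P]_w phis k (Hs n w) = means k)
  (meanbE : forall n k, \int[P]_w phib k (Ht n w) = meanb k)
  (nearest : forall w n, (n < npts Phis w)%N -> (cs (pt Phis n w) < K)%N ->
     (cs (pt Phis 0 w) <= cs (pt Phis n w))%N).

Let mus := label_mean rhos lambdas cs.
Let mub := label_mean rhob lambdab cb.

Let first w := cs (pt Phis 0 w).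

Let U j := [set w | (0 < npts Phis w)%N /\ first w = j].

(** Summing over the label of the first point makes the excluded zone deterministic in each term.
    The strict inequality drops all satellites in the cell of the first one, itself included; this
    is what decouples the event from the remaining counts. *)
Lemma expectation_grid (h : nat -> R) :
  (forall j, 0 <= h j <= 1) ->
  \int[P]_w (\1_[set w | (0 < npts Phis w)%N /\ (first w < K)%N] w * h (first w) *
     (\prod_(n < npts Phis w | (first w < cs (pt Phis n w))%N)
         phis (cs (pt Phis n w)) (Hs n w)) *
     \prod_(n < npts Phib w) phib (cb (pt Phib n w)) (Ht n w)) =
  \int[P]_w (\1_[set w | (0 < npts Phis w)%N /\ (first w < K)%N] w * h (first w) *
     expR (- (\sum_(0 <= k < K | (first w < k)%N) (1 - means k) * mus k) -
           \sum_(0 <= k < K) (1 - meanb k) * mub k)).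
Proof.
move=> h01.
(* Replacing the factor by 1 up to the label [j] turns the product over the satellites beyond the
   first cell into a product over all points. *)
pose phij j k y := if (j < k)%N then phis k y else 1.
pose meanj j k := if (j < k)%N then means k else 1.
have one : fine (P [set: T]) = 1 by rewrite [X in fine X]probability_setT.
have GU j : process_sigma Phis (U j).
  exact: (@process_sigma_point _ _ _ _ Phis 0 [set p | cs p = j]).
have uU j : unit_rv (\1_(U j) : T -> R).
  by apply: unit_rv_indic; exact: process_sigma_measurable (GU j).
(* By [nearest] the first point has the least occupied label, so this event about the enumeration is
   an event about counts. *)
have UE j w : (j < K)%N -> U j w <->
    (forall k, (k < j)%N -> npoints_in Phis [set p | cs p = k] w = 0%N) /\
    (0 < npoints_in Phis [set p | cs p = j] w)%N.
  move=> jK; split => [[np fj]|[N0 /npoints_in_gt0[n nN csn]]].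
    split; last by apply/npoints_in_gt0; exists 0%N.
    move=> k kj; apply/eqP; rewrite -leqn0 leqNgt; apply/negP.
    move=> /npoints_in_gt0[n nN /= csn].
    have := nearest nN; rewrite csn => /(_ (ltn_trans kj jK)).
    by rewrite -/(first w) fj leqNgt kj.
  split; first exact: leq_ltn_trans nN.
  have := nearest nN; rewrite csn => /(_ jK).
  rewrite leq_eqVlt => /predU1P[//|fj].
  have np : (0 < npts Phis w)%N by exact: leq_ltn_trans nN.
  have : (0 < npoints_in Phis [set p | cs p = first w] w)%N.
    by apply/npoints_in_gt0; exists 0%N.
  by rewrite N0.
have decomp (F : nat -> T -> R) w :
    \1_[set w | (0 < npts Phis w)%N /\ (first w < K)%N] w * F (first w) w =
    \sum_(0 <= j < K) \1_(U j) w * F j w.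
  rewrite indicE; case: (asboolP ((0 < npts Phis w)%N /\ (first w < K)%N)).
    move=> [np fK]; rewrite mem_set// mul1r (bigD1_seq (first w))/=; last 2 first.
    - by rewrite mem_index_iota.
    - exact: iota_uniq.
    rewrite indicE mem_set// mul1r big1 ?addr0// => j jf.
    by rewrite indicE memNset ?mul0r// => -[_ fj]; rewrite fj eqxx in jf.
  move=> nU; rewrite memNset// mul0r big_nat big1// => j /andP[_ jK].
  rewrite indicE memNset ?mul0r// => -[np fj]; apply: nU.
  by rewrite fj.
have bs : \int[P]_w \prod_(n < npts Phib w) meanb (cb (pt Phib n w)) =
    expR (- \sum_(0 <= k < K) (1 - meanb k) * mub k).
  apply: expectation_prod_points => // [k|].
    rewrite -(meanbE 0); apply: Rintegral_unit_rv.
    exact: unit_rv_comp (measurable_funPT (Ht 0)) (mphib k) (phib01 k).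
  rewrite -(meanbE 0); under eq_Rintegral do rewrite phibK.
  by rewrite Rintegral_cst// mul1r one.
have uphij j n k : unit_rv (fun w => phij j k (Hs n w)).
  rewrite /phij; case: (j < k)%N; last by apply: unit_rv_cst; rewrite ler01 lexx.
  exact: unit_rv_comp (measurable_funPT (Hs n)) (mphis k) (phis01 k).
have uphib n k : unit_rv (fun w => phib k (Ht n w)).
  exact: unit_rv_comp (measurable_funPT (Ht n)) (mphib k) (phib01 k).
have ups j := unit_rv_prod_points Phis mcs (uphij j).
have upb := unit_rv_prod_points Phib mcb uphib.
pose es j := \sum_(0 <= k < K | (j < k)%N) (1 - means k) * mus k.
pose eb := \sum_(0 <= k < K) (1 - meanb k) * mub k.
have e01 j : 0 <= expR (- es j - eb) <= 1.
  rewrite expR_ge0/= -expR0 ler_expR -opprD oppr_le0 addr_ge0//.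
    apply: sumr_ge0 => k _; apply: mulr_ge0; last exact: label_mean_ge0.
    rewrite subr_ge0 -(meansE 0); apply: (andP (Rintegral_unit_rv P _)).2.
    exact: unit_rv_comp (measurable_funPT (Hs 0)) (mphis k) (phis01 k).
  apply: sumr_ge0 => k _; apply: mulr_ge0; last exact: label_mean_ge0.
  by rewrite subr_ge0 -(meanbE 0); apply: (andP (Rintegral_unit_rv P _)).2.
have sat_mean j : (j < K)%N ->
    \int[P]_w (\1_(U j) w * \prod_(n < npts Phis w) meanj j (cs (pt Phis n w))) =
    (\int[P]_w \1_(U j) w) * expR (- es j).
  move=> jK; have -> : es j = \sum_(0 <= k < K) (1 - meanj j k) * label_mean rhos lambdas cs k.
    rewrite /es big_mkcond/=; apply: eq_bigr => k _; rewrite /meanj.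
    by case: ifP => // _; rewrite subrr mul0r.
  apply: (@expectation_first_label _ _ _ _ Phis rhos lambdas cs K PPPs _ _ _ j (meanj j) (U j)) => //.
  - exact: process_sigma_measurable (GU j).
  - by move=> w; exact: UE.
  - move=> k; rewrite /meanj; case: ifP => _; last by rewrite ler01 lexx.
    rewrite -(meansE 0); apply: Rintegral_unit_rv.
    exact: unit_rv_comp (measurable_funPT (Hs 0)) (mphis k) (phis01 k).
  - rewrite /meanj jK -(meansE 0); under eq_Rintegral do rewrite phisK.
    by rewrite Rintegral_cst// mul1r one.
  - by move=> k kj; rewrite /meanj ltnNge kj.
have base_mean : \int[P]_w \prod_(n < npts Phib w) meanb (cb (pt Phib n w)) =
    expR (- eb) by exact: bs.
suff: \int[P]_w (\1_[set w | (0 < npts Phis w)%N /\ (first w < K)%N] w * h (first w) *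
     (\prod_(n < npts Phis w | (first w < cs (pt Phis n w))%N)
         phis (cs (pt Phis n w)) (Hs n w)) *
     \prod_(n < npts Phib w) phib (cb (pt Phib n w)) (Ht n w)) =
  \int[P]_w (\1_[set w | (0 < npts Phis w)%N /\ (first w < K)%N] w * h (first w) *
     expR (- es (first w) - eb)) by [].
move: (es) (eb) e01 sat_mean base_mean => {bs} {}es {}eb e01 sat_mean base_mean.
pose F j w := h j * (\prod_(n < npts Phis w) phij j (cs (pt Phis n w)) (Hs n w)) *
     \prod_(n < npts Phib w) phib (cb (pt Phib n w)) (Ht n w).
have uF j : unit_rv (F j).
  by apply: unit_rvM => //; apply: unit_rvM => //; exact: unit_rv_cst.
have scale (a : R) (f : T -> R) : unit_rv f ->
    \int[P]_w (f w * a) = (\int[P]_w f w) * a.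
  by move=> uf; rewrite RintegralZr//; exact: unit_rv_integrable.
have term j : (j < K)%N ->
    \int[P]_w (\1_(U j) w * F j w) =
    \int[P]_w (\1_(U j) w * (h j * expR (- es j - eb))).
  move=> jK.
  transitivity (\int[P]_w (\1_(U j) w *
      (\prod_(n < npts Phis w) phij j (cs (pt Phis n w)) (Hs n w)) *
      (\prod_(n < npts Phib w) phib (cb (pt Phib n w)) (Ht n w)) * h j)).
    by apply: eq_Rintegral => w _; rewrite /F; ring.
  rewrite scale; last by apply: unit_rvM => //; exact: unit_rvM.
  rewrite (@expectation_network_marks _ _ _ _ Phis Phib Hs Ht cs cb K (phij j) phib
    (meanj j) meanb)//; first last.
  - move=> n k; rewrite /phij /meanj; case: (j < k)%N; first exact: meansE.
    by rewrite Rintegral_cst// mul1r one.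
  - by move=> y; rewrite /phij phisK; case: ifP.
  - by move=> k y; rewrite /phij; case: ifP => // _; rewrite ler01 lexx.
  - by move=> k; rewrite /phij; case: (j < k)%N.
  by rewrite base_mean sat_mean// (scale _ _ (uU j)) expRD; ring.
transitivity (\int[P]_w (\sum_(0 <= j < K) \1_(U j) w * F j w)).
  apply: eq_Rintegral => w _; rewrite -decomp /F -!mulrA; congr (_ * (_ * (_ * _))).
  rewrite big_mkcond/=; apply: eq_bigr => n _; rewrite /phij.
  by case: ifP.
rewrite (@Rintegral_sum _ _ _ P setT)//; last first.
  by move=> j; apply: unit_rv_integrable; exact: unit_rvM.
rewrite [LHS]big_nat (eq_bigr _ (fun j jK => term j (andP jK).2)) -big_nat.
rewrite -(@Rintegral_sum _ _ _ P setT)//; last first.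
  move=> j; apply: unit_rv_integrable; apply: unit_rvM => //.
  by apply: unit_rvM; apply: unit_rv_cst.
apply: eq_Rintegral => w _.
by rewrite -(decomp (fun j _ => h j * expR (- es j - eb))) -mulrA.
Qed.

End grid.

(** * Integrals by primitives *)

Section primitives.
Context {R : realType}.
Notation mu := (@lebesgue_measure R).

(** The right end may be open or closed because it will come either from an open ray or from the
    closed visible cap; the interval may also be degenerate. *)
Lemma integral_itv_FTC2 (f F : R -> R) (a b : R) (s : bool) : a <= b ->
  continuous f -> (forall x : R, is_derive x 1 F (f x)) ->
  (\int[mu]_(x in [set` Interval (BLeft a) (BSide s b)]) (f x)%:E = (F b - F a)%:E)%E.
Proof.
move=> ab cf dF.
have mf : measurable_fun setT (EFin \o f).
  by apply/measurable_EFinP; exact: continuous_measurable_fun.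
have -> : (\int[mu]_(x in [set` Interval (BLeft a) (BSide s b)]) (f x)%:E =
    \int[mu]_(x in `[a, b]) (f x)%:E)%E.
  by case: s => //; rewrite integral_itv_bndo_bndc//; exact: measurable_funTS.
have cF : continuous F.
  move=> x; apply: differentiable_continuous; apply/derivable1_diffP.
  by case: (dF x).
move: ab; rewrite le_eqVlt => /predU1P[->|ab].
  by rewrite set_itv1 integral_set1 subrr.
rewrite (continuous_FTC2 (F := F))//.
- exact: continuous_subspaceT.
- split.
  + by move=> x _; case: (dF x).
  + by apply: cvg_at_right_filter; exact: cF.
  + by apply: cvg_at_left_filter; exact: cF.
- by move=> x _; rewrite derive1E; exact: derive_val.
Qed.

End primitives.

(** * Law of the distance to the user on a visible cap *)

Section polar.
Context {R : realType}.
Notation mu := (@lebesgue_measure R).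
Variables (Ro Ru theta : R).
Hypotheses (Ru_gt0 : 0 < Ru) (Ru_lt_Ro : Ru < Ro)
  (theta_ge0 : 0 <= theta) (theta_lt : theta < pi / 2).

Let Ro_gt0 : 0 < Ro. Proof. exact: lt_trans Ru_lt_Ro. Qed.

Let s1 : 0 <= sin theta < 1.
Proof.
have p0 := @pi_gt0 R.
have tpi : theta <= pi by move: theta_lt p0; lra.
apply/andP; split; first by apply: sin_ge0_pi; rewrite theta_ge0.
have c0 : 0 < cos theta by apply: cos_gt0_pihalf; move: theta_lt theta_ge0 p0; lra.
rewrite ltNge; apply/negP => s1; have := cos2Dsin2 theta.
have : 1 <= sin theta ^+ 2 by rewrite expr_ge1// (le_trans ler01).
have : 0 < cos theta ^+ 2 by rewrite exprn_gt0.
lra.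
Qed.

Lemma Rmin_gt0 : 0 < Rmin Ro Ru.
Proof. by rewrite /Rmin subr_gt0. Qed.

(** After squaring, the difference is [2 * Ru * (Ro - Ru) * (1 - sin theta)]; the elevation angle
    below [pi / 2] makes it positive. *)
Lemma Rmin_lt_Rmax : Rmin Ro Ru < Rmax Ro Ru theta.
Proof.
have /andP[s0 s1'] := s1.
rewrite /Rmin /Rmax ltrBrDr -ltr_sqr ?nnegrE ?sqrtr_ge0//; last first.
  by have := mulr_ge0 (ltW Ru_gt0) s0; move: Ru_lt_Ro; lra.
rewrite sqr_sqrtr; last by move: Ru_gt0 Ru_lt_Ro; nra.
rewrite -subr_gt0.
have -> : Ro ^+ 2 - Ru ^+ 2 + Ru ^+ 2 * sin theta ^+ 2 - (Ro - Ru + Ru * sin theta) ^+ 2 =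
  2 * Ru * (Ro - Ru) * (1 - sin theta) by ring.
by rewrite !mulr_gt0// subr_gt0.
Qed.

(** This bound keeps the argument of the arccosine in [angle] within [-1, 1], and later dominates
    the integrands [v * f v]. *)
Lemma Rmax_le_Ro : Rmax Ro Ru theta <= Ro.
Proof.
have /andP[s0 s1'] := s1.
rewrite /Rmax lerBlDr -ler_sqr ?nnegrE ?sqrtr_ge0//; last first.
  by rewrite addr_ge0 ?mulr_ge0// ltW.
rewrite sqr_sqrtr; last by move: Ru_gt0 Ru_lt_Ro; nra.
rewrite -subr_ge0.
have -> : (Ro + Ru * sin theta) ^+ 2 - (Ro ^+ 2 - Ru ^+ 2 + Ru ^+ 2 * sin theta ^+ 2) =
  Ru ^+ 2 + 2 * Ro * (Ru * sin theta) by ring.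
by rewrite addr_ge0 ?sqr_ge0 ?mulr_ge0// ltW.
Qed.

(** Law of cosines in the triangle formed by the origin, the user and a point at polar angle [t]. *)
Definition polar_dist (t : R) : R := Num.sqrt (Ro ^+ 2 + Ru ^+ 2 - 2 * Ro * Ru * cos t).

Lemma euclid_norm_spherical phi t : euclid_norm (spherical Ro phi t) = Ro.
Proof.
rewrite /euclid_norm /spherical/= -[RHS]ger0_norm ?ltW// -sqrtr_sqr; congr Num.sqrt.
have c := cos2Dsin2 phi; have c' := cos2Dsin2 t.
have -> : (Ro * sin t * cos phi) ^+ 2 + (Ro * sin t * sin phi) ^+ 2 + (Ro * cos t) ^+ 2 =
  Ro ^+ 2 * (sin t ^+ 2 * (cos phi ^+ 2 + sin phi ^+ 2) + cos t ^+ 2) by ring.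
by rewrite c mulr1 (addrC (sin t ^+ 2)) c' mulr1.
Qed.

Lemma euclid_dist_spherical phi t :
  euclid_dist (spherical Ro phi t) (user Ru) = polar_dist t.
Proof.
rewrite /euclid_dist /euclid_norm /spherical/= !subr0; congr Num.sqrt.
have c := cos2Dsin2 phi; have c' := cos2Dsin2 t.
have -> : (Ro * sin t * cos phi) ^+ 2 + (Ro * sin t * sin phi) ^+ 2 + (Ro * cos t - Ru) ^+ 2 =
  Ro ^+ 2 * (sin t ^+ 2 * (cos phi ^+ 2 + sin phi ^+ 2) + cos t ^+ 2) + Ru ^+ 2 - 2 * Ro * Ru * cos t by ring.
by rewrite c mulr1 (addrC (sin t ^+ 2)) c' mulr1.
Qed.

Lemma measurable_polar_dist : measurable_fun setT polar_dist.
Proof.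
apply: continuous_measurable_fun => t.
apply: continuous_comp; last exact: sqrt_continuous.
apply: cvgB; first exact: cvg_cst.
by apply: cvgM; [exact: cvg_cst|exact: continuous_cos].
Qed.

Let radicand_ge t : (Ro - Ru) ^+ 2 <= Ro ^+ 2 + Ru ^+ 2 - 2 * Ro * Ru * cos t.
Proof.
rewrite -subr_ge0.
have -> : Ro ^+ 2 + Ru ^+ 2 - 2 * Ro * Ru * cos t - (Ro - Ru) ^+ 2 =
  2 * Ro * Ru * (1 - cos t) by ring.
by rewrite !mulr_ge0 ?subr_ge0 ?cos_le1// ltW.
Qed.

Lemma Rmin_le_polar_dist t : Rmin Ro Ru <= polar_dist t.
Proof.
rewrite /Rmin -ler_sqr ?nnegrE ?sqrtr_ge0//; last by rewrite subr_ge0 ltW.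
rewrite /polar_dist sqr_sqrtr; first exact: radicand_ge.
by apply: le_trans (radicand_ge t); exact: sqr_ge0.
Qed.

(* The polar angle at distance [y] from the user. *)
Let angle (y : R) : R := acos ((Ro ^+ 2 + Ru ^+ 2 - y ^+ 2) / (2 * Ro * Ru)).

Let cos_arg y : Rmin Ro Ru <= y <= Ro ->
  -1 <= (Ro ^+ 2 + Ru ^+ 2 - y ^+ 2) / (2 * Ro * Ru) <= 1.
Proof.
move=> /andP[ry yR]; have rr : 0 < 2 * Ro * Ru by rewrite !mulr_gt0.
rewrite ler_pdivlMr// ler_pdivrMr// mulN1r mul1r; move: ry; rewrite /Rmin => ry.
have := Ru_lt_Ro; have := Ru_gt0.
  nra.
Qed.

Let angle_itv y : Rmin Ro Ru <= y <= Ro -> angle y \in `[0, pi].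
Proof.
by move=> yR; rewrite in_itv/= acos_ge0 ?acos_lepi// cos_arg.
Qed.

Let cos_angle y : Rmin Ro Ru <= y <= Ro ->
  cos (angle y) = (Ro ^+ 2 + Ru ^+ 2 - y ^+ 2) / (2 * Ro * Ru).
Proof. by move=> yR; rewrite acosK// in_itv/= cos_arg. Qed.

(** The cosine decreases on [[0, pi]], so the distance increases with the polar angle and a cap is
    an interval of angles. The flag treats strict and large inequalities together. *)
Let polar_dist_lteif (s : bool) y t : Rmin Ro Ru <= y <= Ro -> t \in `[0, pi] ->
  (polar_dist t < y ?<= if ~~ s) = (t < angle y ?<= if ~~ s).
Proof.
move=> yR tpi; have /andP[ry _] := yR.
have y0 : 0 <= y by apply: le_trans ry; exact/ltW/Rmin_gt0.
have rr : 0 < 2 * Ro * Ru by rewrite !mulr_gt0.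
have sq : polar_dist t ^+ 2 = Ro ^+ 2 + Ru ^+ 2 - 2 * Ro * Ru * cos t.
  by rewrite sqr_sqrtr//; apply: le_trans (radicand_ge t); exact: sqr_ge0.
have E : (Ro ^+ 2 + Ru ^+ 2 - y ^+ 2) / (2 * Ro * Ru) * (2 * Ro * Ru) =
    Ro ^+ 2 + Ru ^+ 2 - y ^+ 2 by rewrite divfK// gt_eqF.
case: s => /=.
  rewrite -(ltr_cos tpi (angle_itv yR)) cos_angle// -ltr_sqr ?nnegrE ?sqrtr_ge0// sq.
  rewrite ltr_pdivrMr//; apply/idP/idP; lra.
rewrite !leNgt -(ltr_cos (angle_itv yR) tpi) cos_angle// -ltr_sqr ?nnegrE ?sqrtr_ge0// sq.
rewrite ltr_pdivlMr//; congr (~~ _); apply/idP/idP; lra.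
Qed.

(** [Wpolar] is the area density of the cap in the polar angle, [Wdist] its image in the distance
    [y]. Differentiating [y^2 = Ro^2 + Ru^2 - 2 Ro Ru cos t] gives [y dy = Ro Ru sin t dt], hence
    [Ro^2 sin t dt = (Ro / Ru) y dy]: this is the origin of the factor [Ro / Ru] in the scaled
    density. *)
Let Wpolar (t : R) : R := \1_(`[0, pi]) t * (\1_[set t | polar_dist t <= Rmax Ro Ru theta] t * (Ro ^+ 2 * sin t)).

Let Wdist (v : R) : R := \1_(`[Rmin Ro Ru, Rmax Ro Ru theta]) v * (Ro / Ru * v).

Let ray_polar (s : bool) y : Rmin Ro Ru <= y <= Ro ->
  (\int[mu]_(t in [set` Interval (BLeft 0%R) (BSide s (angle y))]) (Ro ^+ 2 * sin t)%:E =
   \int[mu]_(v in [set` Interval (BLeft (Rmin Ro Ru)) (BSide s y)]) (Ro / Ru * v)%:E)%E.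
Proof.
move=> yR; have /andP[ry _] := yR.
have a0 : 0 <= angle y by have := angle_itv yR; rewrite in_itv/= => /andP[].
have csin : continuous (fun t : R => Ro ^+ 2 * sin t).
  by move=> t; apply: cvgM; [exact: cvg_cst|exact: continuous_sin].
have cid : continuous (fun v : R => Ro / Ru * v).
  by move=> v; apply: cvgM; [exact: cvg_cst|exact: cvg_id].
have dcos (t : R) : is_derive t 1 (fun t : R => - (Ro ^+ 2 * cos t)) (Ro ^+ 2 * sin t).
  by apply: is_derive_eq; rewrite /GRing.scale/=; ring.
have dsqr (v : R) : is_derive v 1 (fun v : R => Ro / Ru * (v ^+ 2 / 2)) (Ro / Ru * v).
  by apply: is_derive_eq; rewrite /GRing.scale/=; field; rewrite gt_eqF.
rewrite (integral_itv_FTC2 s a0 csin dcos) (integral_itv_FTC2 s ry cid dsqr).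
congr EFin; rewrite cos_angle// cos0 /Rmin; field.
by rewrite gt_eqF//= gt_eqF.
Qed.

Let Wpolar_ge0 t : 0 <= Wpolar t.
Proof.
rewrite /Wpolar [X in X * _]indicE; case: (boolP (t \in _)) => [|_].
  rewrite inE => tpi; rewrite mul1r mulr_ge0// mulr_ge0 ?sqr_ge0//.
  by apply: sin_ge0_pi; move: tpi; rewrite /= in_itv.
by rewrite mul0r.
Qed.

Let Wdist_ge0 v : 0 <= Wdist v.
Proof.
rewrite /Wdist [X in X * _]indicE; case: (boolP (v \in _)) => [|_].
  rewrite inE/= in_itv/= => /andP[rv _]; rewrite mul1r mulr_ge0//.
    by rewrite divr_ge0 ?ltW.
  by apply: le_trans rv; exact/ltW/Rmin_gt0.
by rewrite mul0r.
Qed.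

Let mWpolar : measurable_fun setT Wpolar.
Proof.
apply: measurable_funM; first by apply: measurable_indic; exact: measurable_itv.
apply: measurable_funM.
  apply: measurable_indic; rewrite -[X in measurable X]setTI.
  rewrite (_ : [set t | _] = polar_dist @^-1` `]-oo, Rmax Ro Ru theta]).
    exact: measurable_polar_dist.
  by apply/seteqP; split => t /=; rewrite in_itv.
apply: measurable_funM => //.
by apply: continuous_measurable_fun; exact: continuous_sin.
Qed.

Let mWdist : measurable_fun setT Wdist.
Proof.
apply: measurable_funM; first by apply: measurable_indic; exact: measurable_itv.
exact: measurable_funM.
Qed.

Let andR (a b : bool) : (a && b)%:R = a%:R * b%:R :> R.
Proof. by case: a; case: b; rewrite ?mulr1 ?mulr0. Qed.

Let rays y : (\int[mu]_t (Wpolar t * \1_(`]-oo, y[) (polar_dist t))%:E =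
  \int[mu]_v (Wdist v * \1_(`]-oo, y[) v)%:E)%E.
Proof.
have [yr|ry] := leP y (Rmin Ro Ru).
  rewrite !integral0_eq// => [v _|t _]; rewrite /Wdist /Wpolar !indicE.
    case: (boolP (v \in _)) => [|_]; last by rewrite !mul0r.
    rewrite inE/= in_itv/= => /andP[rv _]; rewrite memNset ?mulr0//=.
    by rewrite in_itv/= => vy; have := le_trans yr rv; rewrite leNgt vy.
  rewrite [polar_dist t \in `]-oo, y[%classic]memNset ?mulr0//= in_itv/= => ty.
  by have := Rmin_le_polar_dist t; rewrite leNgt (lt_le_trans ty yr).
(* The cap is closed at [M] and the ray open at [y]: their intersection ends at the smaller of the
   two, and is open there exactly when [y <= M]. *)
pose M := Rmax Ro Ru theta; pose s := y <= M; pose Y := Num.min M y.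
have rM : Rmin Ro Ru < M by exact: Rmin_lt_Rmax.
have yR : Rmin Ro Ru <= Y <= Ro.
  by rewrite le_min (ltW rM) (ltW ry)/= ge_min Rmax_le_Ro.
have minE z : (z <= M) && (z < y) = (z < Y ?<= if ~~ s).
  rewrite /s /Y; have [yM|] := boolP (y <= M); rewrite /=.
    rewrite min_r//; case: (ltP z y) => [zy|]; last by rewrite andbF.
    by rewrite (le_trans (ltW zy) yM).
  rewrite -ltNge => My; rewrite (min_l (ltW My)).
  by case: (boolP (z <= M)) => // zM; rewrite (le_lt_trans zM My).
transitivity (\int[mu]_t (Ro ^+ 2 * sin t * \1_[set` Interval (BLeft 0%R) (BSide s (angle Y))] t)%:E)%E.
  apply: eq_integral => t _; congr EFin; rewrite /Wpolar !indicE.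
  have -> : (t \in [set` Interval (BLeft 0%R) (BSide s (angle Y))]) =
      (t \in `[0, pi]) && (polar_dist t <= M) && (polar_dist t < y).
    rewrite -andbA minE; apply/idP/idP.
      rewrite inE/= in_itv/= => /andP[t0 ta].
      have tpi : t \in `[0, pi].
        rewrite in_itv/= t0/=; apply: le_trans (lteifW ta) _.
        by have := angle_itv yR; rewrite in_itv/= => /andP[].
      by rewrite tpi polar_dist_lteif.
    move=> /andP[tpi]; rewrite polar_dist_lteif// inE/= in_itv/= => ->.
    by move: tpi; rewrite in_itv/= => /andP[-> _].
  rewrite [in RHS]mulrC (andR ((t \in `[0, pi]) && (polar_dist t <= M))) (andR (t \in `[0, pi])).
  have -> : (t \in `[0%R, pi]%classic) = (t \in `[0%R, pi]).
    by apply/idP/idP => [/set_mem|/mem_set].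
  have -> : (t \in [set t | polar_dist t <= M]) = (polar_dist t <= M).
    by apply/idP/idP => [/set_mem//|h]; exact/mem_set.
  have -> : (polar_dist t \in `]-oo, y[%classic) = (polar_dist t < y).
    by apply/idP/idP => [/set_mem/=|h]; rewrite ?in_itv//; apply/mem_set; rewrite /= in_itv.
  ring.
rewrite (integral_indic_comp mu (fun t => Ro ^+ 2 * sin t) id) preimage_id.
rewrite ray_polar// -[X in (\int[mu]_(v in X) _)%E]preimage_id.
rewrite -(integral_indic_comp mu (fun v => Ro / Ru * v) id).
apply: eq_integral => v _; congr EFin; rewrite /Wdist !indicE.
have -> : (v \in [set` Interval (BLeft (Rmin Ro Ru)) (BSide s Y)]) =
    (v \in `[Rmin Ro Ru, M]) && (v < y).
  rewrite in_itv/= -andbA minE.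
  by apply/idP/idP => [/set_mem/=|h]; [|apply/mem_set; rewrite /=]; rewrite in_itv.
have -> : (v \in `[Rmin Ro Ru, M]%classic) = (v \in `[Rmin Ro Ru, M]).
  by apply/idP/idP => [/set_mem|/mem_set].
have -> : (v \in `]-oo, y[%classic) = (v < y).
  by apply/idP/idP => [/set_mem/=|h]; rewrite ?in_itv//; apply/mem_set; rewrite /= in_itv.
by rewrite (andR (v \in `[Rmin Ro Ru, M])); ring.
Qed.

Let integral_Wpolar (g : R -> R) : measurable_fun setT g -> (forall v, 0 <= g v) ->
  (\int[mu]_t (Wpolar t * g (polar_dist t))%:E = \int[mu]_v (Wdist v * g v)%:E)%E.
Proof.
move=> mg g0.
apply: (@eq_integral_weight_rays _ _ _ _ _ mu mu Wpolar Wdist polar_dist id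
  mWpolar mWdist measurable_polar_dist _ Wpolar_ge0 Wdist_ge0 _ rays) => //.
apply: (@le_lt_trans _ _ (\int[mu]_(t in `[0%R, pi]) (cst (Ro ^+ 2)%:E) t)%E).
  rewrite [leRHS]integral_mkcond; apply: ge0_le_integral => //.
  - by move=> t _; rewrite lee_fin.
  - exact/measurable_EFinP.
  - by apply/(measurable_restrictT _ _).1 => //; exact: measurable_itv.
  - move=> t _; rewrite patchE /Wpolar [X in X * _]indicE.
    case: ifPn => tpi; last by rewrite mul0r.
    rewrite mul1r lee_fin indicE; have := sin_le1 t.
    have := sqr_ge0 Ro; case: (t \in [set _ | _]); last by rewrite mul0r.
    by rewrite mul1r => R0 st; rewrite ler_piMr.
rewrite integral_cst//= lebesgue_measure_itv/= lte_fin; case: ifP => _.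
  by rewrite -EFinD -EFinM ltry.
by rewrite mule0 ltry.
Qed.

Lemma measurable_euclid_dist :
  measurable_fun setT (fun p : R * R * R => euclid_dist p (user Ru)).
Proof.
have mx : measurable_fun setT (fun p : R * R * R => p.1.1).
  by apply: (measurableT_comp measurable_fst); exact: measurable_fst.
have my : measurable_fun setT (fun p : R * R * R => p.1.2).
  by apply: (measurableT_comp measurable_snd); exact: measurable_fst.
have mz : measurable_fun setT (fun p : R * R * R => p.2) by exact: measurable_snd.
have msqrt : measurable_fun setT (@Num.sqrt R).
  by apply: continuous_measurable_fun; exact: sqrt_continuous.
apply: (measurableT_comp msqrt).
by apply: measurable_funD; first apply: measurable_funD;
  apply: measurable_funX; apply: measurable_funB.
Qed.

(** The distance does not depend on the azimuth, so the outer integral contributes [2 * pi] and the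
    inner one is transported to the distance. *)
Lemma fine_sphere_area_annulus (J : set R) : measurable J ->
  fine (sphere_area Ro [set p | visible Ro Ru theta p /\ J (euclid_dist p (user Ru))]) =
  2 * pi * (Ro / Ru) *
  \int[mu]_(v in `[Rmin Ro Ru, Rmax Ro Ru theta]) (v * \1_J v).
Proof.
move=> mJ; set A := [set p | _].
have inner phi : (\int[mu]_(t in `[0%R, pi]) (\1_A (spherical Ro phi t) * (Ro ^+ 2 * sin t))%:E =
    \int[mu]_t (Wpolar t * \1_J (polar_dist t))%:E)%E.
  rewrite integral_mkcond; apply: eq_integral => t _.
  rewrite patchE /Wpolar [\1_(`[0, pi]) t]indicE.
  case: ifPn => tpi; last by rewrite !mul0r.
  rewrite mul1r; congr EFin.
  rewrite !indicE (_ : (_ \in A) = (t \in [set t | polar_dist t <= Rmax Ro Ru theta]) && (polar_dist t \in J)).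
    by rewrite andR; ring.
  apply/idP/idP => [/set_mem[[_ vis] Jt]|/andP[/set_mem/= vis /set_mem Jt]].
    by rewrite euclid_dist_spherical in vis Jt; apply/andP; split; exact/mem_set.
  apply/mem_set; rewrite /A/= euclid_dist_spherical; split => //.
  by split; [exact: euclid_norm_spherical|rewrite euclid_dist_spherical].
rewrite /sphere_area; under eq_integral do rewrite inner.
have mvJ : measurable_fun setT (fun v : R => v * \1_J v).
  by apply: measurable_funM => //; exact: measurable_indic.
pose I : set R := `[Rmin Ro Ru, Rmax Ro Ru theta]%classic.
have mI : measurable I by exact: measurable_itv.
have Iv v : I v -> 0 <= v * \1_J v <= Ro.
  rewrite /I/= in_itv/= => /andP[rv vR].
  have v0 : 0 <= v by apply: le_trans rv; exact/ltW/Rmin_gt0.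
  rewrite mulr_ge0//= indicE; case: (v \in J); first by rewrite mulr1; exact: le_trans Rmax_le_Ro.
  by rewrite mulr0 ltW.
have finI : (\int[mu]_(v in I) (v * \1_J v)%:E)%E \is a fin_num.
  rewrite ge0_fin_numE; last first.
    by apply: integral_ge0 => v /Iv/andP[]; rewrite lee_fin.
  apply: (@le_lt_trans _ _ (\int[mu]_(v in I) (cst Ro%:E) v)%E).
    apply: ge0_le_integral => //.
    - by move=> v /Iv/andP[]; rewrite lee_fin.
    - by apply/measurable_EFinP; exact: measurable_funTS.
    - by move=> v /Iv/andP[]; rewrite lee_fin.
  rewrite integral_cst//= lebesgue_measure_itv/= lte_fin; case: ifP => _.
    by rewrite -EFinD -EFinM ltry.
  by rewrite mule0 ltry.
have -> : (\int[mu]_t (Wpolar t * \1_J (polar_dist t))%:E =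
    (Ro / Ru)%:E * \int[mu]_(v in I) (v * \1_J v)%:E)%E.
  rewrite integral_Wpolar; last 2 first.
  - exact: measurable_indic.
  - by move=> v; rewrite indicE.
  rewrite -ge0_integralZl_EFin//; last 3 first.
  - by move=> v /Iv/andP[]; rewrite lee_fin.
  - by apply/measurable_EFinP; exact: measurable_funTS.
  - by rewrite divr_ge0 ?ltW.
  rewrite [RHS]integral_mkcond; apply: eq_integral => v _.
  rewrite patchE /Wdist [\1_(`[Rmin Ro Ru, Rmax Ro Ru theta]) v]indicE -/I.
  by case: ifPn => vI; rewrite ?mul0r// mul1r -EFinM mulrA.
rewrite integral_cst//= lebesgue_measure_itv/= lte_fin mulr_gt0 ?pi_gt0//.
rewrite sube0 !fineM//= ?fin_numM//.
by rewrite /Rintegral -/I; ring.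
Qed.

End polar.

(** * Discretisation of distances *)

Section cells.
Context {R : realType}.
Implicit Types x y : R.

Definition cell (n : nat) x : nat := Num.truncn (x * n.+1%:R).

Lemma le_cell n x y : x <= y -> (cell n x <= cell n y)%N.
Proof. by move=> xy; apply: le_truncn; rewrite ler_wpM2r. Qed.

Lemma cell_itv (n : nat) x : 0 <= x ->
  (cell n x)%:R / n.+1%:R <= x < (cell n x).+1%:R / n.+1%:R.
Proof.
move=> x0; rewrite ler_pdivrMr// ltr_pdivlMr//.
by apply: truncn_itv; rewrite mulr_ge0.
Qed.

Lemma cell_upper_cvg x : 0 <= x -> (cell n x).+1%:R / n.+1%:R @[n --> \oo] --> x.
Proof.
move=> x0.
apply: (@squeeze_cvgr _ _ _ _ (fun=> x) (fun n => x + n.+1%:R^-1)).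
- apply: nearW => n; have /andP[lo hi] := cell_itv n x0.
  by rewrite ltW//= -natr1 mulrDl mul1r lerD2r.
- exact: cvg_cst.
- rewrite -[X in _ --> X]addr0; apply: cvgD; first exact: cvg_cst.
  exact: cvg_harmonic.
Qed.

(** If [x < y], the right end of the cell of [x] eventually falls below [y]; otherwise monotonicity
    forbids the strict inequality. The strict order of labels thus becomes the strict order of
    distances in the limit. *)
Lemma near_cell_lt x y : 0 <= x -> \forall n \near \oo, (cell n x < cell n y)%N = (x < y).
Proof.
move=> x0; have [xy|yx] := ltP x y; last first.
  by apply: nearW => n; apply/negbTE; rewrite -leqNgt le_cell.
have /cvgr_lt/(_ y xy) := cell_upper_cvg x0; apply: filterS => n h.
by rewrite /cell truncn_gt_nat -ler_pdivrMr// ltW.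
Qed.

Lemma cvg_cell_lt x y : 0 <= x ->
  (cell n x < cell n y)%N%:R @[n --> \oo] --> ((x < y)%R%:R : R).
Proof.
move=> x0; apply: cvg_near_cst; have := near_cell_lt y x0.
by apply: filterS => n ->.
Qed.

Lemma measurable_cell_level n k : measurable [set x | cell n x = k].
Proof.
have le_k j : measurable [set x | (cell n x <= j)%N].
  rewrite (_ : [set x | _] = `]-oo, j.+1%:R / n.+1%:R[%classic).
    exact: measurable_itv.
  by apply/seteqP; split => x /=; rewrite /cell truncn_le_nat in_itv/= ltr_pdivlMr.
case: k => [|k].
  rewrite (_ : [set x | _] = [set x | (cell n x <= 0)%N])//.
  by apply/seteqP; split => x /=; rewrite leqn0 => /eqP.
rewrite (_ : [set x | _] = [set x | (cell n x <= k.+1)%N] `\` [set x | (cell n x <= k)%N]).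
  exact: measurableD.
apply/seteqP; split => x /=; first by move=> ->; rewrite leqnn ltnn.
by move=> [h /negP]; rewrite -ltnNge => h'; apply/eqP; rewrite eqn_leq h.
Qed.

Lemma measurable_cell n (f : nat -> R) : measurable_fun setT (fun x => f (cell n x)).
Proof.
apply: (measurable_select (F := fun k _ => f k)) => k; last exact: measurable_cst.
exact: measurable_cell_level.
Qed.

End cells.

(** * Sums over the grid converge to integrals *)

Section grid_labels.
Context {R : realType}.
Notation mu := (@lebesgue_measure R).
Variables (Ro Ru theta lambda : R).
Hypotheses (Ru_gt0 : 0 < Ru) (Ru_lt_Ro : Ru < Ro)
  (theta_ge0 : 0 <= theta) (theta_lt : theta < pi / 2).

Let I : set R := `[Rmin Ro Ru, Rmax Ro Ru theta]%classic.

Definition grid_size n := (cell n (Rmax Ro Ru theta)).+1.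

(** [K] is a parameter because the satellite and base-station grids must share one neutral label,
    the larger of their two sizes. *)
Definition grid_label n (K : nat) (p : R * R * R) : nat :=
  if p \in visible Ro Ru theta then cell n (euclid_dist p (user Ru)) else K.

Lemma grid_label_lt n K p : (grid_size n <= K)%N -> visible Ro Ru theta p ->
  (grid_label n K p < K)%N.
Proof.
move=> nK vp; rewrite /grid_label mem_set//; apply: leq_trans nK.
by rewrite ltnS; apply: le_cell; exact: vp.2.
Qed.

Lemma grid_label_le n K p : (grid_size n <= K)%N -> (grid_label n K p <= K)%N.
Proof.
move=> nK; case: (pselect (visible Ro Ru theta p)) => vp.
  exact/ltnW/grid_label_lt.
by rewrite /grid_label memNset.
Qed.

Lemma measurable_euclid_norm : measurable_fun setT (@euclid_norm R).
Proof.
rewrite (_ : euclid_norm = fun p => euclid_dist p (user 0)).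
  exact: measurable_euclid_dist.
by apply/funext => -[[x y] z]; rewrite /euclid_dist /= !subr0.
Qed.

Lemma measurable_visible : measurable (visible Ro Ru theta).
Proof.
rewrite (_ : visible _ _ _ = euclid_norm @^-1` [set Ro] `&`
  (fun p => euclid_dist p (user Ru)) @^-1` `]-oo, Rmax Ro Ru theta]); last first.
  by apply/seteqP; split => p [h1 h2]; split => //; move: h2; rewrite /preimage/= in_itv.
apply: measurableI; rewrite -[X in measurable X]setTI.
  exact: measurable_euclid_norm.
exact: measurable_euclid_dist.
Qed.

Lemma measurable_grid_level n K k : measurable [set p | grid_label n K p = k].
Proof.
pose V := visible Ro Ru theta.
pose C := (fun p => euclid_dist p (user Ru)) @^-1` [set x | cell n x = k].
have mC : measurable C.
  rewrite -[X in measurable X]setTI; apply: measurable_euclid_dist => //.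
  exact: measurable_cell_level.
rewrite (_ : [set p | _] = (V `&` C) `|` (~` V `&` [set _ | K = k])).
  apply: measurableU; apply: measurableI => //.
  - exact: measurable_visible.
  - by apply: measurableC; exact: measurable_visible.
  - by case: (pselect (K = k)) => h; [rewrite (_ : mkset _ = setT)|rewrite (_ : mkset _ = set0)] => //; apply/seteqP; split.
apply/seteqP; split => p; rewrite /= /grid_label.
  case: (pselect (V p)) => Vp; first by rewrite mem_set//; left.
  by rewrite memNset//; right.
by move=> [[Vp Cp]|[nVp Kk]]; [rewrite mem_set|rewrite memNset].
Qed.

Lemma label_mean_grid n K k : (k < K)%N ->
  label_mean Ro lambda (grid_label n K) k =
  2 * pi * scaled_density lambda Ro Ru *
  \int[mu]_(v in I) (v * \1_[set x | cell n x = k] v).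
Proof.
move=> kK; rewrite /label_mean.
rewrite (_ : [set p | _] = [set p | visible Ro Ru theta p /\
   [set x | cell n x = k] (euclid_dist p (user Ru))]).
  rewrite fine_sphere_area_annulus//; last exact: measurable_cell_level.
  by rewrite /scaled_density -/I; ring.
apply/seteqP; split => p; rewrite /= /grid_label.
  case: (boolP (_ \in _)) => [/set_mem//|_ Kk].
  by rewrite Kk ltnn in kK.
by move=> [vp <-]; rewrite mem_set.
Qed.

Let I_itv v : I v -> 0 <= v <= Ro.
Proof.
rewrite /I/= in_itv/= => /andP[rv vR]; apply/andP; split.
  by apply: le_trans rv; exact/ltW/Rmin_gt0.
by apply: le_trans vR _; exact: Rmax_le_Ro.
Qed.

Let mI : measurable I. Proof. exact: measurable_itv. Qed.

Let integrable_bounded (f : R -> R) : measurable_fun I f ->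
  (forall v, I v -> 0 <= f v <= 1) -> mu.-integrable I (fun v => (v * f v)%:E).
Proof.
move=> mf f01.
apply: (@le_integrable _ _ _ mu I mI _ (cst Ro%:E)).
- by apply/measurable_EFinP; exact: measurable_funM.
- move=> v Iv; have /andP[v0 vR] := I_itv Iv; have /andP[f0 f1] := f01 v Iv.
  rewrite lee_fin !ger0_norm ?mulr_ge0//; last exact: le_trans vR.
  by apply: le_trans vR; rewrite ler_piMr.
- apply/integrableP; split => //.
  rewrite (_ : (fun x => _) = cst `|Ro%:E|%E)// integral_cst//= lebesgue_measure_itv/= lte_fin; case: ifP => _.
    by rewrite -EFinD -EFinM ltry.
  by rewrite mule0 ltry.
Qed.

(** For fixed [n] the sum is the integral of the step function [f n (cell n v)] against the law of
    the distance. The constant [Ro] dominates the integrands on a bounded interval. *)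
Lemma grid_sum_cvg (K : nat -> nat) (f : nat -> nat -> R) (g : R -> R) :
  (forall n, grid_size n <= K n)%N ->
  (forall n k, 0 <= f n k <= 1) ->
  (forall v, I v -> f n (cell n v) @[n --> \oo] --> g v) ->
  \sum_(0 <= k < K n) f n k * label_mean Ro lambda (grid_label n (K n)) k
    @[n --> \oo] -->
  2 * pi * scaled_density lambda Ro Ru * \int[mu]_(v in I) (v * g v).
Proof.
move=> nK f01 fg.
have intf n : mu.-integrable I (fun v => (v * f n (cell n v))%:E).
  apply: integrable_bounded => //; apply: measurable_funTS; exact: measurable_cell.
have sumE n : \sum_(0 <= k < K n) f n k * label_mean Ro lambda (grid_label n (K n)) k =
    2 * pi * scaled_density lambda Ro Ru * \int[mu]_(v in I) (v * f n (cell n v)).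
  have int1 k : mu.-integrable I (fun v => (v * \1_[set x | cell n x = k] v)%:E).
    apply: integrable_bounded => [|v _].
      apply: measurable_funTS; apply: measurable_indic; exact: measurable_cell_level.
    by rewrite indicE; case: (_ \in _); rewrite ?lexx ?ler01.
  transitivity (\sum_(0 <= k < K n) 2 * pi * scaled_density lambda Ro Ru *
      \int[mu]_(v in I) (f n k * (v * \1_[set x | cell n x = k] v))).
    rewrite big_nat [RHS]big_nat; apply: eq_bigr => k /andP[_ kK].
    by rewrite label_mean_grid// RintegralZl//; [rewrite mulrCA|exact: int1].
  rewrite -mulr_sumr; congr (_ * _).
  rewrite -Rintegral_sum//; last first.
    move=> k; rewrite (_ : EFin \o _ = (fun v => (f n k)%:E * (v * \1_[set x | cell n x = k] v)%:E)%E)//.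
    exact: integrableZl.
  apply: eq_Rintegral => v /set_mem Iv.
  have vK : (cell n v < K n)%N.
    apply: leq_trans (nK n); rewrite ltnS; apply: le_cell.
    by move: Iv; rewrite /I/= in_itv/= => /andP[].
  rewrite (bigD1_seq (cell n v))/= ?mem_index_iota ?iota_uniq//.
  rewrite indicE mem_set// mulr1 big1 ?addr0 1?mulrC// => k kv.
  by rewrite indicE memNset ?mulr0 ?mulr0//= => vk; rewrite vk eqxx in kv.
under eq_fun do rewrite sumE.
apply: cvgM; first exact: cvg_cst.
have mg : measurable_fun I (fun v => v * g v).
  apply: measurable_funM => //.
  apply: (@measurable_fun_cvg _ _ _ I (fun n v => f n (cell n v))) => [n|v Iv]; last exact: fg.
  by apply: measurable_funTS; exact: measurable_cell.
have := @dominated_convergence _ _ R mu I mI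
  (fun n v => (v * f n (cell n v))%:E) (fun v => (v * g v)%:E) (cst Ro%:E).
case.
- move=> n; apply/measurable_EFinP; apply: measurable_funM => //.
  by apply: measurable_funTS; exact: measurable_cell.
- exact/measurable_EFinP.
- apply: aeW => v Iv; apply: cvg_EFin; first exact: nearW.
  by apply: cvgM; [exact: cvg_cst|exact: fg].
- apply/integrableP; split => //.
  rewrite (_ : (fun x => _) = cst `|Ro%:E|%E)// integral_cst//= lebesgue_measure_itv/= lte_fin; case: ifP => _.
    by rewrite -EFinD -EFinM ltry.
  by rewrite mule0 ltry.
- apply: aeW => v n Iv; have /andP[v0 vR] := I_itv Iv.
  have /andP[f0 f1] := f01 n (cell n v).
  rewrite lee_fin ger0_norm ?mulr_ge0//.
  by apply: le_trans vR; rewrite ler_piMr.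
- move=> intg _ cv; apply: fine_cvg.
  by rewrite /= -[X in _ --> X]fineK in cv; last exact: integrable_fin_num.
Qed.

End grid_labels.

Lemma is_derive_continuous {R : realType} (F f : R -> R) :
  (forall x : R, is_derive x 1 F (f x)) -> continuous F.
Proof.
move=> dF x; apply: differentiable_continuous; apply/derivable1_diffP.
by case: (dF x).
Qed.

(** * Gamma integrals and odd Gaussian moments *)

Section truncated_exponential.
Context {R : realType}.
Notation mu := (@lebesgue_measure R).

(** The tail of the Gamma law of shape [n + 1]. Its derivative telescopes to a single term, so up to
    the factor [- n!] it is a primitive of [t ^+ n * expR (- t)]. *)
Definition exp_trunc n (t : R) : R := expR (- t) * \sum_(i < n.+1) t ^+ i / i`!%:R.

Lemma is_derive_exp_trunc n (t : R) :
  is_derive t 1 (exp_trunc n) (- (expR (- t) * t ^+ n / n`!%:R)).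
Proof.
elim: n => [|n IH].
  rewrite (_ : exp_trunc 0 = fun t => expR (- t)); last first.
    by apply/funext => x; rewrite /exp_trunc big_ord_recl big_ord0 /= expr0 addr0 divr1 mulr1.
  by apply: is_derive_eq; rewrite expr0 /GRing.scale/= fact0; field.
rewrite (_ : exp_trunc n.+1 = fun t => exp_trunc n t + expR (- t) * (t ^+ n.+1 * (n.+1`!%:R)^-1)); last first.
  by apply/funext => x; rewrite /exp_trunc big_ord_recr/= mulrDr.
pose c : R := (n.+1)`!%:R^-1.
have dexp : is_derive t 1 (fun t : R => expR (- t)) (- expR (- t)).
  by apply: is_derive_eq; rewrite /GRing.scale/=; ring.
have dpow : is_derive t 1 (fun t : R => t ^+ n.+1 * c) (n.+1%:R * t ^+ n * c).
  rewrite (_ : (fun t : R => _) = c \*: ((id : R -> R) ^+ n.+1)); last first.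
    by apply/funext => x; rewrite !fctE /GRing.scale/= mulrC.
  by apply: is_derive_eq; rewrite /GRing.scale/=; ring.
have dprod := is_deriveM dexp dpow.
apply: (is_derive_eq (is_deriveD IH dprod)).
have f0 : n`!%:R != 0 :> R by rewrite pnatr_eq0 -lt0n fact_gt0.
have n0 : n.+1%:R != 0 :> R by rewrite pnatr_eq0.
rewrite /GRing.scale/= /c factS natrM exprS; field.
by rewrite f0 nat1r n0.
Qed.

Lemma exp_trunc0 n : exp_trunc n 0 = 1.
Proof.
rewrite /exp_trunc oppr0 expR0 mul1r big_ord_recl/= expr0 divr1 big1 ?addr0// => i _.
by rewrite expr0n/= mul0r.
Qed.

(** The exponential exceeds [t ^+ n.+1 / (n.+1)!], which bounds the product by [(n.+1)! / t]. *)
Lemma exprn_expRN_cvg n : t ^+ n * expR (- t) @[t --> +oo] --> (0 : R).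
Proof.
apply: (@squeeze_cvgr _ _ _ _ (fun=> 0) (fun t => (n.+1)`!%:R * t^-1)).
- near=> t; have t0 : 0 < t by near: t; exact: nbhs_pinfty_gt.
  apply/andP; split; first by rewrite mulr_ge0 ?expR_ge0// exprn_ge0// ltW.
  rewrite expRN ler_pdivrMr ?expR_gt0//.
  have := expR_ge1Dxn n (ltW t0).
  have F0 : 0 < (n.+1)`!%:R :> R by rewrite ltr0n fact_gt0.
  move=> h; have {h}: t ^+ n.+1 / (n.+1)`!%:R <= expR t by apply: le_trans h; rewrite lerDr.
  rewrite ler_pdivrMr// exprS => h.
  by rewrite mulrAC ler_pdivlMr// mulrC (mulrC _`!%:R).
- exact: cvg_cst.
- rewrite -[X in _ --> X](mulr0 (n.+1)`!%:R); apply: cvgM; first exact: cvg_cst.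
  apply/(@gtr0_cvgV0 R R (+oo%R) _ (fun t : R => t)); last exact: cvg_id.
  exact: nbhs_pinfty_gt.
Unshelve. all: by end_near. Qed.

Lemma exp_trunc_cvg n : exp_trunc n t @[t --> +oo] --> 0.
Proof.
have h : \sum_(i < n.+1) (t ^+ i * expR (- t) * (i`!%:R)^-1) @[t --> +oo] -->
    \sum_(i < n.+1) (0 : R).
  apply: cvg_big => [|i _]; first exact: add_continuous.
  rewrite -[X in _ --> X](mul0r (i`!%:R^-1)).
  by apply: cvgM; [exact: exprn_expRN_cvg|exact: cvg_cst].
rewrite big1// in h; apply: cvg_trans h; apply: near_eq_cvg; apply: nearW => t.
by rewrite /exp_trunc mulr_sumr; apply: eq_bigr => i _; rewrite mulrCA mulrA.
Qed.

Lemma continuous_exprn_expR n k (g : R) :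
  continuous (fun t : R => t ^+ n * expR (- (g * t ^+ k))).
Proof.
move=> t; apply: cvgM; first exact: exprn_continuous.
apply: continuous_comp; last exact: continuous_expR.
by apply: cvgN; apply: cvgM; [exact: cvg_cst|exact: exprn_continuous].
Qed.

Lemma integral_exprn_expRN n :
  (\int[mu]_(t in `[0%R, +oo[) (t ^+ n * expR (- t))%:E = n`!%:R%:E)%E.
Proof.
have f0 : n`!%:R != 0 :> R by rewrite pnatr_eq0 -lt0n fact_gt0.
have dF (t : R) : is_derive t 1 (fun t => - n`!%:R * exp_trunc n t) (t ^+ n * expR (- t)).
  have := is_derive_exp_trunc n t => ?; apply: is_derive_eq.
  by rewrite /GRing.scale/=; field.
rewrite (@ge0_continuous_FTC2y _ _ (fun t => - n`!%:R * exp_trunc n t) 0 0).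
- by rewrite exp_trunc0 mulr1 -EFinB sub0r opprK.
- by move=> t t0; rewrite mulr_ge0 ?exprn_ge0// expR_ge0.
- apply: continuous_subspaceT => t.
  by have := @continuous_exprn_expR n 1 1 t; under eq_fun do rewrite mul1r expr1.
- rewrite -[X in _ --> X](mulr0 (- n`!%:R)); apply: cvgM; first exact: cvg_cst.
  exact: exp_trunc_cvg.
- by move=> t _; case: (dF t).
- by apply: cvg_at_right_filter; exact: (is_derive_continuous dF).
- by move=> t _; rewrite derive1E; exact: derive_val.
Qed.

Lemma GammaS n : Gamma (n.+1%:R : R) = n`!%:R.
Proof.
rewrite /Gamma /Rintegral.
under eq_integral => t /set_mem/=.
  rewrite in_itv/= andbT => t0.
  rewrite -natr1 addrK powR_mulrn ?(ltW t0)//; over.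
rewrite [X in fine X](_ : _ = n`!%:R%:E)//.
rewrite -integral_exprn_expRN integral_itv_obnd_cbnd//.
apply/measurable_EFinP; apply: measurable_funTS; apply: continuous_measurable_fun => t.
by have := @continuous_exprn_expR n 1 1 t; under eq_fun do rewrite mul1r expr1.
Qed.

(** The substitution [t = g x^2] leads to a Gamma integral; it is carried out on the primitive, by
    composing [exp_trunc n] with [g * x ^+ 2]. *)
Lemma integral_gaussian_odd n (g : R) : 0 < g ->
  (\int[mu]_(x in `[0%R, +oo[) (x ^+ n.*2.+1 * expR (- (g * x ^+ 2)))%:E =
   (n`!%:R / (2 * g ^+ n.+1))%:E)%E.
Proof.
move=> g0; set C := n`!%:R / (2 * g ^+ n.+1).
have f0 : n`!%:R != 0 :> R by rewrite pnatr_eq0 -lt0n fact_gt0.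
have gn0 : g != 0 by rewrite gt_eqF.
have dF (x : R) : is_derive x 1 (fun x => - C * exp_trunc n (g * x ^+ 2))
    (x ^+ n.*2.+1 * expR (- (g * x ^+ 2))).
  have dq (y : R) : is_derive y 1 (fun y : R => g * y ^+ 2) (g * (2 * y)).
    by apply: is_derive_eq; rewrite /GRing.scale/=; ring.
  have dc : is_derive x 1 (exp_trunc n \o (fun y : R => g * y ^+ 2))
     (- (expR (- (g * x ^+ 2)) * (g * x ^+ 2) ^+ n / n`!%:R) * (g * (2 * x))).
    by apply: is_derive1_comp; exact: is_derive_exp_trunc.
  rewrite (_ : (fun x => _) = (fun x => - C * (exp_trunc n \o (fun y : R => g * y ^+ 2)) x))//.
  apply: is_derive_eq; rewrite /GRing.scale/= /C exprMn -exprM mul2n [g ^+ n.+1]exprS [x ^+ n.*2.+1]exprS.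
  by field; rewrite f0 gn0 expf_neq0.
rewrite (@ge0_continuous_FTC2y _ _ (fun x => - C * exp_trunc n (g * x ^+ 2)) 0 0).
- by rewrite expr0n/= mulr0 exp_trunc0 mulr1 -EFinB sub0r opprK.
- by move=> t t0; rewrite mulr_ge0 ?exprn_ge0// expR_ge0.
- by apply: continuous_subspaceT => t; exact: continuous_exprn_expR.
- rewrite -[X in _ --> X](mulr0 (- C)); apply: cvgM; first exact: cvg_cst.
  apply: (cvg_comp (fun x => g * x ^+ 2) (exp_trunc n)); last exact: exp_trunc_cvg.
  apply/cvgryPgt => A; near=> x.
  have x1 : 1 <= x by near: x; exact: nbhs_pinfty_ge.
  have xA : `|A| / g < x by near: x; apply: nbhs_pinfty_gt; exact: num_real.
  rewrite (le_lt_trans (ler_norm A))//.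
  move: xA; rewrite ltr_pdivrMr// mulrC => xA; apply: lt_le_trans xA _.
  by rewrite ler_pM2l//; nra.
- by move=> t _; case: (dF t).
- by apply: cvg_at_right_filter; exact: (is_derive_continuous dF).
- by move=> t _; rewrite derive1E; exact: derive_val.
Unshelve. all: by end_near. Qed.

End truncated_exponential.

(** * Kummer's transformation at integer parameter *)

Section kummer.
Context {R : realType}.
Implicit Types x : R.

Lemma poch_natS m n : poch (m.+1%:R : R) n = ('C(m + n, n) * n`!)%:R.
Proof.
elim: n => [|n IH]; first by rewrite /poch big_ord0 addn0 bin0.
rewrite /poch big_ord_recr/= -/(poch _ n) IH -natrD -natrM; congr _%:R.
rewrite addnS factS mulnA (mulnC _ n.+1) -mul_bin_diag/= addSn.
by rewrite mulnAC (mulnC (m + n).+1).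
Qed.

(** With [ms = m + 1], this turns the signed factor of [SR_zeta] into a nonnegative falling
    factorial, zero for [z > m]. *)
Lemma poch_oppr m z : (-1) ^+ z * poch (- m%:R : R) z = ('C(m, z) * z`!)%:R.
Proof.
rewrite bin_ffact; elim: z => [|z IH]; first by rewrite /poch big_ord0 expr0 mulr1.
rewrite /poch big_ord_recr/= -/(poch _ z) exprS ffactnSr natrM -IH.
have [zm|mz] := leqP z m; first by rewrite natrB//; ring.
have -> : poch (- m%:R : R) z = 0.
  rewrite /poch (bigD1 (Ordinal mz))//= addNr mul0r//.
by rewrite !(mulr0, mul0r).
Qed.

Let a m x j : R := 'C(m, j)%:R * x ^+ j / j`!%:R.

Let e x k : R := x ^+ k / k`!%:R.

(** The coefficient reduces to ['C(m + n, n)], which Vandermonde's identity splits. The [n]-th term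
    is thus that of the Cauchy product of a polynomial of degree [m] with the exponential series. *)
Let hyp1F1_term m n x :
  poch m.+1%:R n / poch 1 n * x ^+ n / n`!%:R =
  \sum_(0 <= j < m.+1) (if (j <= n)%N then a m x j * e x (n - j) else 0).
Proof.
have f0 k : k`!%:R != 0 :> R by rewrite pnatr_eq0 -lt0n fact_gt0.
transitivity (\sum_(0 <= j < n.+1) a m x j * e x (n - j)).
  rewrite poch_natS -[1]/(1%:R) poch_natS add0n binn mul1n natrM mulfK//.
  rewrite -binomial.Vandermonde natr_sum !mulr_suml big_mkord; apply: eq_bigr => -[j /=].
  rewrite ltnS => jn _; rewrite bin_sub// natrM /a /e.
  have := bin_fact jn => /(congr1 (fun k => k%:R : R)); rewrite !natrM => <-.
  rewrite (_ : x ^+ n = x ^+ j * x ^+ (n - j)); last by rewrite -exprD subnKC.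
  have bn : 'C(n, j)%:R != 0 :> R by rewrite pnatr_eq0 -lt0n bin_gt0.
  by field; rewrite bn !f0.
have ext N (F : nat -> R) k : (N <= k)%N ->
    \sum_(0 <= j < N) F j = \sum_(0 <= j < k) (if (j < N)%N then F j else 0).
  move=> Nk; rewrite (big_cat_nat (leq0n _) Nk)/=.
  have -> : \sum_(N <= j < k) (if (j < N)%N then F j else 0) = 0.
    by rewrite big_nat big1// => j /andP[Nj _]; rewrite ltnNge Nj.
  by rewrite addr0; apply: eq_big_nat => j /andP[_ ->].
rewrite (ext n.+1 _ (maxn n m).+1) ?ltnS ?leq_maxl//.
rewrite [RHS](ext m.+1 _ (maxn n m).+1) ?ltnS ?leq_maxr//.
apply: eq_bigr => j _; rewrite !ltnS; case: ifP => jn; case: ifP => // /negbT.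
by rewrite -ltnNge => mj; rewrite /a bin_small// !mul0r.
Qed.

(** Each coefficient of the polynomial multiplies a shifted partial sum of the exponential series;
    truncated subtraction makes that sum empty for [j >= N]. *)
Let series_term m N x :
  series (fun n => poch m.+1%:R n / poch 1 n * x ^+ n / n`!%:R) N =
  \sum_(0 <= j < m.+1) a m x j * series (e x) (N - j)%N.
Proof.
elim: N => [|N IH].
  rewrite /series/= big_nil big_nat big1// => j _.
  by rewrite /= sub0n big_nil mulr0.
rewrite seriesSr IH hyp1F1_term -big_split/=; apply: eq_bigr => j _.
case: leqP => jN; first by rewrite subSn// seriesSr mulrDr.
have [-> ->] : (N - j = 0 /\ N.+1 - j = 0)%N by split; apply/eqP; rewrite subn_eq0 // ltnW.
by rewrite addr0.
Qed.

(* Kummer's transformation, by the Vandermonde identity. *)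
Lemma hyp1F1_nat m x :
  hyp1F1 m.+1%:R 1 x = expR x * \sum_(0 <= j < m.+1) 'C(m, j)%:R * x ^+ j / j`!%:R.
Proof.
apply/cvg_lim => //.
rewrite (funext (fun N => series_term m N x)) mulr_sumr.
apply: cvg_big => [|j _]; first exact: add_continuous.
rewrite mulrC; apply: cvgM; first exact: cvg_cst.
apply: (cvg_comp (subn^~ j) (series (e x))); first exact: cvg_subnr.
exact: is_cvg_series_exp_coeff.
Qed.

End kummer.

(** * Laplace transforms of the fading powers *)

Section densities.
Context {R : realType} d (T : measurableType d) (P : probability T R).
Notation mu := (@lebesgue_measure R).

Lemma expectation_density (X : T -> R) (f g : R -> R) :
  measurable_fun setT X -> measurable_fun setT f -> (forall x, 0 <= f x) ->
  has_density P X f -> measurable_fun setT g -> (forall x, 0 <= g x <= 1) ->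
  (\int[P]_w g (X w))%:E = (\int[mu]_x (f x * g x)%:E)%E.
Proof.
move=> mX mf f0 Xf mg g01.
rewrite EFin_unit_rv; last exact: unit_rv_comp.
transitivity (\int[P]_w ((cst 1 w : R) * g (X w))%:E)%E.
  by under [RHS]eq_integral do rewrite /= mul1r.
apply: (@eq_integral_weight _ _ _ _ _ _ _ P mu (cst 1) f X id) => //.
- move=> B mB; rewrite !integral_indic_comp -Xf//.
  under eq_integral do rewrite /=.
  rewrite integral_cst ?mul1e//.
  by rewrite -[X in measurable X]setTI; exact: mX.
- by move=> x; have /andP[] := g01 x.
Qed.

End densities.

Section shadowed_rician.
Context {R : realType} (b Omega : R) (m : nat).
Notation mu := (@lebesgue_measure R).
Hypotheses (b_gt0 : 0 < b) (Omega_gt0 : 0 < Omega).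

Let beta := SR_beta b.
Let c := SR_c b Omega m.+1.
Let kappa : R := (2 * b * m.+1%:R / (2 * b * m.+1%:R + Omega)) ^+ m.+1.
Let coef j : R := kappa * 'C(m, j)%:R * c ^+ j / (j`!%:R * b).

Let den_gt0 : 0 < 2 * b * m.+1%:R + Omega.
Proof. by rewrite addr_gt0// mulr_gt0// mulr_gt0. Qed.

(** The difference equals [ms / (2 b ms + Omega)]. It is the Gaussian rate left after Kummer's
    transformation, and its sign makes the moments converge. *)
Lemma SR_beta_gt_c : 0 < SR_beta b - SR_c b Omega m.+1.
Proof.
rewrite /SR_beta /SR_c.
have M0 : 0 < m.+1%:R :> R by [].
move: (m.+1%:R) M0 den_gt0 => M M0 D0.
have -> : 1 / (2 * b) - Omega / (2 * b * (2 * b * M + Omega)) = M / (2 * b * M + Omega).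
  by field; rewrite (gt_eqF D0) (gt_eqF b_gt0).
by rewrite divr_gt0.
Qed.

Let c_gt0 : 0 < c.
Proof. by rewrite /c /SR_c divr_gt0// mulr_gt0// mulr_gt0. Qed.

Let coef_ge0 j : 0 <= coef j.
Proof.
rewrite /coef divr_ge0 ?mulr_ge0 ?exprn_ge0//; do ?exact: ltW.
by rewrite divr_ge0 ?mulr_ge0//; exact: ltW.
Qed.

(** Kummer's transformation brings out [expR (c * x ^+ 2)], which lowers the Gaussian rate from
    [beta] to [beta - c], the constant in the denominators of the result. *)
Lemma shadowed_rician_pdfE x : shadowed_rician_pdf b Omega m.+1 x =
  if 0 < x then \sum_(0 <= j < m.+1) coef j * (x ^+ j.*2.+1 * expR (- ((beta - c) * x ^+ 2)))
  else 0.
Proof.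
rewrite /shadowed_rician_pdf; case: ifP => // x0.
rewrite (_ : Omega * x ^+ 2 / _ = c * x ^+ 2); last by rewrite /c /SR_c mulrAC.
rewrite hyp1F1_nat -/kappa mulrA !mulr_sumr; apply: eq_bigr => j _.
rewrite (_ : - ((beta - c) * x ^+ 2) = - (x ^+ 2 / (2 * b)) + c * x ^+ 2); last first.
  by rewrite /beta /SR_beta; field; rewrite gt_eqF.
have f0 : j`!%:R != 0 :> R by rewrite pnatr_eq0 -lt0n fact_gt0.
rewrite expRD exprMn -exprM mul2n [x ^+ j.*2.+1]exprS /coef.
by field; rewrite f0 gt_eqF.
Qed.

Let odd_gaussian_measurable j (g : R) :
  measurable_fun setT (fun x : R => x ^+ j.*2.+1 * expR (- (g * x ^+ 2))).
Proof. by apply: continuous_measurable_fun; exact: continuous_exprn_expR. Qed.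

Let measurable_pdf : measurable_fun setT (shadowed_rician_pdf b Omega m.+1).
Proof.
rewrite (funext shadowed_rician_pdfE); apply: measurable_fun_ifT => //.
  by apply: measurable_fun_ltr.
by apply: measurable_sum => j; apply: measurable_funM.
Qed.

Let pdf_ge0 x : 0 <= shadowed_rician_pdf b Omega m.+1 x.
Proof.
rewrite shadowed_rician_pdfE; case: ifP => // x0; apply: sumr_ge0 => j _.
by rewrite mulr_ge0 ?coef_ge0// mulr_ge0 ?expR_ge0// exprn_ge0// ltW.
Qed.

Lemma shadowed_rician_laplace d (T : measurableType d) (P : probability T R)
    (Y : T -> R) (a : R) : measurable_fun setT Y ->
  has_density P Y (shadowed_rician_pdf b Omega m.+1) -> 0 <= a ->
  \int[P]_w expR (- (a * Y w ^+ 2)) =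
  \sum_(z < m.+1) SR_zeta b Omega m.+1 z * Gamma (z.+1)%:R /
    (SR_beta b - SR_c b Omega m.+1 + a) ^+ z.+1.
Proof.
move=> mY Yf a0; apply: EFin_inj.
have mg : measurable_fun setT (fun y : R => expR (- (a * y ^+ 2))).
  apply: continuous_measurable_fun => y; apply: continuous_comp; last exact: continuous_expR.
  by apply: cvgN; apply: cvgM; [exact: cvg_cst|exact: exprn_continuous].
rewrite (expectation_density (g := fun y => expR (- (a * y ^+ 2))) mY measurable_pdf pdf_ge0 Yf mg); last first.
  by move=> y; rewrite expR_ge0/= -expR0 ler_expR oppr_le0 mulr_ge0// sqr_ge0.
set g := beta - c + a.
have g0 : 0 < g by rewrite ltr_wpDr// SR_beta_gt_c.
transitivity (\int[mu]_(x in `[0%R, +oo[) \sum_(0 <= j < m.+1)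
    ((coef j)%:E * (x ^+ j.*2.+1 * expR (- (g * x ^+ 2)))%:E))%E.
  rewrite [RHS]integral_mkcond; apply: eq_integral => x _.
  rewrite patchE shadowed_rician_pdfE.
  have -> : (x \in `[0%R, +oo[%classic) = (0 <= x).
    by apply/idP/idP => [/set_mem/=|h]; [|apply/mem_set; rewrite /=]; rewrite in_itv/= andbT.
  (* The domains differ only at 0, where the odd powers vanish as the density does. *)
  rewrite le0r; case: (ltP 0 x) => [x0|x0]; rewrite ?orbT ?orbF.
    rewrite mulr_suml -sumEFin; apply: eq_bigr => j _; rewrite -EFinM; congr EFin.
    rewrite (_ : - (g * x ^+ 2) = - ((beta - c) * x ^+ 2) + - (a * x ^+ 2)); last by rewrite /g; ring.
    by rewrite expRD !mulrA.
  case: ifP => [/eqP ->|_]; last by rewrite mul0r.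
  by rewrite mul0r big1// => j _; rewrite exprS !mul0r mule0.
rewrite ge0_integral_sum//; last 2 first.
- move=> j; apply: measurable_funTS; apply/measurable_EFinP.
  by apply: measurable_funM => //; exact: odd_gaussian_measurable.
- move=> j x; rewrite /= in_itv/= andbT => x0.
  by rewrite lee_fin mulr_ge0 ?coef_ge0// mulr_ge0 ?expR_ge0// exprn_ge0.
rewrite big_mkord -sumEFin; apply: eq_bigr => j _.
rewrite ge0_integralZl_EFin//; last 2 first.
- move=> x; rewrite /= in_itv/= andbT => x0.
  by rewrite lee_fin mulr_ge0 ?exprn_ge0 ?expR_ge0.
- by apply: measurable_funTS; apply/measurable_EFinP; exact: odd_gaussian_measurable.
rewrite integral_gaussian_odd// -EFinM; congr EFin.
have f0 : j`!%:R != 0 :> R by rewrite pnatr_eq0 -lt0n fact_gt0.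
rewrite GammaS /SR_zeta -/kappa -/c (_ : 1 - m.+1%:R = - m%:R); last by rewrite -natr1; ring.
rewrite -(mulrA (SR_beta b)) poch_oppr natrM /coef /SR_beta -/g.
field.
by rewrite f0 expf_neq0 !gt_eqF.
Qed.

End shadowed_rician.

Section nakagami.
Context {R : realType}.
Notation mu := (@lebesgue_measure R).

(** Lebesgue measure is determined by its values on the intervals []x, y]], whose preimages are []x
    / k, y / k]]. *)
Lemma lebesgue_measure_scale (k : R) (B : set R) : 0 < k -> measurable B ->
  (k%:E * mu ([eta *%R k] @^-1` B) = mu B)%E.
Proof.
move=> k0 mB; have mk : measurable_fun setT ([eta *%R k] : R -> R).
  by apply: continuous_measurable_fun => x; apply: cvgM; [exact: cvg_cst|exact: cvg_id].
pose kn : {nonneg R} := NngNum (ltW k0).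
have mB' : measurable (B : set (measurableTypeR R)) by [].
apply/esym.
rewrite (@lebesgue_measure_unique R (mscale kn (pushforward mu ([eta *%R k] : measurableTypeR R -> measurableTypeR R))) _ B)//.
move=> X [[x y] _ <-] /=; rewrite /mscale/= /pushforward.
rewrite (_ : _ @^-1` _ = `]x / k, y / k]%classic); last first.
  apply/seteqP; split => z /=; rewrite !in_itv/= ltr_pdivrMr// ler_pdivlMr//;
    by rewrite (mulrC z).
rewrite !lebesgue_measure_itv/= !lte_fin ltr_pM2r ?invr_gt0//.
case: ifP => _; last by rewrite mule0.
by rewrite -!EFinD -EFinM; congr EFin; field; rewrite gt_eqF.
Qed.

Lemma integral_lebesgue_scale (k : R) (h : R -> R) : 0 < k ->
  measurable_fun setT h -> (forall x, 0 <= h x) ->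
  (\int[mu]_x (k * h (k * x))%:E = \int[mu]_x (h x)%:E)%E.
Proof.
move=> k0 mh h0; have mk : measurable_fun setT ([eta *%R k] : R -> R).
  by apply: continuous_measurable_fun => x; apply: cvgM; [exact: cvg_cst|exact: cvg_id].
transitivity (\int[mu]_x ((cst 1 x : R) * h x)%:E)%E; last first.
  by apply: eq_integral => x _; rewrite /= mul1r.
apply: (@eq_integral_weight _ _ _ _ _ _ _ mu mu (cst k) (cst 1) [eta *%R k] id) => //.
  by move=> x; exact: ltW.
move=> B mB; rewrite !integral_indic_comp preimage_id.
rewrite [LHS](_ : _ = \int[mu]_(x in [eta *%R k] @^-1` B) (cst k%:E) x)%E//.
rewrite [RHS](_ : _ = \int[mu]_(x in B) (cst 1%E) x)%E//.
rewrite !integral_cst//; last by rewrite -[X in measurable X]setTI; exact: mk.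
by rewrite mul1e; exact: lebesgue_measure_scale.
Qed.

Variable m : R.
Hypothesis m_gt0 : 0 < m.

Let Gamma_ge0 (x : R) : 0 <= Gamma x.
Proof. by apply: Rintegral_ge0 => t _; rewrite mulr_ge0 ?powR_ge0 ?expR_ge0. Qed.

Let pdf_ge0 x : 0 <= nakagami_pdf m x.
Proof.
rewrite /nakagami_pdf; case: ifP => // _.
by rewrite !mulr_ge0 ?powR_ge0 ?expR_ge0 ?invr_ge0.
Qed.

Let measurable_pdf : measurable_fun setT (nakagami_pdf m).
Proof.
apply: measurable_fun_ifT => //; first exact: measurable_fun_ltr.
apply: measurable_funM; first by apply: measurable_funM => //; exact: measurable_powR.
apply: continuous_measurable_fun => y; apply: continuous_comp; last exact: continuous_expR.
by apply: cvgN; apply: cvgM; [exact: cvg_cst|exact: exprn_continuous].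
Qed.

(* Rescaling the density turns the transform into its total mass, whatever
   the normalizing constant is. *)
Lemma nakagami_laplace d (T : measurableType d) (P : probability T R)
    (Y : T -> R) (a : R) : measurable_fun setT Y ->
  has_density P Y (nakagami_pdf m) -> 0 <= a ->
  \int[P]_w expR (- (a * Y w ^+ 2)) = (1 + a / m) `^ (- m).
Proof.
move=> mY Yf a0; apply: EFin_inj.
have mg : measurable_fun setT (fun y : R => expR (- (a * y ^+ 2))).
  apply: continuous_measurable_fun => y; apply: continuous_comp; last exact: continuous_expR.
  by apply: cvgN; apply: cvgM; [exact: cvg_cst|exact: exprn_continuous].
rewrite (expectation_density (g := fun y => expR (- (a * y ^+ 2))) mY measurable_pdf pdf_ge0 Yf mg); last first.
  by move=> y; rewrite expR_ge0/= -expR0 ler_expR oppr_le0 mulr_ge0// sqr_ge0.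
set q := 1 + a / m.
have q0 : 0 < q by rewrite ltr_wpDr// divr_ge0// ltW.
(* With this scale [m (k x)^2 = m x^2 + a x^2], so the exponential of the transform is absorbed into
   the density at [k * x]. *)
pose k := Num.sqrt q; have k0 : 0 < k by rewrite sqrtr_gt0.
have kk : k ^+ 2 = q by rewrite sqr_sqrtr// ltW.
have total : (\int[mu]_x (nakagami_pdf m x)%:E = 1)%E.
  by rewrite -(Yf setT)// preimage_setT probability_setT.
rewrite -[RHS]mule1 -total -(integral_lebesgue_scale k0 measurable_pdf pdf_ge0).
rewrite -ge0_integralZl_EFin//; last 3 first.
- by move=> x _; rewrite lee_fin mulr_ge0// ltW.
- apply/measurable_EFinP; apply: measurable_funM => //.
  by apply: (measurableT_comp measurable_pdf); exact: measurable_funM.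
- exact: powR_ge0.
apply: eq_integral => x _; rewrite -EFinM; congr EFin.
rewrite /nakagami_pdf pmulr_rgt0//; case: ifP => x0; last by rewrite mul0r !mulr0.
rewrite powRM ?ltW//.
have -> : q `^ (- m) = k `^ (- (2 * m)).
  by rewrite -kk -powR_mulrn ?ltW// -powRrM mulrN.
have -> : m * (k * x) ^+ 2 = m * x ^+ 2 + a * x ^+ 2.
  by rewrite exprMn kk /q; field; rewrite gt_eqF.
rewrite opprD expRD.
have E : k `^ (- (2 * m)) * (k * k `^ (2 * m - 1)) = 1.
  rewrite -{2}(powRr1 (ltW k0)) -!powRD; last 2 first.
  - by rewrite (gt_eqF k0) ?implybT.
  - by rewrite (gt_eqF k0) ?implybT.
  rewrite (_ : _ + _ = 0) ?powRr0//; ring.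
transitivity ((k `^ (- (2 * m)) * (k * k `^ (2 * m - 1))) *
   (2 * m `^ m / Gamma m * x `^ (2 * m - 1) * (expR (- (m * x ^+ 2)) * expR (- (a * x ^+ 2))))).
  by rewrite E mul1r mulrA.
ring.
Qed.

End nakagami.

(** Points of the process are not given in spherical coordinates. Here the difference of squares is
    [2 * Ru * (Ro - z)], where the height [z] is at most [Ro]. *)
Lemma Rmin_le_euclid_dist {R : realType} (Ro Ru : R) (p : R * R * R) :
  0 < Ru -> Ru < Ro -> sphere Ro p -> Rmin Ro Ru <= euclid_dist p (user Ru).
Proof.
move=> Ru0 RuRo; case: p => [[x y] z]; rewrite /sphere/= /euclid_norm/= => E.
have Ro0 : 0 < Ro by exact: lt_trans RuRo.
have xyz : x ^+ 2 + y ^+ 2 + z ^+ 2 = Ro ^+ 2.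
  by rewrite -E sqr_sqrtr// !addr_ge0 ?sqr_ge0.
have zRo : z <= Ro.
  rewrite leNgt; apply/negP => h; have := sqr_ge0 x; have := sqr_ge0 y.
  by have : Ro ^+ 2 < z ^+ 2; [rewrite ltr_sqr ?nnegrE// ltW// (lt_trans Ro0)|lra].
rewrite /Rmin /euclid_dist /euclid_norm/= !subr0.
rewrite -ler_sqr ?nnegrE ?sqrtr_ge0//; last by rewrite subr_ge0 ltW.
rewrite sqr_sqrtr; last by rewrite !addr_ge0 ?sqr_ge0.
rewrite -subr_ge0.
have -> : x ^+ 2 + y ^+ 2 + (z - Ru) ^+ 2 - (Ro - Ru) ^+ 2 =
  (x ^+ 2 + y ^+ 2 + z ^+ 2 - Ro ^+ 2) + 2 * Ru * (Ro - z) by ring.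
by rewrite xyz subrr add0r mulr_ge0 ?subr_ge0// mulr_ge0// ltW.
Qed.

(** * Vanishing mesh and the conditional identity *)

Section conditional_transform.
Context {R : realType} d (T : measurableType d) (P : probability T R).
Notation mu := (@lebesgue_measure R).
Variables (Ru Rs Rb theta lambdas lambdab : R).
Hypotheses (Ru_gt0 : 0 < Ru) (Ru_lt_Rs : Ru < Rs) (Ru_lt_Rb : Ru < Rb)
  (theta_ge0 : 0 <= theta) (theta_lt : theta < pi / 2)
  (lambdas_ge0 : 0 <= lambdas) (lambdab_ge0 : 0 <= lambdab).
Variables (Phis Phib : point_process P) (Hs Ht : nat -> {RV P >-> R}).
Hypotheses (PPPs : homogeneous_PPP_on_sphere Rs lambdas Phis)
  (PPPb : homogeneous_PPP_on_sphere Rb lambdab Phib)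
  (nearest : first_is_nearest Phis (visible Rs Ru theta) (user Ru))
  (ind : independent_network Phis Phib Hs Ht).
Variables (rates rateb psis psib : R -> R).
Hypotheses (rates_ge0 : forall x, 0 <= rates x) (rateb_ge0 : forall x, 0 <= rateb x)
  (rates_cont : forall x, 0 < x -> {for x, continuous rates})
  (rateb_cont : forall x, 0 < x -> {for x, continuous rateb})
  (psisE : forall n a, 0 <= a ->
     \int[P]_w expR (- (a * Num.sqrt (Hs n w) ^+ 2)) = psis a)
  (psibE : forall n a, 0 <= a ->
     \int[P]_w expR (- (a * Num.sqrt (Ht n w) ^+ 2)) = psib a).

Let u := user Ru.
Let D w := euclid_dist (pt Phis 0 w) u.
Let E : set T := [set w | (1 <= npoints_in Phis (visible Rs Ru theta) w)%N].
Let Is : set R := `[Rmin Rs Ru, Rmax Rs Ru theta]%classic.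
Let Ib : set R := `[Rmin Rb Ru, Rmax Rb Ru theta]%classic.

(** The exponential of the interference without its noise term, as a product over points. Writing
    the fading power as a squared root keeps every factor in [0, 1], even on the null set where a
    power is negative. *)
Definition transform_visible w : R :=
  (\prod_(n < npts Phis w | (pt Phis n w \in visible Rs Ru theta) && (D w < euclid_dist (pt Phis n w) u))
     expR (- (rates (euclid_dist (pt Phis n w) u) * Num.sqrt (Hs n w) ^+ 2))) *
  \prod_(n < npts Phib w | pt Phib n w \in visible Rb Ru theta)
     expR (- (rateb (euclid_dist (pt Phib n w) u) * Num.sqrt (Ht n w) ^+ 2)).

(** The lower limit [r] is written as a factor of the integrand, so that the domain of integration
    is fixed and [grid_sum_cvg] applies. *)
Definition transform_mean (r : R) : R :=
  expR (- (2 * pi * scaled_density lambdas Rs Ru *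
             \int[mu]_(v in Is) (v * ((r < v)%R%:R * (1 - psis (rates v))))) -
        2 * pi * scaled_density lambdab Rb Ru *
             \int[mu]_(v in Ib) (v * (1 - psib (rateb v)))).

Let msqrt : measurable_fun setT (@Num.sqrt R).
Proof. by apply: continuous_measurable_fun; exact: sqrt_continuous. Qed.

Let fading (a h : R) : R := expR (- (a * Num.sqrt h ^+ 2)).

Let fading01 a h : 0 <= a -> 0 <= fading a h <= 1.
Proof.
by move=> a0; rewrite expR_ge0/= -expR0 ler_expR oppr_le0 mulr_ge0// sqr_ge0.
Qed.

Let mfading a : measurable_fun setT (fading a).
Proof.
apply: (measurableT_comp (f := fun y : R => expR (- (a * y ^+ 2)))) => //.
apply: continuous_measurable_fun => y; apply: continuous_comp; last exact: continuous_expR.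
by apply: cvgN; apply: cvgM; [exact: cvg_cst|exact: exprn_continuous].
Qed.

Let u_fading a (H : {RV P >-> R}) : 0 <= a -> unit_rv (fun w => fading a (H w)).
Proof.
by move=> a0; apply: (unit_rv_comp (measurable_funPT H) (mfading a)) => h; exact: fading01.
Qed.

Let fading_cvg (a : nat -> R) l h : a n @[n --> \oo] --> l ->
  fading (a n) h @[n --> \oo] --> fading l h.
Proof.
move=> al; apply: (continuous_cvg _ (@continuous_expR R _)).
by apply: cvgN; apply: cvgM => //; exact: cvg_cst.
Qed.

(** The right end of cell [k], at which the path loss of the whole cell is evaluated. *)
Let rep n k : R := k.+1%:R / n.+1%:R.

Let rate_cvg (rate : R -> R) x : 0 < x -> {for x, continuous rate} ->
  rate (rep n (cell n x)) @[n --> \oo] --> rate x.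
Proof.
move=> x0 cx; apply: (continuous_cvg _ cx).
exact/cell_upper_cvg/ltW.
Qed.

Let K n := maxn (grid_size Rs Ru theta n) (grid_size Rb Ru theta n).
Let cs n := grid_label Rs Ru theta n (K n).
Let cb n := grid_label Rb Ru theta n (K n).
Let phi (rate : R -> R) n k (h : R) : R :=
  if (k < K n)%N then fading (rate (rep n k)) h else 1.
Let mean (psi rate : R -> R) n k : R :=
  if (k < K n)%N then psi (rate (rep n k)) else 1.

Let K_s n : (grid_size Rs Ru theta n <= K n)%N. Proof. exact: leq_maxl. Qed.
Let K_b n : (grid_size Rb Ru theta n <= K n)%N. Proof. exact: leq_maxr. Qed.

Let mcs n k : measurable [set p | cs n p = k]. Proof. exact: measurable_grid_level. Qed.
Let mcb n k : measurable [set p | cb n p = k]. Proof. exact: measurable_grid_level. Qed.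

Let phi01 rate n k h : (forall x, 0 <= rate x) -> 0 <= phi rate n k h <= 1.
Proof.
move=> r0; rewrite /phi; case: (k < K n)%N; first exact: fading01.
by rewrite ler01 lexx.
Qed.

Let mphi rate n k : measurable_fun setT (phi rate n k).
Proof. by rewrite /phi; case: (k < K n)%N. Qed.

Let one : fine (P [set: T]) = 1. Proof. by rewrite [X in fine X]probability_setT. Qed.

Let phi_mean (psi rate : R -> R) (H : nat -> {RV P >-> R}) n k i :
  (forall x, 0 <= rate x) ->
  (forall n a, 0 <= a -> \int[P]_w fading a (H n w) = psi a) ->
  \int[P]_w phi rate n k (H i w) = mean psi rate n k.
Proof.
move=> r0 psiE; rewrite /phi /mean; case: (k < K n)%N; first exact: psiE.
by rewrite Rintegral_cst// mul1r one.
Qed.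

(** No formula for [psi] is used: being an expectation of [fading], it inherits continuity from the
    integrand by bounded convergence. *)
Let psi_cvg (psi rate : R -> R) (H : nat -> {RV P >-> R}) x : 0 < x ->
  (forall x, 0 <= rate x) -> {for x, continuous rate} ->
  (forall n a, 0 <= a -> \int[P]_w fading a (H n w) = psi a) ->
  psi (rate (rep n (cell n x))) @[n --> \oo] --> psi (rate x).
Proof.
move=> x0 r0 cx psiE; rewrite -(psiE 0%N)//.
rewrite (funext (fun n => esym (psiE 0%N (rate (rep n (cell n x))) (r0 _)))).
apply: bounded_convergence => [n|w]; first exact: u_fading.
by apply: fading_cvg; exact: rate_cvg.
Qed.

Let visible_dist Ro p : Ru < Ro -> visible Ro Ru theta p ->
  Rmin Ro Ru <= euclid_dist p u <= Rmax Ro Ru theta /\ 0 < euclid_dist p u.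
Proof.
move=> RuRo [sp dp]; have rp := Rmin_le_euclid_dist Ru_gt0 RuRo sp.
by rewrite rp dp; split => //; apply: lt_le_trans rp; exact: Rmin_gt0.
Qed.

Let E_first w : E w -> visible Rs Ru theta (pt Phis 0 w).
Proof. by move=> /nearest[]. Qed.

Let E_npts w : E w -> (0 < npts Phis w)%N.
Proof. by move=> /npoints_in_gt0[n nN _]; exact: leq_ltn_trans nN. Qed.

Let cs_visible n p : (cs n p < K n)%N -> visible Rs Ru theta p.
Proof.
rewrite /cs /grid_label; case: (boolP (p \in _)) => [/set_mem//|_].
by rewrite ltnn.
Qed.

(** By [nearest], some satellite is visible exactly when the point of index 0 exists and is
    visible. *)
Let EE n : [set w | (0 < npts Phis w)%N /\ (cs n (pt Phis 0 w) < K n)%N] = E.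
Proof.
apply/seteqP; split => w /=.
  move=> [np /cs_visible v0]; apply/npoints_in_gt0; by exists 0%N.
move=> Ew; split; first exact: E_npts.
by apply: grid_label_lt => //; exact: E_first.
Qed.

Let first_cell n w : E w -> cs n (pt Phis 0 w) = cell n (D w).
Proof. by move=> /E_first v; rewrite /cs /grid_label mem_set. Qed.

Let grid_nearest n w i : (i < npts Phis w)%N -> (cs n (pt Phis i w) < K n)%N ->
  (cs n (pt Phis 0 w) <= cs n (pt Phis i w))%N.
Proof.
move=> iN /cs_visible vi.
have Ew : E w by apply/npoints_in_gt0; exists i.
rewrite first_cell// /cs /grid_label mem_set//; apply: le_cell.
by have [_ /(_ i iN vi)] := nearest Ew.
Qed.

Let mE : measurable E.
Proof. by apply: (@process_sigma_measurable _ _ _ _ Phis); apply: process_sigma_visible; exact: measurable_visible. Qed.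

(** Factor by factor, the labels of a visible point follow its distance, while an invisible point
    keeps the neutral label and the factor 1. [Q] and [q] cover both uses: satellites beyond the
    nearest one, and all base stations. *)
Let prod_points_cvg (Phi : point_process P) (H : nat -> {RV P >-> R}) (Ro : R) (rate : R -> R)
    (Q : nat -> nat -> bool) (q : R -> bool) w :
  Ru < Ro -> (forall n, grid_size Ro Ru theta n <= K n)%N ->
  (forall x, 0 <= rate x) -> (forall x, 0 < x -> {for x, continuous rate}) ->
  (forall x, 0 < x -> \forall n \near \oo, Q n (cell n x) = q x) ->
  \prod_(i < npts Phi w | Q n (grid_label Ro Ru theta n (K n) (pt Phi i w)))
     phi rate n (grid_label Ro Ru theta n (K n) (pt Phi i w)) (H i w) @[n --> \oo] -->
  \prod_(i < npts Phi w | (pt Phi i w \in visible Ro Ru theta) && q (euclid_dist (pt Phi i w) u))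
     fading (rate (euclid_dist (pt Phi i w) u)) (H i w).
Proof.
move=> RuRo Ro_K r0 rc Qq; rewrite big_mkcond/=.
under eq_fun do rewrite big_mkcond/=.
apply: cvg_big => [|i _]; first exact: mul_continuous.
set p := pt Phi i w; case: (boolP (p \in visible Ro Ru theta)) => [/set_mem vp|nvp].
  have [_ x0] := visible_dist RuRo vp; set x := euclid_dist p u in x0 *.
  have lab n : grid_label Ro Ru theta n (K n) p = cell n x by rewrite /grid_label mem_set.
  rewrite /=; apply: (@cvg_trans _ ((if q x then fading (rate (rep n (cell n x))) (H i w) else 1) @[n --> \oo])).
    apply: near_eq_cvg; move: (Qq x x0); apply: filterS => n Qn.
    by rewrite lab Qn /phi -lab grid_label_lt.
  case: (q x); last exact: cvg_cst.
  by apply: fading_cvg; apply: rate_cvg => //; exact: rc.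
rewrite /=; apply: cvg_near_cst; apply: nearW => n.
by rewrite /grid_label (negbTE nvp) /phi ltnn; case: (Q n _).
Qed.

Let mean01 (psi rate : R -> R) (H : nat -> {RV P >-> R}) n k :
  (forall x, 0 <= rate x) ->
  (forall n a, 0 <= a -> \int[P]_w fading a (H n w) = psi a) ->
  0 <= mean psi rate n k <= 1.
Proof.
move=> r0 psiE; rewrite /mean; case: (k < K n)%N; last by rewrite ler01 lexx.
by rewrite -(psiE 0%N)//; apply: Rintegral_unit_rv; exact: u_fading.
Qed.

Let first_level n k : measurable [set w | cs n (pt Phis 0 w) = k].
Proof. exact: (measurable_pt Phis 0 (mcs n k)). Qed.

Let sat_exponent_cvg r : 0 < r ->
  \sum_(0 <= k < K n | (cell n r < k)%N)
     (1 - mean psis rates n k) * label_mean Rs lambdas (cs n) k @[n --> \oo] -->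
  2 * pi * scaled_density lambdas Rs Ru *
     \int[mu]_(v in Is) (v * ((r < v)%R%:R * (1 - psis (rates v)))).
Proof.
move=> r0.
have h01 n k : 0 <= (cell n r < k)%N%:R * (1 - mean psis rates n k) <= 1.
  have /andP[m0 m1] := mean01 n k rates_ge0 psisE.
  by case: (cell n r < k)%N; rewrite ?mul1r ?mul0r ?lexx ?ler01// subr_ge0 m1/= gerBl.
have hc v : Is v -> (cell n r < cell n v)%N%:R * (1 - mean psis rates n (cell n v)) @[n --> \oo] -->
    (r < v)%R%:R * (1 - psis (rates v)).
  rewrite /Is/= in_itv/= => /andP[rv vR].
  have v0 : 0 < v by apply: lt_le_trans rv; exact: Rmin_gt0.
  apply: cvgM; first by apply: cvg_cell_lt; exact: ltW.
  apply: cvgB; first exact: cvg_cst.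
  apply: cvg_trans (psi_cvg v0 rates_ge0 (rates_cont v0) psisE).
  apply: near_eq_cvg; apply: nearW => n; rewrite /mean ifT//.
  by apply: leq_trans (K_s n); rewrite ltnS; exact: le_cell.
have := @grid_sum_cvg _ Rs Ru theta lambdas Ru_gt0 Ru_lt_Rs theta_ge0 theta_lt K
  (fun n k => (cell n r < k)%N%:R * (1 - mean psis rates n k))
  (fun v => (r < v)%R%:R * (1 - psis (rates v))) K_s h01 hc.
apply: cvg_trans; apply: near_eq_cvg; apply: nearW => n; rewrite [RHS]big_mkcond/=.
apply: eq_bigr => k _.
by case: (cell n r < k)%N; rewrite ?mul1r ?mul0r.
Qed.

Let base_exponent_cvg :
  \sum_(0 <= k < K n) (1 - mean psib rateb n k) * label_mean Rb lambdab (cb n) k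
    @[n --> \oo] -->
  2 * pi * scaled_density lambdab Rb Ru * \int[mu]_(v in Ib) (v * (1 - psib (rateb v))).
Proof.
apply: (@grid_sum_cvg _ Rb Ru theta lambdab Ru_gt0 Ru_lt_Rb theta_ge0 theta_lt K
  (fun n k => 1 - mean psib rateb n k)) K_b _ _.
- move=> n k; have /andP[m0 m1] := mean01 n k rateb_ge0 psibE.
  by rewrite subr_ge0 m1/= gerBl.
- move=> v; rewrite /= in_itv/= => /andP[rv vR].
  have v0 : 0 < v by apply: lt_le_trans rv; exact: Rmin_gt0.
  apply: cvgB; first exact: cvg_cst.
  apply: cvg_trans (psi_cvg v0 rateb_ge0 (rateb_cont v0) psibE).
  apply: near_eq_cvg; apply: nearW => n; rewrite /mean ifT//.
  by apply: leq_trans (K_b n); rewrite ltnS; exact: le_cell.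
Qed.

(** The grid exponents depend on [r] only through its cell, so they are measurable, and so is their
    pointwise limit. *)
Lemma measurable_transform_mean : measurable_fun Is transform_mean.
Proof.
apply: (@measurable_fun_cvg _ _ _ Is (fun n r =>
    expR (- (\sum_(0 <= k < K n | (cell n r < k)%N)
               (1 - mean psis rates n k) * label_mean Rs lambdas (cs n) k) -
         \sum_(0 <= k < K n) (1 - mean psib rateb n k) * label_mean Rb lambdab (cb n) k))).
  move=> n; apply: measurable_funTS.
  exact: (measurable_cell n (fun j => expR (- (\sum_(0 <= k < K n | (j < k)%N)
               (1 - mean psis rates n k) * label_mean Rs lambdas (cs n) k) -
         \sum_(0 <= k < K n) (1 - mean psib rateb n k) * label_mean Rb lambdab (cb n) k))).
move=> r; rewrite /Is/= in_itv/= => /andP[rr _].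
apply: (continuous_cvg _ (@continuous_expR R _)).
apply: cvgB base_exponent_cvg; apply: cvgN; apply: sat_exponent_cvg.
by apply: lt_le_trans rr; exact: Rmin_gt0.
Qed.

Lemma measurable_psis_rates : measurable_fun (`]0%R, +oo[%classic : set R) (fun v => psis (rates v)).
Proof.
apply: (@measurable_fun_cvg _ _ _ _ (fun n v => psis (rates (rep n (cell n v))))).
  move=> n; apply: measurable_funTS.
  exact: (measurable_cell n (fun k => psis (rates (rep n k)))).
move=> v; rewrite /= in_itv/= andbT => v0.
exact: (psi_cvg v0 rates_ge0 (rates_cont v0) psisE).
Qed.

(** The strict inequality leaves out the end point [r], a null set. *)
Lemma Rintegral_above r : Is r ->
  \int[mu]_(v in Is) (v * ((r < v)%R%:R * (1 - psis (rates v)))) =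
  \int[mu]_(v in `[r, Rmax Rs Ru theta]) ((1 - psis (rates v)) * v).
Proof.
rewrite /Is/= in_itv/= => /andP[rr rR].
have r0 : 0 < r by apply: lt_le_trans rr; exact: Rmin_gt0.
rewrite /Rintegral; congr fine; rewrite -[RHS]integral_itv_obnd_cbnd; last first.
  apply/measurable_EFinP; apply: measurable_funM => //; apply: measurable_funB => //.
  apply: measurable_funS measurable_psis_rates => // v /=.
  by rewrite !in_itv/= andbT => /andP[rv _]; exact: lt_trans rv.
rewrite [LHS]integral_mkcond [RHS]integral_mkcond; apply: eq_integral => v _.
rewrite !patchE.
have -> : (v \in Is) = (Rmin Rs Ru <= v <= Rmax Rs Ru theta).
  by rewrite /Is; apply/idP/idP => [/set_mem/=|h]; [|apply/mem_set; rewrite /=]; rewrite in_itv.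
have -> : (v \in `]r, Rmax Rs Ru theta]%classic) = (r < v <= Rmax Rs Ru theta).
  by apply/idP/idP => [/set_mem/=|h]; [|apply/mem_set; rewrite /=]; rewrite in_itv.
case: (ltP r v) => rv /=; last by rewrite mul0r mulr0; case: ifP.
by rewrite (le_trans rr (ltW rv)) mul1r mulrC.
Qed.

(** [hn] and [hl] are test functions of the label and of the distance. They will be the constant 1
    and the indicators of rays, which cells approximate pointwise; an arbitrary Borel set has no
    such approximation. *)
Lemma grid_limit (hn : nat -> nat -> R) (hl : R -> R) :
  (forall n k, 0 <= hn n k <= 1) ->
  (forall x, 0 < x -> hn n (cell n x) @[n --> \oo] --> hl x) ->
  [/\ unit_rv (fun w => \1_E w * hl (D w) * transform_visible w),
      unit_rv (fun w => \1_E w * hl (D w) * transform_mean (D w)) &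
      \int[P]_w (\1_E w * hl (D w) * transform_visible w) =
      \int[P]_w (\1_E w * hl (D w) * transform_mean (D w))].
Proof.
move=> hn01 hnl.
pose Xn n w := \1_E w * hn n (cs n (pt Phis 0 w)) *
     (\prod_(i < npts Phis w | (cs n (pt Phis 0 w) < cs n (pt Phis i w))%N)
         phi rates n (cs n (pt Phis i w)) (Hs i w)) *
     \prod_(i < npts Phib w) phi rateb n (cb n (pt Phib i w)) (Ht i w).
pose Yn n w := \1_E w * hn n (cs n (pt Phis 0 w)) *
   expR (- (\sum_(0 <= k < K n | (cs n (pt Phis 0 w) < k)%N)
               (1 - mean psis rates n k) * label_mean Rs lambdas (cs n) k) -
         \sum_(0 <= k < K n) (1 - mean psib rateb n k) * label_mean Rb lambdab (cb n) k).
have XY n : \int[P]_w Xn n w = \int[P]_w Yn n w.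
  rewrite /Xn /Yn -(EE n).
  apply: (@expectation_grid _ _ _ P Phis Phib Hs Ht (cs n) (cb n) (K n)
    (phi rates n) (phi rateb n) (mean psis rates n) (mean psib rateb n) Rs Rb
    lambdas lambdab ind PPPs PPPb) => //.
  - by move=> p; exact: grid_label_le (K_s n).
  - by move=> p; exact: grid_label_le (K_b n).
  - by move=> k y; exact: phi01.
  - by move=> k y; exact: phi01.
  - by move=> y; rewrite /phi ltnn.
  - by move=> y; rewrite /phi ltnn.
  - by move=> i k; exact: phi_mean.
  - by move=> i k; exact: phi_mean.
  - by move=> w i; exact: grid_nearest.
have cvg_s w : E w ->
    \sum_(0 <= k < K n | (cs n (pt Phis 0 w) < k)%N)
       (1 - mean psis rates n k) * label_mean Rs lambdas (cs n) k @[n --> \oo] -->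
    2 * pi * scaled_density lambdas Rs Ru *
       \int[mu]_(v in Is) (v * ((D w < v)%R%:R * (1 - psis (rates v)))).
  move=> Ew; have [_ D0] := visible_dist Ru_lt_Rs (E_first Ew).
  by under eq_fun do rewrite first_cell//; exact: sat_exponent_cvg.
have h_cvg w : E w -> hn n (cs n (pt Phis 0 w)) @[n --> \oo] --> hl (D w).
  move=> Ew; have [_ D0] := visible_dist Ru_lt_Rs (E_first Ew).
  by under eq_fun do rewrite first_cell//; exact: hnl.
have uE : unit_rv (\1_E : T -> R) by exact: unit_rv_indic.
have u_hn n : unit_rv (fun w => hn n (cs n (pt Phis 0 w))).
  by apply: (unit_rv_select (F := fun k _ => hn n k)) => // k; exact: unit_rv_cst.
have Xcvg w : Xn n w @[n --> \oo] --> \1_E w * hl (D w) * transform_visible w.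
  rewrite /Xn indicE; case: (boolP (w \in E)) => [/set_mem Ew|_]; last first.
    by under eq_fun do rewrite !mul0r; rewrite !mul0r; exact: cvg_cst.
  have [_ D0] := visible_dist Ru_lt_Rs (E_first Ew).
  rewrite /transform_visible mulrA; apply: cvgM; first apply: cvgM.
  - by apply: cvgM; [exact: cvg_cst|exact: h_cvg].
  - under eq_fun do rewrite first_cell//.
    apply: (prod_points_cvg (Q := fun n k => (cell n (D w) < k)%N) (q := fun x => D w < x)) => //.
    by move=> x x0; apply: near_cell_lt; exact: ltW.
  - have := @prod_points_cvg Phib Ht Rb rateb (fun _ _ => true) (fun _ => true) w
      Ru_lt_Rb K_b rateb_ge0 rateb_cont.
    move=> /(_ (fun _ _ => nearW _ (fun _ => erefl))).
    rewrite (eq_bigl (fun i : 'I_(npts Phib w) => pt Phib i w \in visible Rb Ru theta))//.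
    by move=> i; rewrite andbT.
have Ycvg w : Yn n w @[n --> \oo] --> \1_E w * hl (D w) * transform_mean (D w).
  rewrite /Yn indicE; case: (boolP (w \in E)) => [/set_mem Ew|_]; last first.
    by under eq_fun do rewrite !mul0r; rewrite !mul0r; exact: cvg_cst.
  apply: cvgM; first by apply: cvgM; [exact: cvg_cst|exact: h_cvg].
  apply: (continuous_cvg _ (@continuous_expR R _)).
  by apply: cvgB; [apply: cvgN; exact: cvg_s|exact: base_exponent_cvg].
have uX n : unit_rv (Xn n).
  apply: unit_rvM; first apply: unit_rvM; first exact: unit_rvM.
    apply: (unit_rv_select (L := fun w => cs n (pt Phis 0 w))
      (F := fun j w => \prod_(i < npts Phis w | (j < cs n (pt Phis i w))%N)
        phi rates n (cs n (pt Phis i w)) (Hs i w))) => // j.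
    rewrite (_ : (fun w => _) = (fun w => \prod_(i < npts Phis w)
      if (j < cs n (pt Phis i w))%N then phi rates n (cs n (pt Phis i w)) (Hs i w) else 1)); last first.
      by apply/funext => w; rewrite big_mkcond.
    apply: (unit_rv_prod_points Phis (F := fun i k w => if (j < k)%N then phi rates n k (Hs i w) else 1)) => // i k.
    case: (j < k)%N; last by apply: unit_rv_cst; rewrite ler01 lexx.
    by apply: (unit_rv_comp (measurable_funPT (Hs i)) (mphi rates n k)) => y; exact: phi01.
  apply: (unit_rv_prod_points Phib (F := fun i k w => phi rateb n k (Ht i w))) => // i k.
  by apply: (unit_rv_comp (measurable_funPT (Ht i)) (mphi rateb n k)) => y; exact: phi01.
have uY n : unit_rv (Yn n).
  apply: unit_rvM; first exact: unit_rvM.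
  apply: (unit_rv_select (L := fun w => cs n (pt Phis 0 w)) (F := fun j _ =>
     expR (- (\sum_(0 <= k < K n | (j < k)%N)
               (1 - mean psis rates n k) * label_mean Rs lambdas (cs n) k) -
         \sum_(0 <= k < K n) (1 - mean psib rateb n k) * label_mean Rb lambdab (cb n) k))) => // j.
  apply: unit_rv_cst; rewrite expR_ge0/= expR_le1 -opprD oppr_le0 addr_ge0//.
    apply: sumr_ge0 => k _; apply: mulr_ge0; last exact: label_mean_ge0.
    by rewrite subr_ge0; have /andP[] := mean01 n k rates_ge0 psisE.
  apply: sumr_ge0 => k _; apply: mulr_ge0; last exact: label_mean_ge0.
  by rewrite subr_ge0; have /andP[] := mean01 n k rateb_ge0 psibE.
split; [exact: unit_rv_cvg uX Xcvg|exact: unit_rv_cvg uY Ycvg|].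
have cX := bounded_convergence (P := P) uX Xcvg.
have cY := bounded_convergence (P := P) uY Ycvg.
rewrite (funext XY) in cX.
by rewrite -(cvg_lim (@Rhausdorff R) cX) -(cvg_lim (@Rhausdorff R) cY).
Qed.

Let mD : measurable_fun setT D.
Proof. exact: (measurableT_comp (measurable_euclid_dist Ru) (measurable_funPT (pt Phis 0))). Qed.

Let unit_one : [/\ unit_rv (fun w => \1_E w * transform_visible w),
      unit_rv (fun w => \1_E w * transform_mean (D w)) & True].
Proof.
have c01 (n k : nat) : 0 <= (1 : R) <= 1 by rewrite ler01 lexx.
have c1 (x : R) : 0 < x -> (1 : R) @[n --> \oo] --> (1 : R) by move=> _; exact: cvg_cst.
have [u1 u2 _] := @grid_limit (fun _ _ => 1) (fun _ => 1) c01 c1.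
split=> //.
  by move: u1; under eq_fun do rewrite mulr1.
by move: u2; under eq_fun do rewrite mulr1.
Qed.

Lemma unit_rv_transform_visible : unit_rv (fun w => \1_E w * transform_visible w).
Proof. by case: unit_one. Qed.

Lemma unit_rv_transform_mean : unit_rv (fun w => \1_E w * transform_mean (D w)).
Proof. by case: unit_one. Qed.

Lemma expectation_transform_visible (B : set R) : measurable B ->
  (\int[P]_(w in E `&` D @^-1` B) (transform_visible w)%:E =
   \int[P]_(w in E `&` D @^-1` B) (transform_mean (D w))%:E)%E.
Proof.
move=> mB.
have key : (\int[P]_w (\1_E w * transform_visible w * \1_B (D w))%:E =
    \int[P]_w (\1_E w * transform_mean (D w) * \1_B (D w))%:E)%E.
  apply: (@eq_integral_weight_rays _ _ _ _ _ P P
    (fun w => \1_E w * transform_visible w) (fun w => \1_E w * transform_mean (D w)) D D) => //.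
  - exact: unit_rv_transform_visible.1.
  - exact: unit_rv_transform_mean.1.
  - by move=> w; exact: (unit_rv_ge0 w unit_rv_transform_visible).
  - by move=> w; exact: (unit_rv_ge0 w unit_rv_transform_mean).
  - by rewrite -EFin_unit_rv ?ltry//; exact: unit_rv_transform_visible.
  - move=> y.
    have h01 (n k : nat) : 0 <= ((k < cell n y)%N%:R : R) <= 1.
      by case: (k < cell n y)%N; rewrite ?lexx ?ler01.
    have hc (x : R) : 0 < x -> (cell n x < cell n y)%N%:R @[n --> \oo] --> ((x < y)%R%:R : R).
      by move=> x0; apply: cvg_cell_lt; exact: ltW.
    have [u1 u2 eq12] := @grid_limit (fun n k => (k < cell n y)%N%:R)
      (fun x => (x < y)%R%:R) h01 hc.
    have iE x : \1_(`]-oo, y[) x = (x < y)%R%:R :> R.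
      rewrite indicE; congr (nat_of_bool _)%:R.
      by apply/idP/idP => [/set_mem/=|h]; [|apply/mem_set; rewrite /=]; rewrite in_itv.
    transitivity (\int[P]_w (\1_E w * (D w < y)%R%:R * transform_visible w)%:E)%E.
      by apply: eq_integral => w _; rewrite iE mulrAC.
    transitivity (\int[P]_w (\1_E w * (D w < y)%R%:R * transform_mean (D w))%:E)%E.
      by rewrite -!EFin_unit_rv// eq12.
    by apply: eq_integral => w _; rewrite iE mulrAC.
have cut (f : T -> R) : (\int[P]_w (\1_E w * f w * \1_B (D w))%:E =
    \int[P]_(w in E `&` D @^-1` B) (f w)%:E)%E.
  rewrite [RHS]integral_mkcond; apply: eq_integral => w _.
  rewrite patchE in_setI !indicE; have -> : (w \in D @^-1` B) = (D w \in B) by [].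
  by case: (w \in E); case: (D w \in B); rewrite ?mul1r ?mul0r ?mulr1 ?mulr0.
by rewrite -!cut.
Qed.

End conditional_transform.

(** * From fading transforms to the interference *)

(** The region depends on [w] because the cap removed around the user has the random radius
    [D w]. *)
Lemma measurable_received_power {R : realType} d (T : measurableType d)
    (P : probability T R) (Phi : point_process P) (A : T -> set (R * R * R))
    (Ru g alpha : R) (H : nat -> {RV P >-> R}) :
  (forall n, measurable [set w | pt Phi n w \in A w]) ->
  measurable_fun setT (fun w => received_power Phi (A w) (user Ru) g alpha H w).
Proof.
move=> mA.
apply: (measurable_select (F := fun N w => \sum_(n < N | pt Phi n w \in A w)
   g * H n w * euclid_dist (pt Phi n w) (user Ru) `^ (- alpha))) => N.
  exact: measurable_npts.
rewrite (_ : (fun w => _) = (fun w => \sum_(n < N) \1_[set w | pt Phi n w \in A w] w *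
   (g * H n w * euclid_dist (pt Phi n w) (user Ru) `^ (- alpha)))); last first.
  apply/funext => w; rewrite big_mkcond; apply: eq_bigr => n _.
  rewrite indicE; case: (boolP (pt Phi n w \in A w)) => h.
    by rewrite mem_set// mul1r.
  by rewrite memNset ?mul0r//=; exact/negP.
apply: measurable_sum => n; apply: measurable_funM; first exact: measurable_indic.
apply: measurable_funM; first by apply: measurable_funM => //; exact: measurable_funPT.
apply: (measurableT_comp (measurable_powR (- alpha))).
exact: (measurableT_comp (measurable_euclid_dist Ru) (measurable_funPT (pt Phi n))).
Qed.

(** [Num.sqrt] is 0 at negative numbers, so negative values of [H] lie in the event that the root is
    0, which a density makes null. *)
Lemma ae_ge0_of_sqrt_density {R : realType} d (T : measurableType d)
    (P : probability T R) (H : {RV P >-> R}) (f : R -> R) :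
  has_density P (fun w => Num.sqrt (H w)) f -> {ae P, forall w, 0 <= H w}.
Proof.
move=> Hf; exists [set w | Num.sqrt (H w) = 0]; split.
- rewrite -[X in measurable X]setTI.
  have m : measurable_fun setT (fun w => Num.sqrt (H w)).
    apply: measurableT_comp; last exact: measurable_funPT.
    by apply: continuous_measurable_fun; exact: sqrt_continuous.
  exact: (m measurableT [set 0] (measurable_set1 0)).
- by have := Hf [set 0] (measurable_set1 0); rewrite integral_set1.
- by move=> w /negP; rewrite -ltNge => /ltW/ler0_sqrtr.
Qed.

(** The visible cap has positive area because [Rmin < Rmax], so the probability that it is empty,
    [expR (- rate)], is less than 1. *)
Lemma probability_visible_gt0 {R : realType} d (T : measurableType d)
    (P : probability T R) (Phi : point_process P) (Ro Ru theta lambda : R) :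
  0 < Ru -> Ru < Ro -> 0 <= theta -> theta < pi / 2 -> 0 < lambda ->
  homogeneous_PPP_on_sphere Ro lambda Phi ->
  (0 < P [set w | (1 <= npoints_in Phi (visible Ro Ru theta) w)%N])%E.
Proof.
move=> Ru0 RuRo t0 tpi l0 PPP; set E := [set w | _].
have mV := @measurable_visible R Ro Ru theta.
have mE : measurable E.
  by apply: (@process_sigma_measurable _ _ _ _ Phi); exact: process_sigma_visible.
rewrite lt0e measure_ge0 andbT; apply/negP => /eqP E0.
have rR := Rmin_lt_Rmax Ru0 RuRo t0 tpi; have r0 := Rmin_gt0 RuRo.
pose rate := lambda * fine (sphere_area Ro (visible Ro Ru theta)).
have rate_gt0 : 0 < rate.
  rewrite mulr_gt0//.
  have -> : visible Ro Ru theta = [set p | visible Ro Ru theta p /\ setT (euclid_dist p (user Ru))].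
    by apply/seteqP; split => p //= -[].
  rewrite fine_sphere_area_annulus// mulr_gt0//.
    by rewrite !mulr_gt0 ?pi_gt0 ?divr_gt0 ?invr_gt0// (lt_trans Ru0).
  rewrite /Rintegral; under eq_integral do rewrite indicT mulr1.
  have dsqr (v : R) : is_derive v 1 (fun v : R => v ^+ 2 / 2) v.
    by apply: is_derive_eq; rewrite /GRing.scale/=; field.
  rewrite (integral_itv_FTC2 false (ltW rR) _ dsqr); last by move=> v; exact: cvg_id.
  rewrite /= -mulrBl divr_gt0// subr_gt0 ltr_sqr ?nnegrE ?ltW// (lt_trans r0)//.
(* At 0 the generating function is the void probability, since [0 ^+ n] is 1 for [n = 0] and 0
   otherwise. *)
have := @poisson_pgf _ _ _ P (npoints_in Phi (visible Ro Ru theta)) rate 0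
  (measurable_npoints_in Phi mV) (ltW rate_gt0).
rewrite lexx ler01 => /(_ isT (fun B => PPP.1 _ B mV)).
rewrite (_ : \int[P]_w _ = 1); last first.
  transitivity (\int[P]_w \1_(~` E) w).
    apply: eq_Rintegral => w _; rewrite indicE; case: (posnP (npoints_in Phi (visible Ro Ru theta) w)) => N0.
      by rewrite N0 expr0 mem_set// /E/= N0.
    by rewrite expr0n gtn_eqF// memNset// => h; exact: h.
  rewrite Rintegral_indic1; last exact: measurableC.
  by rewrite probability_setC// E0 sube0.
rewrite subr0 mul1r => /esym/eqP; rewrite -expR0 (inj_eq (@expR_inj R)) oppr_eq0.
by rewrite gt_eqF.
Qed.

Theorem lemma7 (d : measure_display) (T : measurableType d) (R : realType)
  (P : probability T R)
  (* geometry *)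
  (Ru Rs Rb theta lambda_s lambda_b : R)
  (Ru_gt0 : 0 < Ru) (Ru_lt_Rs : Ru < Rs) (Ru_lt_Rb : Ru < Rb)
  (theta_ge0 : 0 <= theta) (theta_lt : theta < pi / 2)
  (lambda_s_gt0 : 0 < lambda_s) (lambda_b_gt0 : 0 < lambda_b)
  (* gains, powers and path-loss exponents *)
  (fc c0 Gu_side Gs_side Gb_side Ps Pb sigma2 alpha_s alpha_t : R)
  (fc_gt0 : 0 < fc) (c0_gt0 : 0 < c0)
  (Gu_side_gt0 : 0 < Gu_side) (Gs_side_gt0 : 0 < Gs_side)
  (Gb_side_gt0 : 0 < Gb_side)
  (Ps_gt0 : 0 < Ps) (Pb_gt0 : 0 < Pb) (sigma2_gt0 : 0 < sigma2)
  (alpha_s_gt0 : 0 < alpha_s) (alpha_t_gt0 : 0 < alpha_t)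
  (* fading parameters *)
  (b Omega mt : R) (ms : nat)
  (b_gt0 : 0 < b) (Omega_gt0 : 0 < Omega) (mt_gt0 : 0 < mt)
  (ms_gt0 : (0 < ms)%N)
  (* point processes and fading powers *)
  (Phis Phib : point_process P) (Hs Ht : nat -> {RV P >-> R})
  (Phis_PPP : homogeneous_PPP_on_sphere Rs lambda_s Phis)
  (Phib_PPP : homogeneous_PPP_on_sphere Rb lambda_b Phib)
  (x1_nearest : first_is_nearest Phis (visible Rs Ru theta) (user Ru))
  (Hs_law : forall n, has_density P (fun w => Num.sqrt (Hs n w))
                        (shadowed_rician_pdf b Omega ms))
  (Ht_law : forall m, has_density P (fun w => Num.sqrt (Ht m w))
                        (nakagami_pdf mt))
  (indep : independent_network Phis Phib Hs Ht)
  (s : R) (s_ge0 : 0 <= s) :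
  let u := user Ru in
  let As := visible Rs Ru theta in
  let Ab := visible Rb Ru theta in
  let Gs := link_gain Gu_side Gs_side c0 fc in
  let Gb := link_gain Gu_side Gb_side c0 fc in
  let I := fun (r : R) (w : T) =>
    received_power Phis (As `\` cap Rs Ru r) u (Gs * Ps) alpha_s Hs w +
    received_power Phib Ab u (Gb * Pb) alpha_t Ht w + sigma2 in
  is_cond_expectation P
    (fun w => euclid_dist (pt Phis 0 w) u)
    [set w | (1 <= npoints_in Phis As w)%N]
    `[Rmin Rs Ru, Rmax Rs Ru theta]
    (fun r w => expR (- s * I r w))
    (fun r =>
       expR (- s * sigma2
         - 2 * pi * scaled_density lambda_s Rs Ru *
             \int[lebesgue_measure]_(v in `[r, Rmax Rs Ru theta])
               ((1 - \sum_(z < ms) SR_zeta b Omega ms z * Gamma (z.+1)%:R /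
                       (SR_beta b - SR_c b Omega ms
                        + s * Gs * Ps * v `^ (- alpha_s)) ^+ z.+1) * v)
         - 2 * pi * scaled_density lambda_b Rb Ru *
             \int[lebesgue_measure]_(w in `[Rmin Rb Ru, Rmax Rb Ru theta])
               ((1 - (1 + s * Gb * Pb * w `^ (- alpha_t) / mt) `^ (- mt)) * w))).
Proof.
move=> u As Ab Gs Gb I.
(* Kummer's transformation is available for the parameter [m.+1]. *)
case: ms ms_gt0 Hs_law => // m _ Hs_law'.
pose rates (v : R) : R := s * Gs * Ps * v `^ (- alpha_s).
pose rateb (w : R) : R := s * Gb * Pb * w `^ (- alpha_t).
pose psis (a : R) : R := \sum_(z < m.+1) SR_zeta b Omega m.+1 z * Gamma (z.+1)%:R /
  (SR_beta b - SR_c b Omega m.+1 + a) ^+ z.+1.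
pose psib (a : R) : R := (1 + a / mt) `^ (- mt).
pose D w := euclid_dist (pt Phis 0 w) u.
pose E := [set w | (1 <= npoints_in Phis As w)%N].
have gain_ge0 G : 0 < G -> 0 <= link_gain Gu_side G c0 fc.
  by move=> G0; rewrite /link_gain mulr_ge0 ?sqr_ge0// (mulr_ge0 (ltW Gu_side_gt0) (ltW G0)).
have rates_ge0 x : 0 <= rates x.
  by rewrite mulr_ge0 ?powR_ge0// (mulr_ge0 (mulr_ge0 s_ge0 (gain_ge0 _ Gs_side_gt0)) (ltW Ps_gt0)).
have rateb_ge0 x : 0 <= rateb x.
  by rewrite mulr_ge0 ?powR_ge0// (mulr_ge0 (mulr_ge0 s_ge0 (gain_ge0 _ Gb_side_gt0)) (ltW Pb_gt0)).
have powR_cont (a x : R) : 0 < x -> {for x, continuous (fun v : R => v `^ a)}.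
  move=> x0; apply: differentiable_continuous; apply/derivable1_diffP.
  by apply: derivable_powR; rewrite in_itv/= x0.
have rates_cont (x : R) : 0 < x -> {for x, continuous rates}.
  by move=> x0; apply: cvgM; [exact: cvg_cst|exact: powR_cont].
have rateb_cont (x : R) : 0 < x -> {for x, continuous rateb}.
  by move=> x0; apply: cvgM; [exact: cvg_cst|exact: powR_cont].
have msqrt (H : {RV P >-> R}) : measurable_fun setT (fun w => Num.sqrt (H w)).
  apply: measurableT_comp; last exact: measurable_funPT.
  by apply: continuous_measurable_fun; exact: sqrt_continuous.
have psisE n a : 0 <= a -> \int[P]_w expR (- (a * Num.sqrt (Hs n w) ^+ 2)) = psis a.
  exact: (shadowed_rician_laplace b_gt0 Omega_gt0 (msqrt (Hs n)) (Hs_law' n)).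
have psibE n a : 0 <= a -> \int[P]_w expR (- (a * Num.sqrt (Ht n w) ^+ 2)) = psib a.
  exact: (nakagami_laplace mt_gt0 (msqrt (Ht n)) (Ht_law n)).
pose V := transform_visible Ru Rs Rb theta Phis Phib Hs Ht rates rateb.
pose M := transform_mean Ru Rs Rb theta lambda_s lambda_b rates rateb psis psib.
pose c := expR (- s * sigma2).
pose f r := expR (- s * sigma2
         - 2 * pi * scaled_density lambda_s Rs Ru *
             \int[lebesgue_measure]_(v in `[r, Rmax Rs Ru theta])
               ((1 - \sum_(z < m.+1) SR_zeta b Omega m.+1 z * Gamma (z.+1)%:R /
                       (SR_beta b - SR_c b Omega m.+1
                        + s * Gs * Ps * v `^ (- alpha_s)) ^+ z.+1) * v)
         - 2 * pi * scaled_density lambda_b Rb Ru *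
             \int[lebesgue_measure]_(w in `[Rmin Rb Ru, Rmax Rb Ru theta])
               ((1 - (1 + s * Gb * Pb * w `^ (- alpha_t) / mt) `^ (- mt)) * w)).
have fE r : `[Rmin Rs Ru, Rmax Rs Ru theta]%classic r -> f r = c * M r.
  move=> rI; rewrite /f /c /M /transform_mean -expRD; congr expR.
  rewrite (Rintegral_above Ru_lt_Rs rates_ge0 rates_cont psisE rI).
  rewrite (_ : \int[lebesgue_measure]_(w in `[Rmin Rb Ru, Rmax Rb Ru theta]) _ =
    \int[lebesgue_measure]_(v in `[Rmin Rb Ru, Rmax Rb Ru theta]) (v * (1 - psib (rateb v)))).
    by rewrite addrA.
  by apply: eq_Rintegral => v _; rewrite mulrC.
have c01 : 0 <= c <= 1.
  by rewrite expR_ge0/= expR_le1 mulNr oppr_le0 mulr_ge0 ?(ltW sigma2_gt0).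
(* The identity needs nonnegative fading powers: only then is [Num.sqrt H ^+ 2] equal to [H]. *)
have XE w : (forall n, 0 <= Hs n w) -> (forall n, 0 <= Ht n w) ->
    expR (- s * I (D w) w) = c * V w.
  move=> Hs0 Ht0; rewrite /I /V /transform_visible /c.
  rewrite (_ : - s * _ = - s * sigma2 + (- s * received_power Phis (As `\` cap Rs Ru (D w)) u (Gs * Ps) alpha_s Hs w +
    - s * received_power Phib Ab u (Gb * Pb) alpha_t Ht w)); last by ring.
  rewrite expRD expRD; congr (_ * (_ * _)).
    rewrite /received_power mulr_sumr expR_sum; apply: eq_big => [n|n _].
      (* A visible point already lies on the sphere, so being outside the cap of radius [D w] means
         being strictly farther than [D w]. *)
      rewrite in_setD; case: (boolP (pt Phis n w \in As)) => //= /set_mem [sp _].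
      apply/idP/idP => [|h]; last by rewrite memNset//= => -[_]; rewrite leNgt h.
      by apply: contraLR; rewrite -leNgt negbK => h; exact/mem_set.
    by rewrite sqr_sqrtr// /rates; congr expR; ring.
  rewrite /received_power mulr_sumr expR_sum; apply: eq_bigr => n _.
  by rewrite sqr_sqrtr// /rateb; congr expR; ring.
have mD : measurable_fun setT D.
  exact: (measurableT_comp (measurable_euclid_dist Ru) (measurable_funPT (pt Phis 0))).
have mVs := @measurable_visible R Rs Ru theta.
have mVb := @measurable_visible R Rb Ru theta.
have mE : measurable E.
  by apply: (@process_sigma_measurable _ _ _ _ Phis); exact: process_sigma_visible.
have mX : measurable_fun setT (fun w => expR (- s * I (D w) w)).
  have mR : measurable_fun setT (@expR R).
    by apply: continuous_measurable_fun; exact: continuous_expR.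
  apply: (measurableT_comp mR); apply: measurable_funM => //.
  apply: measurable_funD => //; apply: measurable_funD.
    apply: measurable_received_power => n.
    rewrite (_ : [set w | _] = [set w | As (pt Phis n w)] `&`
       [set w | D w < euclid_dist (pt Phis n w) u]); last first.
      apply/seteqP; split => w /=; rewrite in_setD.
        move=> /andP[/set_mem Aw]; rewrite notin_setE => nC; split => //.
        by rewrite ltNge; apply/negP => h; apply: nC; split => //; exact: Aw.1.
      move=> [Aw h]; apply/andP; split; first exact: mem_set.
      by rewrite notin_setE => -[_]; rewrite leNgt h.
    apply: measurableI; first exact: (measurable_pt Phis n mVs).
    have mdn : measurable_fun setT (fun w => euclid_dist (pt Phis n w) u).
      exact: (measurableT_comp (measurable_euclid_dist Ru) (measurable_funPT (pt Phis n))).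
    rewrite -[X in measurable X]setTI.
    have /(_ measurableT [set true]) := measurable_fun_ltr mD mdn.
    by apply.
  apply: (measurable_received_power (A := fun=> Ab)) => n.
  rewrite (_ : [set w | _] = [set w | Ab (pt Phib n w)]).
    exact: (measurable_pt Phib n mVb).
  by apply/seteqP; split => w /= => [/set_mem|/mem_set].
have aeH : {ae P, forall w, (forall n, 0 <= Hs n w) /\ (forall n, 0 <= Ht n w)}.
  apply: filterS2 (ae_foralln (fun n => ae_ge0_of_sqrt_density (Hs_law' n)))
    (ae_foralln (fun n => ae_ge0_of_sqrt_density (Ht_law n))) => w Hs0 Ht0.
  by split.
have uV := unit_rv_transform_visible Ru_gt0 Ru_lt_Rs Ru_lt_Rb theta_ge0 theta_lt
  (ltW lambda_s_gt0) (ltW lambda_b_gt0) Phis_PPP Phib_PPP x1_nearest indep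
  rates_ge0 rateb_ge0 rates_cont rateb_cont psisE psibE.
have uM := unit_rv_transform_mean Ru_gt0 Ru_lt_Rs Ru_lt_Rb theta_ge0 theta_lt
  (ltW lambda_s_gt0) (ltW lambda_b_gt0) Phis_PPP Phib_PPP x1_nearest indep
  rates_ge0 rateb_ge0 rates_cont rateb_cont psisE psibE.
have main B := expectation_transform_visible (B := B) Ru_gt0 Ru_lt_Rs Ru_lt_Rb theta_ge0 theta_lt
  (ltW lambda_s_gt0) (ltW lambda_b_gt0) Phis_PPP Phib_PPP x1_nearest indep
  rates_ge0 rateb_ge0 rates_cont rateb_cont psisE psibE.
have X_ae S : measurable S -> S `<=` E ->
    (\int[P]_(w in S) (expR (- s * I (D w) w))%:E =
     \int[P]_(w in S) (c * (\1_E w * V w))%:E)%E.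
  move=> mS SE; apply: ae_eq_integral => //.
  - by apply/measurable_EFinP; exact: measurable_funTS.
  - apply/measurable_EFinP; apply: measurable_funTS.
    by apply: measurable_funM => //; exact: uV.1.
  - apply: filterS aeH => w [Hs0 Ht0] Sw.
    by rewrite XE// indicE mem_set ?mul1r//; exact: SE.
have ucV : unit_rv (fun w => c * (\1_E w * V w)).
  by apply: unit_rvM => //; exact: unit_rv_cst.
split.
- exact: probability_visible_gt0 Phis_PPP.
(* On the null set of negative fading powers the exponential has no evident bound; integrability is
   read off the [0, 1]-valued variable that equals it almost everywhere on [E]. *)
- apply/integrableP; split.
    by apply/measurable_EFinP; exact: measurable_funTS.
  under eq_integral do rewrite /= ger0_norm ?expR_ge0//.
  rewrite X_ae//.
  have /integrableP[_] := integrableS measurableT mE (@subsetT _ _) (unit_rv_integrable P ucV).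
  by under eq_integral do rewrite /= ger0_norm ?(unit_rv_ge0 _ ucV)//.
- have mM := measurable_transform_mean lambda_s lambda_b Ru_gt0 Ru_lt_Rs Ru_lt_Rb theta_ge0 theta_lt
    rates_ge0 rateb_ge0 rates_cont rateb_cont psisE psibE.
  apply: (eq_measurable_fun (fun r => c * M r)); last exact: measurable_funM.
  by move=> r /set_mem rI; rewrite -fE.
- move=> B mB Bdom.
  set S := E `&` D @^-1` B.
  have mS : measurable S.
    apply: measurableI => //; rewrite -[X in measurable X]setTI; exact: mD.
  have SE : S `<=` E by move=> w [].
  rewrite [LHS](X_ae _ mS SE).
  have pull (g : T -> R) : unit_rv (fun w => \1_E w * g w) ->
      (\int[P]_(w in S) (c * (\1_E w * g w))%:E = c%:E * \int[P]_(w in S) (g w)%:E)%E.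
    move=> ug; under eq_integral do rewrite EFinM.
    rewrite ge0_integralZl_EFin//; last 3 first.
    + by move=> w _; rewrite lee_fin; exact: (unit_rv_ge0 w ug).
    + by apply/measurable_EFinP; apply: measurable_funTS; exact: ug.1.
    + by have /andP[] := c01.
    congr (_ * _)%E; apply: eq_integral => w /set_mem Sw.
    by rewrite indicE mem_set ?mul1r//; exact: SE.
  rewrite (pull _ uV) (main B mB) -(pull (fun w => M (D w)) uM).
  apply: eq_integral => w /set_mem[Ew Bw].
  by rewrite indicE mem_set// mul1r -fE//; exact: Bdom.
Qed.
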